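(* Let $\mathcal{M}$ be a smooth manifold of positive dimension and $p,p'\ge 0$ integers with $p+p'=\dim\mathcal{M}$. Let $x\mapsto d\mu_x$ and $x\mapsto d\check\mu_x$ be two diffeomorphism invariant fields of non-zero invariant measures on the spaces $\Gamma_x$ of scalar products of signature $(p,p')$ on $T_x\mathcal{M}$, each constructed from some base point and some non-zero invariant measure there as described in the context. Let $\mathcal{B},\mathcal{S}$ (respectively $\check{\mathcal{B}},\check{\mathcal{S}}$) be the corresponding $C^*$-algebras of quantum observables and spaces of quantum states, and similarly let checked symbols denote all objects built from $d\check\mu_x$. Then: (i) there is a constant $c>0$ such that $d\check\mu_x=c\,d\mu_x$ for every $x\in\mathcal{M}$; (ii) for every finite subset $\lambda\subset\mathcal{M}$ the map $U_\lambda:\mathcal{H}_\lambda\to\check{\mathcal{H}}_\lambda$, $U_\lambda(\Psi)=(\sqrt{c})^{-\#\lambda}\,\Psi$, is a Hilbert space isomorphism, and the $C^*$-algebra isomorphisms $u_\lambda:\mathcal{B}_\lambda\to\check{\mathcal{B}}_\lambda$, $u_\lambda(a)=U_\lambda\circ a\circ U_\lambda^{-1}$, satisfy $\check\iota_{\lambda'\lambda}=u_{\lambda'}\circ\iota_{\lambda'\lambda}\circ u_\lambda^{-1}$ and $\check\pi_{\lambda\lambda'}=(u_\lambda^{-1})^*\circ\pi_{\lambda\lambda'}\circ u_{\lambda'}^*$ for all $\lambda'\ge\lambda$; (iii) the family $\{u_\lambda\}$ induces a $C^*$-algebra isomorphism $\mathcal{U}:\mathcal{B}\to\check{\mathcal{B}}$,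 and the family $\{u_\lambda^*\}$ of maps $u_\lambda^*:\check{\mathcal{S}}_\lambda\to\mathcal{S}_\lambda$ induces an isomorphism (bijection) $\mathcal{U}^*:\check{\mathcal{S}}\to\mathcal{S}$, such that $(\mathcal{U}^*(\check s))(a)=\check s(\mathcal{U}(a))$ for every $\check s\in\check{\mathcal{S}}$ and $a\in\mathcal{B}$.
   Context: Scalar products and measures. A scalar product on a real vector space $V$ is a non-degenerate symmetric bilinear form. The set $\Gamma$ of scalar products of a fixed signature on $V$ is an open subset of the vector space of symmetric bilinear forms on $V$, with induced topology. $GL(V)$ acts on it by $\bar g(\gamma)=(g^{-1})^*\gamma$. A regular Borel measure $d\mu$ on $\Gamma$ is invariant if its pushforward satisfies $\bar g_\star d\mu=d\mu$ for all $g\in GL(V)$. For a linear isomorphism $l:V\to W$, $(l^*\gamma)(v,v')=\gamma(lv,lv')$. The measure fields considered are those of the form $d\mu_x:=(l_x^* )_\star d\mu_{x_0}$, where $x_0\in\mathcal{M}$ is some base point, $d\mu_{x_0}$ is a non-zero invariant measure on $\Gamma_{x_0}$, and $l_x:T_x\mathcal{M}\to T_{x_0}\mathcal{M}$ is any linear isomorphism (the result does not depend on $l_x$). Construction from a measure field. $\Lambda$ is the set of all finite subsets of $\mathcal{M}$, ordered by $\lambda'\ge\lambda$ iff $\lambda\subset\lambda'$ ($\lambda'>\lambda$ if also $\lambda'\neq\lambda$). $\mathcal{H}_x:=L^2(\Gamma_x,d\mu_x)$ (complex), $\mathcal{H}_\lambda:=\mathcal{H}_{x_1}\otimes\dots\otimes\mathcal{H}_{x_N}$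 for $\lambda=\{x_1,\dots,x_N\}$ (the ordering of factors is chosen once and for all and is immaterial; $\mathcal{H}_\emptyset=\mathbb{C}$). For $\lambda'>\lambda$ one identifies $\mathcal{H}_{\lambda'}=\mathcal{H}_{\lambda'\setminus\lambda}\otimes\mathcal{H}_\lambda$ canonically. $\mathcal{B}_\lambda$ is the $C^*$-algebra of bounded operators on $\mathcal{H}_\lambda$ and $\mathcal{S}_\lambda$ the set of states (normed positive linear functionals) on $\mathcal{B}_\lambda$. For $\lambda'>\lambda$, $\iota_{\lambda'\lambda}:\mathcal{B}_\lambda\to\mathcal{B}_{\lambda'}$, $\iota_{\lambda'\lambda}(a)=\mathbf{1}\otimes a$ under this identification, and $\iota_{\lambda\lambda}=\mathrm{id}$; $\pi_{\lambda\lambda'}:=\iota_{\lambda'\lambda}^*:\mathcal{S}_{\lambda'}\to\mathcal{S}_\lambda$ is the pull-back $s\mapsto s\circ\iota_{\lambda'\lambda}$. $\mathcal{B}$ is the $C^*$-inductive limit of $\{\mathcal{B}_\lambda,\iota_{\lambda'\lambda}\}_{\lambda\in\Lambda}$ and $\mathcal{S}$ is the projective limit of $\{\mathcal{S}_\lambda,\pi_{\lambda\lambda'}\}_{\lambda\in\Lambda}$, i.e. the set of families $(s_\lambda)_\lambda$ with $s_\lambda\in\mathcal{S}_\lambda$ and $\pi_{\lambda\lambda'}s_{\lambda'}=s_\lambda$ for $\lambda'\ge\lambda$. Each $s=(s_\lambda)\in\mathcal{S}$ is identified with the unique state on $\mathcal{B}$ whose value on the image in $\mathcal{B}$ of $a\in\mathcal{B}_\lambda$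 is $s_\lambda(a)$; $s(a)$ for $a\in\mathcal{B}$ refers to this state. For a map $u:A\to B$ of algebras, $u^*$ denotes the pull-back $s\mapsto s\circ u$ of states; $\#\lambda$ is the number of elements of $\lambda$. *)

(* Defs.v *)
From HB Require Import structures.
From mathcomp Require Import all_boot all_order all_algebra finmap.
From mathcomp Require Import all_classical all_reals all_analysis.
From mathcomp Require Import measurable_realfun.
From mathcomp Require Import complex ring lra.
Set Implicit Arguments. Unset Strict Implicit. Unset Printing Implicit Defensive.
Import Order.TTheory GRing.Theory Num.Theory numFieldNormedType.Exports.
Local Open Scope classical_set_scope.
Local Open Scope ring_scope.
Local Open Scope complex_scope.
Local Notation normc := ComplexField.Normc.normc.

(* * Smooth manifolds and tangent spaces *)

(* On an open set U the last clause says that all iterated directional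
   derivatives of f up to order k exist and are continuous. *)
Fixpoint class_C (R : realType) (n m k : nat) (U : set 'rV[R]_n)
    (f : 'rV[R]_n -> 'rV[R]_m) : Prop :=
  match k with
  | 0 => forall x, U x -> {for x, continuous f}
  | k'.+1 => (forall x, U x -> differentiable f x) /\
             forall v, class_C k' U (fun x => 'D_v f x)
  end.

Definition smooth_on (R : realType) (n m : nat) (U : set 'rV[R]_n)
    (f : 'rV[R]_n -> 'rV[R]_m) : Prop := forall k, class_C k U f.

Record chart (R : realType) (n : nat) (M : topologicalType) := Chart {
  cdom : set M ;
  cmap : M -> 'rV[R]_n ;
  cinv : 'rV[R]_n -> M ;
  cdom_open : open cdom ;
  crange_open : open (cmap @` cdom) ;
  cmapK : forall x, cdom x -> cinv (cmap x) = x ;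
  cmap_cont : forall x, cdom x -> {for x, continuous cmap} ;
  cinv_cont : forall y, (cmap @` cdom) y -> {for y, continuous cinv} }.

Definition transition (R : realType) (n : nat) (M : topologicalType)
    (phi psi : chart R n M) : 'rV[R]_n -> 'rV[R]_n := cmap psi \o cinv phi.

Record manifold (R : realType) (n : nat) := Manifold {
  mpoint :> topologicalType ;
  manifold_hausdorff : hausdorff_space mpoint ;
  manifold_second_countable : @second_countable mpoint ;
  atlas : set (chart R n mpoint) ;
  atlas_cover : forall x, exists2 phi, atlas phi & cdom phi x ;
  atlas_smooth : forall phi psi, atlas phi -> atlas psi ->
    smooth_on (cmap phi @` (cdom phi `&` cdom psi)) (transition phi psi) }.

(* A tangent vector at x is given by its components in all the charts of the
   atlas around x, related by the derivatives of the transition maps; the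
   components in the other charts are set to 0. *)
Section TangentSpace.
Variables (R : realType) (n : nat) (M : manifold R n) (x : M).
Implicit Types (phi psi : chart R n M) (v : chart R n M -> 'rV[R]_n).

Definition chart_at phi : Prop := atlas phi /\ cdom phi x.

Definition is_tangent v : Prop :=
  (forall phi, ~ chart_at phi -> v phi = 0) /\
  (forall phi psi, chart_at phi -> chart_at psi ->
     v psi = 'd (transition phi psi) (cmap phi x) (v phi)).

Definition tangent_pred : {pred chart R n M -> 'rV[R]_n} :=
  fun v => `[< is_tangent v >].

Fact tangent_submod : submod_closed tangent_pred.
Proof.
split.
  apply/asboolP; split => // phi psi _ _.
  by rewrite linear0.
move=> k u v /asboolP[u0 uE] /asboolP[v0 vE]; apply/asboolP; split.
  by move=> phi Nphi; rewrite !fctE u0// v0// scaler0 addr0.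
by move=> phi psi cphi cpsi; rewrite !fctE linearP -uE// -vE.
Qed.

HB.instance Definition _ :=
  GRing.isSubmodClosed.Build _ _ tangent_pred tangent_submod.

Record tangent := Tangent { tcomp : chart R n M -> 'rV[R]_n ;
                            tangentP : tcomp \in tangent_pred }.

HB.instance Definition _ := [isSub for tcomp].
HB.instance Definition _ := [Choice of tangent by <:].
HB.instance Definition _ := [SubChoice_isSubLmodule of tangent by <:].

End TangentSpace.

(* Real vector spaces of dimension n. *)
HB.mixin Record hasDimension (R : realType) (n : nat) V & GRing.Lmodule R V := {
  coordinates_exist : exists f : {linear V -> 'rV[R]_n}, bijective f }.

#[short(type="fdspaceType")]
HB.structure Definition FdSpace (R : realType) (n : nat) :=
  {V of GRing.Lmodule R V & hasDimension R n V}.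

Section TangentDimension.
Variables (R : realType) (n : nat) (M : manifold R n) (x : M).

Let tr_diff phi psi : chart_at x phi -> chart_at x psi ->
  differentiable (@transition R n M phi psi) (cmap phi x).
Proof.
move=> [aphi dphi] [apsi dpsi].
have [+ _] := atlas_smooth aphi apsi 1.
by apply; exists x.
Qed.

Let tr_comp phi psi chi : chart_at x phi -> chart_at x psi -> chart_at x chi ->
  'd (@transition R n M phi chi) (cmap phi x) =
  'd (@transition R n M psi chi) (cmap psi x) \o
  'd (@transition R n M phi psi) (cmap phi x) :> (_ -> _).
Proof.
move=> cphi cpsi cchi.
have trx : transition phi psi (cmap phi x) = cmap psi x.
  by rewrite /transition /= cmapK//; case: cphi.
rewrite -trx -diff_comp; [|exact: tr_diff|by rewrite trx; exact: tr_diff].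
have dc : differentiable (transition psi chi \o transition phi psi) (cmap phi x).
  by apply: differentiable_comp; [exact: tr_diff|rewrite trx; exact: tr_diff].
apply/funext => v.
apply: etrans (esym (deriveE v (tr_diff cphi cchi))) _.
apply: etrans _ (deriveE v dc).
apply: near_eq_derive.
have [aphi dphi] := cphi; have [apsi dpsi] := cpsi.
have : \forall y \near cmap phi x, cdom psi (cinv phi y).
  have : {for cmap phi x, continuous (cinv phi)}.
    by apply: cinv_cont; exists x.
  apply; rewrite cmapK//; apply: open_nbhs_nbhs; split => //.
  exact: cdom_open.
apply: filterS => y dy.
by rewrite /transition /= cmapK.
Qed.

Fact tangent_coordinates :
  exists f : {linear tangent x -> 'rV[R]_n}, bijective f.
Proof.
have [phi aphi dphi] := @atlas_cover _ _ M x.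
have cphi : chart_at x phi by [].
pose f (v : tangent x) := tcomp v phi.
have fl : linear f by move=> k u v.
pose F : {linear tangent x -> 'rV[R]_n} :=
  HB.pack f (GRing.isLinear.Build _ _ _ _ f fl).
exists F.
pose g0 (w : 'rV[R]_n) (psi : chart R n M) : 'rV[R]_n :=
  if `[< chart_at x psi >] then 'd (transition phi psi) (cmap phi x) w else 0.
have g0P w : g0 w \in tangent_pred x.
  apply/asboolP; split.
    by move=> psi /asboolPn/negbTE; rewrite /g0 => ->.
  move=> psi chi cpsi cchi; rewrite /g0.
  move/asboolP: (cpsi) => ->; move/asboolP: (cchi) => ->.
  exact: (congr1 (fun h => h w) (tr_comp cphi cpsi cchi)).
have did w : 'd (transition phi phi) (cmap phi x) w = w.
  apply: etrans (esym (deriveE w (tr_diff cphi cphi))) _.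
  have -> : 'D_w (transition phi phi) (cmap phi x) = 'D_w id (cmap phi x).
    apply: near_eq_derive.
    have : open_nbhs (cmap phi x) (cmap phi @` cdom phi).
      by split; [exact: crange_open|exists x].
    move/open_nbhs_nbhs; apply: filterS => _ [y dy <-].
    by rewrite /transition /= cmapK.
  by rewrite derive_id.
exists (fun w => Tangent (g0P w)).
  move=> v; apply/val_inj => /=; apply/funext => psi; rewrite /g0 /f.
  have /asboolP[v0 vE] := tangentP v.
  case: asboolP => cpsi; first by rewrite -vE.
  by rewrite v0.
by move=> w; rewrite /F /= /f /= /g0; move/asboolP: cphi => ->; rewrite did.
Qed.

HB.instance Definition _ :=
  hasDimension.Build R n (tangent x) tangent_coordinates.

End TangentDimension.

(* * Scalar products of a given signature and measures on them *)

Section ScalarProducts.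
Variables (R : realType) (p q : nat).

Definition scalar_product (V : lmodType R) (g : V -> V -> R) : Prop :=
  [/\ forall u v, g u v = g v u,
      forall k u v w, g (k *: u + v) w = k * g u w + g v w
    & forall u, (forall v, g u v = 0) -> u = 0].

(* Signature (p, q): p plus signs and q minus signs in an orthonormal basis. *)
Definition has_signature (V : lmodType R) (g : V -> V -> R) : Prop :=
  exists e : 'I_(p + q) -> V,
    (forall v, exists a : 'I_(p + q) -> R, v = \sum_i a i *: e i) /\
    (forall i j, g (e i) (e j) =
       if i == j then (if (i < p)%N then 1 else -1) else 0).

Record Gamma (V : lmodType R) := MkGamma {
  gform :> V -> V -> R ;
  gformP : `[< scalar_product gform /\ has_signature gform >] }.

HB.instance Definition _ (V : lmodType R) := [isSub for @gform V].
HB.instance Definition _ (V : lmodType R) := [Choice of Gamma V by <:].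

(* The vector space topology on bilinear forms on a finite dimensional V is the
   topology of pointwise convergence; Gamma carries the induced one. *)
Definition gamma_eval (V : lmodType R) (g : Gamma V) : {ptws V * V -> R} :=
  fun uv => g uv.1 uv.2.

HB.instance Definition _ (V : lmodType R) :=
  Topological.copy (Gamma V) (initial_topology (@gamma_eval V)).

Fact Gamma_inhabited (V : fdspaceType R (p + q)) : exists g : Gamma V, True.
Proof.
have [f [f' fK f'K]] := @coordinates_exist _ _ V.
pose s (i : 'I_(p + q)) : R := if (i < p)%N then 1 else -1.
have s2 i : s i * s i = 1 by rewrite /s; case: ifP; rewrite ?mulrNN mulr1.
pose g (u v : V) : R := \sum_i s i * f u ord0 i * f v ord0 i.
pose e i : V := f' (delta_mx ord0 i).
have fe i j : f (e i) ord0 j = (j == i)%:R by rewrite /e f'K mxE eqxx.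
have gE u j : g u (e j) = s j * f u ord0 j.
  rewrite /g (bigD1 j)//= fe eqxx mulr1 big1 ?addr0// => i ij.
  by rewrite fe (negbTE ij) mulr0.
have gP : `[< scalar_product g /\ has_signature g >].
  apply/asboolP; split; first split.
  - by move=> u v; apply: eq_bigr => i _; ring.
  - move=> k u v w; rewrite /g mulr_sumr -big_split/=.
    by apply: eq_bigr => i _; rewrite linearP !mxE; ring.
  - move=> u gu0; apply: (can_inj fK); apply/rowP => i.
    rewrite linear0 mxE; have := gu0 (e i); rewrite gE => /(congr1 ( *%R (s i))).
    by rewrite mulrA s2 mul1r mulr0.
  exists e; split.
    move=> v; exists (fun i => f v ord0 i); apply: (can_inj fK).
    rewrite linear_sum/=; apply/rowP => j; rewrite summxE.
    rewrite (bigD1 j)//= linearZ mxE fe eqxx mulr1 big1 ?addr0// => i ij.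
    by rewrite linearZ mxE fe eq_sym (negbTE ij) mulr0.
  move=> i j; rewrite gE fe eq_sym; case: eqP => [->|_]; last by rewrite mulr0.
  by rewrite mulr1.
by exists (MkGamma gP).
Qed.

HB.instance Definition _ (V : fdspaceType R (p + q)) :=
  isPointed.Build (Gamma V) (projT1 (cid (Gamma_inhabited V))).

(* Gamma V with its Borel sigma-algebra. *)
Definition gammaB (V : fdspaceType R (p + q)) :=
  g_sigma_algebraType (@open (Gamma V)).

HB.instance Definition _ (V : fdspaceType R (p + q)) := Measurable.on (gammaB V).

Record liniso (V W : lmodType R) := LinIso {
  iso_fun :> {linear V -> W} ;
  iso_inv : {linear W -> V} ;
  iso_funK : cancel iso_fun iso_inv ;
  iso_invK : cancel iso_inv iso_fun }.

Definition liniso_inv (V W : lmodType R) (l : liniso V W) : liniso W V :=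
  LinIso (@iso_invK _ _ l) (@iso_funK _ _ l).

Fact pullback_subproof (V W : lmodType R) (l : liniso V W) (g : Gamma W) :
  `[< scalar_product (fun v v' => g (l v) (l v')) /\
      has_signature (fun v v' => g (l v) (l v')) >].
Proof.
have /asboolP[[gC gD g0] [e [espan eo]]] := gformP g.
apply/asboolP; split; first split.
- by move=> u v; rewrite gC.
- by move=> k u v w; rewrite linearP gD.
- move=> u u0; apply: (can_inj (@iso_funK _ _ l)); rewrite linear0.
  by apply: g0 => w; rewrite -(@iso_invK _ _ l w).
exists (iso_inv l \o e); split; last by move=> i j; rewrite /= !iso_invK.
move=> v; have [a va] := espan (l v); exists a.
apply: (can_inj (@iso_funK _ _ l)); rewrite va linear_sum/=.
by apply: eq_bigr => i _; rewrite linearZ/= iso_invK.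
Qed.

(* l^* : Gamma W -> Gamma V *)
Definition pullback (V W : lmodType R) (l : liniso V W) (g : Gamma W) : Gamma V :=
  MkGamma (pullback_subproof l g).

(* The action of GL(V) on Gamma V: the pull-back along the inverse. *)
Definition gl_action (V : lmodType R) (g : liniso V V) : Gamma V -> Gamma V :=
  pullback (liniso_inv g).

Section InvariantMeasures.
Variable V : fdspaceType R (p + q).
Variable mu : {measure set (gammaB V) -> \bar R}.

Local Open Scope ereal_scope.

Definition regular_borel : Prop :=
  [/\ forall K : set (Gamma V), compact K -> mu K < +oo,
      forall A : set (gammaB V), measurable A ->
        mu A = ereal_inf [set mu U | U in
                 [set U : set (Gamma V) | open U /\ A `<=` U]]
    & forall U : set (Gamma V), open U ->
        mu U = ereal_sup [set mu K | K in
                 [set K : set (Gamma V) | compact K /\ K `<=` U]]].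

Definition gl_invariant : Prop :=
  forall (g : liniso V V) (A : set (gammaB V)), measurable A ->
    pushforward mu (gl_action g : gammaB V -> gammaB V) A = mu A.

Definition nonzero_measure : Prop := mu setT != 0.

End InvariantMeasures.

End ScalarProducts.

Arguments gammaB {R} p q V.

(* M has dimension p + q, mu_x is a measure on the space of scalar products of
   signature (p, q) on T_x M *)
Definition measure_field (R : realType) (p q : nat) (M : manifold R (p + q)) :=
  forall x : M, {measure set (gammaB p q (tangent x)) -> \bar R}.

Definition invariant_field (R : realType) (p q : nat) (M : manifold R (p + q))
    (mu : measure_field M) : Prop :=
  exists (x0 : M) (mu0 : {measure set (gammaB p q (tangent x0)) -> \bar R})
         (l : forall x : M, liniso (tangent x) (tangent x0)),
    [/\ regular_borel mu0, gl_invariant mu0, nonzero_measure mu0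
      & forall (x : M) (A : set (gammaB p q (tangent x))), measurable A ->
          mu x A = pushforward mu0 (pullback (l x) : _ -> gammaB p q (tangent x)) A].


(* * Complex Hilbert spaces *)

(* The scalar product is antilinear in the first argument. *)
HB.mixin Record isHilbert (R : realType) H & GRing.Lmodule R[i] H := {
  inner : H -> H -> R[i] ;
  innerP : forall (k : R[i]) x y z,
    inner x (k *: y + z) = k * inner x y + inner x z ;
  inner_conj : forall x y, inner y x = (inner x y)^* ;
  inner_ge0 : forall x, 0 <= inner x x ;
  inner_eq0 : forall x, inner x x = 0 -> x = 0 ;
  hilbert_complete : forall u : nat -> H,
    (forall e : R, 0 < e -> exists N, forall m n, (N <= m)%N -> (N <= n)%N ->
       Num.sqrt (complex.Re (inner (u m - u n) (u m - u n))) < e) ->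
    exists l, forall e : R, 0 < e -> exists N, forall n, (N <= n)%N ->
       Num.sqrt (complex.Re (inner (u n - l) (u n - l))) < e }.

#[short(type="hilbertType")]
HB.structure Definition Hilbert (R : realType) :=
  {H of GRing.Lmodule R[i] H & isHilbert R H}.

Definition hnorm (R : realType) (H : hilbertType R) (x : H) : R :=
  Num.sqrt (complex.Re (inner x x)).

(* * The Hilbert space spanned by a positive definite kernel *)

(* A kernel on K that is Hermitian and positive semi-definite on kdom. *)
Record psdKernel (R : realType) (K : choiceType) := PsdKernel {
  kdom : set K ;
  kfun : K -> K -> R[i] ;
  kfun_conj : forall k l, kdom k -> kdom l -> kfun l k = (kfun k l)^* ;
  kfun_psd : forall s : seq (R[i] * K), all (fun a => `[< kdom a.2 >]) s ->
    0 <= \sum_(a <- s) \sum_(b <- s) a.1^* * b.1 * kfun a.2 b.2 }.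

Lemma quad_form_le (R : realType) (a b c : R) : 0 <= a -> 0 <= c ->
  (forall r : R, 0 <= a + 2 * r * b + r ^+ 2 * c) -> b <= Num.sqrt a * Num.sqrt c.
Proof.
move=> a0 c0 H; rewrite -sqrtrM//.
have [b0|b0] := leP b 0; first by rewrite (le_trans b0)// sqrtr_ge0.
rewrite -(ger0_norm (ltW b0)) -sqrtr_sqr ler_wsqrtr//.
have [cp|cN] := ltP 0 c.
  have := H (- (b / c)).
  have -> : a + 2 * - (b / c) * b + (- (b / c)) ^+ 2 * c = (a * c - b ^+ 2) / c.
    by field; rewrite gt_eqF.
  by rewrite pmulr_lge0 ?invr_gt0// subr_ge0.
have c00 : c = 0 by apply/eqP; rewrite eq_le cN c0.
have := H (- (a + 1) / (2 * b)).
have -> : a + 2 * (- (a + 1) / (2 * b)) * b + (- (a + 1) / (2 * b)) ^+ 2 * c = -1.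
  by rewrite c00; field; rewrite gt_eqF.
by rewrite oppr_ge0 ler10.
Qed.

Section KernelSpace.
Variables (R : realType) (K : choiceType) (k : psdKernel R K).
Local Notation C := R[i].

(* Finite formal linear combinations of elements of K. *)
Definition fsum : Type := seq (C * K).
HB.instance Definition _ := Choice.on fsum.
Implicit Types (s t r : fsum) (u v w : nat -> fsum).

Definition fsum_on s : bool := all (fun a => `[< kdom k a.2 >]) s.
Definition fscale (c : C) s : fsum := [seq (c * a.1, a.2) | a <- s].
Definition fadd s t : fsum := s ++ t.
Definition fsub s t : fsum := fadd s (fscale (-1) t).
Definition fip s t : C :=
  \sum_(a <- s) \sum_(b <- t) a.1^* * b.1 * kfun k a.2 b.2.
Definition fnorm s : R := Num.sqrt (complex.Re (fip s s)).

Definition fcauchy u : Prop :=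
  (forall n, fsum_on (u n)) /\
  forall e : R, 0 < e -> exists N, forall m n, (N <= m)%N -> (N <= n)%N ->
    fnorm (fsub (u m) (u n)) < e.

Definition fequiv u v : Prop :=
  forall e : R, 0 < e -> exists N, forall n, (N <= n)%N ->
    fnorm (fsub (u n) (v n)) < e.

Definition fclass u : set (nat -> fsum) := [set v | fcauchy v /\ fequiv u v].

(* The completion: classes of Cauchy sequences of formal linear combinations. *)
Record kspace := KSpace {
  kclass :> set (nat -> fsum) ;
  kclassP : `[< exists2 u, fcauchy u & kclass = fclass u >] }.

HB.instance Definition _ := [isSub for kclass].
HB.instance Definition _ := [Choice of kspace by <:].

Lemma fip_addl s t r : fip (fadd s t) r = fip s r + fip t r.
Proof. by rewrite /fip big_cat. Qed.

Lemma fip_addr s t r : fip r (fadd s t) = fip r s + fip r t.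
Proof. by rewrite /fip -big_split/=; apply: eq_bigr => a _; rewrite big_cat. Qed.

Lemma fip_scalel c s r : fip (fscale c s) r = c^* * fip s r.
Proof.
rewrite /fip big_map mulr_sumr; apply: eq_bigr => a _ /=.
by rewrite mulr_sumr; apply: eq_bigr => b _; rewrite rmorphM/=; ring.
Qed.

Lemma fip_scaler c s r : fip r (fscale c s) = c * fip r s.
Proof.
rewrite /fip mulr_sumr; apply: eq_bigr => a _ /=.
by rewrite big_map mulr_sumr; apply: eq_bigr => b _ /=; ring.
Qed.

Lemma fip_nill r : fip [::] r = 0. Proof. by rewrite /fip big_nil. Qed.
Lemma fip_nilr r : fip r [::] = 0.
Proof. by rewrite /fip big1// => a _; rewrite big_nil. Qed.

Definition fipE := (fip_addl, fip_addr, fip_scalel, fip_scaler, fip_nill, fip_nilr).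

Lemma fsum_on_add s t : fsum_on (fadd s t) = fsum_on s && fsum_on t.
Proof. by rewrite /fsum_on all_cat. Qed.

Lemma fsum_on_scale c s : fsum_on (fscale c s) = fsum_on s.
Proof. by rewrite /fsum_on all_map. Qed.

Lemma fsum_on_sub s t : fsum_on (fsub s t) = fsum_on s && fsum_on t.
Proof. by rewrite fsum_on_add fsum_on_scale. Qed.

Definition fsum_onE := (fsum_on_add, fsum_on_scale, fsum_on_sub).

Lemma fip_conj s t : fsum_on s -> fsum_on t -> fip t s = (fip s t)^*.
Proof.
move=> /allP os /allP ot; rewrite /fip exchange_big rmorph_sum/=.
rewrite !big_seq; apply: eq_bigr => a /os/asboolP ka; rewrite rmorph_sum/= !big_seq.
apply: eq_bigr => b /ot/asboolP kb.
by rewrite !rmorphM/= conjcK (kfun_conj ka kb); ring.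
Qed.

Lemma fip_ge0 s : fsum_on s -> 0 <= fip s s.
Proof. exact: kfun_psd. Qed.

Lemma fip_re_ge0 s : fsum_on s -> 0 <= complex.Re (fip s s).
Proof. by move=> /fip_ge0; rewrite lecE => /andP[]. Qed.

Lemma fip_im0 s : fsum_on s -> complex.Im (fip s s) = 0.
Proof. by move=> /fip_ge0; rewrite lecE => /andP[/eqP]. Qed.

Lemma fnorm_ge0 s : 0 <= fnorm s. Proof. exact: sqrtr_ge0. Qed.

Lemma fnorm2 s : fsum_on s -> fnorm s ^+ 2 = complex.Re (fip s s).
Proof. by move=> os; rewrite sqr_sqrtr// fip_re_ge0. Qed.

Lemma cReM (x y : C) : complex.Re (x * y) =
  complex.Re x * complex.Re y - complex.Im x * complex.Im y.
Proof. by case: x; case: y. Qed.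
Lemma cImM (x y : C) : complex.Im (x * y) =
  complex.Re x * complex.Im y + complex.Im x * complex.Re y.
Proof. by case: x => a b; case: y => c d /=; rewrite addrC. Qed.
Lemma cReD (x y : C) : complex.Re (x + y) = complex.Re x + complex.Re y.
Proof. by case: x; case: y. Qed.
Lemma cImD (x y : C) : complex.Im (x + y) = complex.Im x + complex.Im y.
Proof. by case: x; case: y. Qed.
Lemma cReJ (x : C) : complex.Re x^* = complex.Re x. Proof. by case: x. Qed.
Lemma cImJ (x : C) : complex.Im x^* = - complex.Im x. Proof. by case: x. Qed.

Lemma fip_re_sym s t : fsum_on s -> fsum_on t ->
  complex.Re (fip t s) = complex.Re (fip s t).
Proof. by move=> os ot; rewrite (fip_conj os ot) cReJ. Qed.

Lemma fip_re_le s t : fsum_on s -> fsum_on t ->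
  complex.Re (fip s t) <= fnorm s * fnorm t.
Proof.
move=> os ot; apply: quad_form_le; try exact: fip_re_ge0.
move=> r; have := @fip_re_ge0 (fadd s (fscale r%:C t)).
rewrite !fsum_onE os ot => /(_ isT).
rewrite !fipE !(cReD, cReM, cImM, cReJ, cImJ)/= (fip_re_sym os ot).
by congr (_ <= _); ring.
Qed.

Lemma fnorm_add s t : fsum_on s -> fsum_on t ->
  fnorm (fadd s t) <= fnorm s + fnorm t.
Proof.
move=> os ot; have := fip_re_le os ot => H.
rewrite -(@ler_pXn2r _ 2)// ?nnegrE ?addr_ge0 ?fnorm_ge0//.
rewrite fnorm2 ?fsum_onE ?os ?ot// sqrrD !fnorm2// !fipE !cReD (fip_re_sym os ot).
lra.
Qed.

Lemma fnorm_scale c s : fnorm (fscale c s) = normc c * fnorm s.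
Proof.
rewrite /fnorm !fipE mulrA.
have -> : c^* * c = (normc c ^+ 2)%:C.
  case: c => a b /=; rewrite sqr_sqrtr ?addr_ge0 ?sqr_ge0//.
  by apply/eqP; rewrite eq_complex/=; apply/andP; split; apply/eqP; ring.
rewrite cReM /= mul0r subr0 sqrtrM ?sqr_ge0// sqrtr_sqr ger0_norm//.
by case: c => a b; exact: sqrtr_ge0.
Qed.

Definition fext s t : Prop := forall r, fip r s = fip r t.

Lemma fnorm_ext s t : fsum_on s -> fsum_on t -> fext s t -> fnorm s = fnorm t.
Proof.
move=> os ot st; rewrite /fnorm; congr Num.sqrt.
by rewrite st -(fip_re_sym os ot) st.
Qed.

Lemma fnorm_subC s t : fsum_on s -> fsum_on t ->
  fnorm (fsub s t) = fnorm (fsub t s).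
Proof.
move=> os ot; transitivity (fnorm (fscale (-1) (fsub t s))).
  by apply: fnorm_ext; rewrite ?fsum_onE ?os ?ot// => r; rewrite !fipE; ring.
by rewrite fnorm_scale /= oppr0 expr0n/= addr0 sqrrN expr1n sqrtr1 mul1r.
Qed.

Lemma fnorm_tri t s r : fsum_on s -> fsum_on t -> fsum_on r ->
  fnorm (fsub s r) <= fnorm (fsub s t) + fnorm (fsub t r).
Proof.
move=> os ot or; apply: le_trans (fnorm_add _ _); rewrite ?fsum_onE ?os ?ot ?or//.
rewrite le_eqVlt; apply/orP; left; apply/eqP; apply: fnorm_ext;
  by rewrite ?fsum_onE ?os ?ot ?or// => q; rewrite !fipE; ring.
Qed.

Lemma fnorm_sub0 s t : fsum_on s -> fsum_on t -> fext s t -> fnorm (fsub s t) = 0.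
Proof.
move=> os ot st; rewrite (@fnorm_ext _ [::]) ?fsum_onE ?os//.
  by rewrite /fnorm fipE /= sqrtr0.
by move=> r; rewrite !fipE st; ring.
Qed.

Definition sadd u v n := fadd (u n) (v n).
Definition sscale c u n := fscale c (u n).

Lemma fcauchy_nil : fcauchy (fun=> [::]).
Proof.
split=> // e e0; exists 0 => m n _ _; rewrite fnorm_sub0//.
Qed.

Lemma fcauchy_add u v : fcauchy u -> fcauchy v -> fcauchy (sadd u v).
Proof.
move=> [ou cu] [ov cv]; split => [n|e e0]; first by rewrite fsum_onE ou ov.
have e2 : 0 < e / 2 by rewrite divr_gt0.
have [N1 H1] := cu _ e2; have [N2 H2] := cv _ e2.
exists (maxn N1 N2) => m n; rewrite !geq_max => /andP[a b] /andP[c d].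
have := @fnorm_add (fsub (u m) (u n)) (fsub (v m) (v n)).
rewrite !fsum_onE !ou !ov => /(_ isT isT).
rewrite (@fnorm_ext _ (fsub (sadd u v m) (sadd u v n))) ?fsum_onE ?ou ?ov//.
  have := H1 _ _ a c; have := H2 _ _ b d; lra.
by move=> r; rewrite !fipE; ring.
Qed.

Lemma fcauchy_scale c u : fcauchy u -> fcauchy (sscale c u).
Proof.
move=> [ou cu]; split => [n|e e0]; first by rewrite fsum_onE ou.
have nc0 : 0 <= normc c by case: (c) => a b; exact: sqrtr_ge0.
have nc1 : 0 < normc c + 1 by lra.
have [N H] := cu _ (divr_gt0 e0 nc1); exists N => m n Nm Nn.
rewrite (@fnorm_ext _ (fscale c (fsub (u m) (u n)))) ?fsum_onE ?ou//.
  rewrite fnorm_scale; have := H _ _ Nm Nn; rewrite ltr_pdivlMr//.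
  apply: le_lt_trans; rewrite mulrC ler_wpM2l ?fnorm_ge0//; lra.
by move=> r; rewrite !fipE; ring.
Qed.

Lemma fequiv_sym u v : fcauchy u -> fcauchy v -> fequiv u v -> fequiv v u.
Proof.
move=> [ou _] [ov _] uv e e0; have [N H] := uv _ e0; exists N => n /H.
by rewrite fnorm_subC.
Qed.

Lemma fequiv_trans v u w : fcauchy u -> fcauchy v -> fcauchy w ->
  fequiv u v -> fequiv v w -> fequiv u w.
Proof.
move=> [ou _] [ov _] [ow _] uv vw e e0.
have e2 : 0 < e / 2 by rewrite divr_gt0.
have [N1 H1] := uv _ e2; have [N2 H2] := vw _ e2.
exists (maxn N1 N2) => n; rewrite geq_max => /andP[a b].
have := fnorm_tri (ou n) (ov n) (ow n).
have := H1 _ a; have := H2 _ b; lra.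
Qed.

Lemma fequiv_ext u v : fcauchy u -> fcauchy v -> (forall n, fext (u n) (v n)) ->
  fequiv u v.
Proof.
move=> [ou _] [ov _] uv e e0; exists 0 => n _; rewrite fnorm_sub0//.
Qed.

Fact kzero_subproof :
  `[< exists2 u, fcauchy u & fclass (fun=> [::]) = fclass u >].
Proof. by apply/asboolP; exists (fun=> [::]); first exact: fcauchy_nil. Qed.

Definition kzero : kspace := KSpace kzero_subproof.

(* The class of a Cauchy sequence (0 if u is not a Cauchy sequence). *)
Definition kcls u : kspace := insubd kzero (fclass u).

Definition krepr (X : kspace) : nat -> fsum := xget (fun=> [::]) (kclass X).

Lemma val_kcls u : fcauchy u -> kclass (kcls u) = fclass u.
Proof.
by move=> cu; rewrite /kcls -[kclass _]/(val _) val_insubd ifT//; apply/asboolP; exists u.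
Qed.

Lemma kcls_eq u v : fcauchy u -> fcauchy v -> fequiv u v -> kcls u = kcls v.
Proof.
move=> cu cv uv; apply/val_inj => /=; rewrite !val_kcls//.
apply/seteqP; split => w [cw ?]; split => //.
  apply: (@fequiv_trans u) => //; exact: fequiv_sym.
exact: (@fequiv_trans v).
Qed.

Lemma kcls_ext u v : fcauchy u -> fcauchy v -> (forall n, fext (u n) (v n)) ->
  kcls u = kcls v.
Proof. by move=> cu cv uv; apply: kcls_eq => //; exact: fequiv_ext. Qed.

Lemma fequiv_refl u : fcauchy u -> fequiv u u.
Proof. by move=> cu; apply: fequiv_ext. Qed.

Lemma krepr_cls u : fcauchy u ->
  fcauchy (krepr (kcls u)) /\ fequiv u (krepr (kcls u)).
Proof.
move=> cu; have : kclass (kcls u) (krepr (kcls u)).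
  apply: (@xgetPex _ (fun=> [::]) (kclass (kcls u))); exists u; rewrite val_kcls//.
  by split => //; exact: fequiv_refl.
by rewrite {1}val_kcls// => -[].
Qed.

Lemma kspaceP (X : kspace) : exists2 u, fcauchy u & X = kcls u.
Proof.
have /asboolP[u cu Xu] := kclassP X; exists u => //.
by apply/val_inj; rewrite /= val_kcls.
Qed.

Definition kadd (X Y : kspace) : kspace := kcls (sadd (krepr X) (krepr Y)).
Definition kscale (c : C) (X : kspace) : kspace := kcls (sscale c (krepr X)).
Definition kopp (X : kspace) : kspace := kscale (-1) X.

Lemma kadd_cls u v : fcauchy u -> fcauchy v ->
  kadd (kcls u) (kcls v) = kcls (sadd u v).
Proof.
move=> cu cv; have [cu' uu'] := krepr_cls cu; have [cv' vv'] := krepr_cls cv.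
apply: kcls_eq; try exact: fcauchy_add.
have [ou _] := cu; have [ov _] := cv; have [ou' _] := cu'; have [ov' _] := cv'.
move=> e e0; have e2 : 0 < e / 2 by rewrite divr_gt0.
have [N1 H1] := uu' _ e2; have [N2 H2] := vv' _ e2.
exists (maxn N1 N2) => n; rewrite geq_max => /andP[a b].
have := @fnorm_add (fsub (u n) (krepr (kcls u) n)) (fsub (v n) (krepr (kcls v) n)).
rewrite !fsum_onE ou ov ou' ov' => /(_ isT isT).
rewrite [X in _ -> is_true (X < _)]fnorm_subC ?fsum_onE ?ou ?ov ?ou' ?ov'//.
rewrite (@fnorm_ext _ (fsub (sadd u v n)
    (sadd (krepr (kcls u)) (krepr (kcls v)) n))) ?fsum_onE ?ou ?ov ?ou' ?ov'//.
  have := H1 _ a; have := H2 _ b; lra.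
by move=> r; rewrite !fipE; ring.
Qed.

Lemma kscale_cls c u : fcauchy u -> kscale c (kcls u) = kcls (sscale c u).
Proof.
move=> cu; have [cu' uu'] := krepr_cls cu.
apply: kcls_eq; try exact: fcauchy_scale.
have [ou _] := cu; have [ou' _] := cu'.
have nc0 : 0 <= normc c by case: (c) => a b; exact: sqrtr_ge0.
have nc1 : 0 < normc c + 1 by lra.
move=> e e0; have [N H] := uu' _ (divr_gt0 e0 nc1); exists N => n Nn.
rewrite (@fnorm_ext _ (fscale c (fsub (krepr (kcls u) n) (u n)))) ?fsum_onE ?ou ?ou'//.
  rewrite fnorm_scale fnorm_subC//; have := H _ Nn; rewrite ltr_pdivlMr//.
  apply: le_lt_trans; rewrite mulrC ler_wpM2l ?fnorm_ge0//; lra.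
by move=> r; rewrite !fipE; ring.
Qed.

Fact kaddA : associative kadd.
Proof.
move=> X Y Z; have [u cu ->] := kspaceP X; have [v cv ->] := kspaceP Y.
have [w cw ->] := kspaceP Z; rewrite !kadd_cls; try by do ?apply: fcauchy_add.
by apply: kcls_ext; try (by do ?apply: fcauchy_add); move=> n r; rewrite !fipE; ring.
Qed.

Fact kaddC : commutative kadd.
Proof.
move=> X Y; have [u cu ->] := kspaceP X; have [v cv ->] := kspaceP Y.
rewrite !kadd_cls//.
by apply: kcls_ext; try (by do ?apply: fcauchy_add); move=> n r; rewrite !fipE; ring.
Qed.

Fact kzeroE : kzero = kcls (fun=> [::]).
Proof. by apply/val_inj => /=; rewrite val_kcls//; exact: fcauchy_nil. Qed.

Fact kadd0 : left_id kzero kadd.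
Proof.
move=> X; have [u cu ->] := kspaceP X; rewrite kzeroE kadd_cls//; last exact: fcauchy_nil.
Qed.

Fact kaddN : left_inverse kzero kopp kadd.
Proof.
move=> X; have [u cu ->] := kspaceP X.
rewrite kzeroE /kopp kscale_cls// kadd_cls//; last exact: fcauchy_scale.
apply: kcls_ext.
- by apply: fcauchy_add => //; exact: fcauchy_scale.
- exact: fcauchy_nil.
- by move=> n r; rewrite !fipE; ring.
Qed.

HB.instance Definition _ := GRing.isZmodule.Build kspace kaddA kaddC kadd0 kaddN.

Fact kscaleA a b X : kscale a (kscale b X) = kscale (a * b) X.
Proof.
have [u cu ->] := kspaceP X; rewrite !kscale_cls//; last exact: fcauchy_scale.
apply: kcls_ext; try by do ?apply: fcauchy_scale.
by move=> n r; rewrite !fipE; ring.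
Qed.

Fact kscale1 : left_id 1 kscale.
Proof.
move=> X; have [u cu ->] := kspaceP X; rewrite kscale_cls//.
apply: kcls_ext; try by do ?apply: fcauchy_scale.
by move=> n r; rewrite !fipE; ring.
Qed.

Fact kscaleDr : right_distributive kscale kadd.
Proof.
move=> a X Y; have [u cu ->] := kspaceP X; have [v cv ->] := kspaceP Y.
rewrite kadd_cls// !kscale_cls//; last exact: fcauchy_add.
rewrite kadd_cls//; try exact: fcauchy_scale.
apply: kcls_ext; try by do ?[apply: fcauchy_add|apply: fcauchy_scale].
by move=> n r; rewrite !fipE; ring.
Qed.

Fact kscaleDl X : {morph kscale^~ X : a b / a + b >-> kadd a b}.
Proof.
move=> a b; have [u cu ->] := kspaceP X.
rewrite !kscale_cls// kadd_cls//; try exact: fcauchy_scale.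
apply: kcls_ext; try by do ?[apply: fcauchy_add|apply: fcauchy_scale].
by move=> n r; rewrite !fipE; ring.
Qed.

HB.instance Definition _ :=
  GRing.Zmodule_isLmodule.Build C kspace kscaleA kscale1 kscaleDr kscaleDl.

Lemma kclsP c u v : fcauchy u -> fcauchy v ->
  c *: kcls u + kcls v = kcls (sadd (sscale c u) v).
Proof.
move=> cu cv.
have -> : c *: kcls u = kcls (sscale c u) by exact: kscale_cls.
by apply: kadd_cls => //; exact: fcauchy_scale.
Qed.

Lemma kclsB u v : fcauchy u -> fcauchy v ->
  kcls u - kcls v = kcls (fun n => fsub (u n) (v n)).
Proof.
move=> cu cv.
have -> : - kcls v = kcls (sscale (-1) v) by exact: kscale_cls.
by apply: kadd_cls => //; exact: fcauchy_scale.
Qed.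

Lemma fcauchy_sub u v : fcauchy u -> fcauchy v ->
  fcauchy (fun n => fsub (u n) (v n)).
Proof. by move=> cu cv; apply: fcauchy_add => //; exact: fcauchy_scale. Qed.

Definition kinner (X Y : kspace) : C :=
  limn (fun n => complex.Re (fip (krepr X n) (krepr Y n))) +i*
  limn (fun n => complex.Im (fip (krepr X n) (krepr Y n))).

Lemma fnorm_dist s t : fsum_on s -> fsum_on t ->
  `|fnorm s - fnorm t| <= fnorm (fsub s t).
Proof.
move=> os ot.
have H (a b : fsum) : fsum_on a -> fsum_on b -> fnorm a <= fnorm b + fnorm (fsub a b).
  move=> oa ob; have := @fnorm_add b (fsub a b); rewrite fsum_onE oa ob => /(_ isT isT).
  by apply: le_trans; rewrite (@fnorm_ext a (fadd b (fsub a b))) ?fsum_onE ?oa ?ob//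
    => r; rewrite !fipE; ring.
have := H s t os ot; have := H t s ot os; rewrite (fnorm_subC ot os).
by rewrite ler_norml => H1 H2; apply/andP; split; lra.
Qed.


Lemma fcauchy_norm_cvg u : fcauchy u -> cvgn (fnorm \o u).
Proof.
move=> [ou cu]; apply: cauchy_cvg; apply/cauchyP => e e0.
have [N H] := cu _ e0; exists (fnorm (u N)); exists N => // n Nn /=.
by apply: le_lt_trans (H _ _ (leqnn N) Nn); exact: fnorm_dist.
Qed.

Lemma fequiv_norm u v : fcauchy u -> fcauchy v -> fequiv u v ->
  limn (fnorm \o u) = limn (fnorm \o v).
Proof.
move=> cu cv uv; apply/eqP; rewrite -subr_eq0; apply/eqP.
rewrite -limB; try exact: fcauchy_norm_cvg.
apply/cvg_lim => //; apply/cvgrPdist_lt => e e0; have [N H] := uv _ e0.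
exists N => // n /= Nn; rewrite sub0r normrN.
have [ou _] := cu; have [ov _] := cv.
by apply: le_lt_trans (H _ Nn); exact: fnorm_dist.
Qed.

Definition kn u : R := limn (fnorm \o u).

Lemma re_polar s t : fsum_on s -> fsum_on t -> complex.Re (fip s t) =
  (fnorm (fadd s t) ^+ 2 - fnorm (fsub s t) ^+ 2) / 4.
Proof.
move=> os ot; rewrite !fnorm2 ?fsum_onE ?os ?ot//.
rewrite !fipE !(cReD, cReM, cImD, cImM, cReJ, cImJ)/= (fip_re_sym os ot).
by field.
Qed.

Lemma cvg_sqr (f : nat -> R) (a : R) : f @ \oo --> a ->
  (fun n => f n ^+ 2) @ \oo --> a ^+ 2.
Proof. by move=> fa; under eq_fun do rewrite expr2; rewrite expr2; exact: cvgM. Qed.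

Lemma re_cvg u v : fcauchy u -> fcauchy v ->
  (fun n => complex.Re (fip (u n) (v n))) @ \oo -->
  (kn (sadd u v) ^+ 2 - kn (fun n => fsub (u n) (v n)) ^+ 2) / 4.
Proof.
move=> cu cv; have [ou _] := cu; have [ov _] := cv.
under eq_fun do rewrite re_polar//.
apply: cvgM; last exact: cvg_cst.
apply: cvgB.
  by apply: cvg_sqr; apply: fcauchy_norm_cvg; apply: fcauchy_add.
by apply: cvg_sqr; apply: fcauchy_norm_cvg; apply: fcauchy_sub.
Qed.

Lemma im_re s t : complex.Im (fip s t) = complex.Re (fip (fscale 'i s) t).
Proof. by rewrite fipE cReM /=; ring. Qed.

Lemma re_equiv u v u' v' : fcauchy u -> fcauchy v -> fcauchy u' -> fcauchy v' ->
  kcls u = kcls u' -> kcls v = kcls v' ->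
  (kn (sadd u v) ^+ 2 - kn (fun n => fsub (u n) (v n)) ^+ 2) / 4 =
  (kn (sadd u' v') ^+ 2 - kn (fun n => fsub (u' n) (v' n)) ^+ 2) / 4.
Proof.
move=> cu cv cu' cv' uu vv.
have knE w w' : fcauchy w -> fcauchy w' -> kcls w = kcls w' -> kn w = kn w'.
  move=> cw cw' ww; apply: fequiv_norm => //.
  have : kclass (kcls w) w'.
    by rewrite ww val_kcls//; split => //; exact: fequiv_refl.
  by rewrite val_kcls// => -[].
have -> : kn (sadd u v) = kn (sadd u' v').
  apply: knE; try exact: fcauchy_add.
  by rewrite -(kadd_cls cu cv) -(kadd_cls cu' cv') uu vv.
suff -> : kn (fun n => fsub (u n) (v n)) = kn (fun n => fsub (u' n) (v' n)) by [].
apply: knE; try exact: fcauchy_sub.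
by rewrite -(kclsB cu cv) -(kclsB cu' cv') uu vv.
Qed.

Lemma kcls_repr X : kcls (krepr X) = X.
Proof.
have [u cu ->] := kspaceP X; have [c e] := krepr_cls cu.
by apply/esym/kcls_eq.
Qed.

Lemma fcauchy_repr X : fcauchy (krepr X).
Proof. by have [u cu ->] := kspaceP X; have [] := krepr_cls cu. Qed.

Lemma kinner_re u v : fcauchy u -> fcauchy v ->
  (fun n => complex.Re (fip (u n) (v n))) @ \oo -->
  complex.Re (kinner (kcls u) (kcls v)).
Proof.
move=> cu cv; rewrite /= (cvg_lim _ (re_cvg (fcauchy_repr _) (fcauchy_repr _)))//.
rewrite (@re_equiv _ _ u v) ?kcls_repr//; try exact: fcauchy_repr.
exact: re_cvg.
Qed.

Lemma kinner_im u v : fcauchy u -> fcauchy v ->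
  (fun n => complex.Im (fip (u n) (v n))) @ \oo -->
  complex.Im (kinner (kcls u) (kcls v)).
Proof.
move=> cu cv /=.
have imE (a b : nat -> fsum) : (fun n => complex.Im (fip (a n) (b n))) =
    (fun n => complex.Re (fip (fscale 'i (a n)) (b n))).
  by apply/funext => n; rewrite im_re.
rewrite !imE.
have ci w : fcauchy w -> fcauchy (fun n => fscale 'i (w n)).
  exact: fcauchy_scale.
rewrite (cvg_lim _ (re_cvg (ci _ (fcauchy_repr _)) (fcauchy_repr _)))//.
rewrite (@re_equiv _ _ (fun n => fscale 'i (u n)) v) ?kcls_repr//; try exact: fcauchy_repr.
- by apply: re_cvg => //; exact: ci.
- by apply: ci; exact: fcauchy_repr.
- exact: ci.
- rewrite -[LHS](@kscale_cls 'i (krepr (kcls u)))//; last exact: fcauchy_repr.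
  by rewrite kcls_repr kscale_cls.
Qed.

Lemma kinnerE u v a b : fcauchy u -> fcauchy v ->
  (fun n => complex.Re (fip (u n) (v n))) @ \oo --> a ->
  (fun n => complex.Im (fip (u n) (v n))) @ \oo --> b ->
  kinner (kcls u) (kcls v) = a +i* b.
Proof.
move=> cu cv ha hb.
rewrite -(cvg_unique _ (kinner_re cu cv) ha)// -(cvg_unique _ (kinner_im cu cv) hb)//.
Qed.

Fact kinnerP (c : C) (X Y Z : kspace) :
  kinner X (c *: Y + Z) = c * kinner X Y + kinner X Z.
Proof.
have [u cu ->] := kspaceP X; have [v cv ->] := kspaceP Y.
have [w cw ->] := kspaceP Z; rewrite kclsP//.
rewrite (@kinnerE u _ (complex.Re (c * kinner (kcls u) (kcls v) + kinner (kcls u) (kcls w)))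
  (complex.Im (c * kinner (kcls u) (kcls v) + kinner (kcls u) (kcls w))))//.
- by case: (_ + _).
- by apply: fcauchy_add => //; exact: fcauchy_scale.
- under eq_fun do rewrite !fipE cReD cReM.
  rewrite cReD cReM; apply: cvgD; last exact: kinner_re.
  by apply: cvgB; apply: cvgM; [exact: cvg_cst|exact: kinner_re|
    exact: cvg_cst|exact: kinner_im].
- under eq_fun do rewrite !fipE cImD cImM.
  rewrite cImD cImM; apply: cvgD; last exact: kinner_im.
  by apply: cvgD; apply: cvgM; [exact: cvg_cst|exact: kinner_im|
    exact: cvg_cst|exact: kinner_re].
Qed.

Fact kinner_conj X Y : kinner Y X = (kinner X Y)^*.
Proof.
have [u cu ->] := kspaceP X; have [v cv ->] := kspaceP Y.
have [ou _] := cu; have [ov _] := cv.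
rewrite (@kinnerE v u (complex.Re (kinner (kcls u) (kcls v)))
  (- complex.Im (kinner (kcls u) (kcls v))))//.
- under eq_fun do rewrite (fip_conj (ou _) (ov _)) cReJ.
  exact: kinner_re.
- under eq_fun do rewrite (fip_conj (ou _) (ov _)) cImJ.
  by apply: cvgN; exact: kinner_im.
Qed.

Lemma kinner_norm u : fcauchy u -> kinner (kcls u) (kcls u) = (kn u ^+ 2)%:C.
Proof.
move=> cu; have [ou _] := cu; rewrite (@kinnerE u u (kn u ^+ 2) 0)//.
  under eq_fun do rewrite -fnorm2//.
  by apply: cvg_sqr; exact: fcauchy_norm_cvg.
under eq_fun do rewrite fip_im0//.
exact: cvg_cst.
Qed.

Fact kinner_ge0 X : 0 <= kinner X X.
Proof.
by have [u cu ->] := kspaceP X; rewrite kinner_norm// lecE /= eqxx sqr_ge0.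
Qed.

Lemma kn_ge0 u : fcauchy u -> 0 <= kn u.
Proof.
move=> cu; apply: limr_ge; first exact: fcauchy_norm_cvg.
by apply: nearW => n; exact: fnorm_ge0.
Qed.

Fact kinner_eq0 X : kinner X X = 0 -> X = 0.
Proof.
have [u cu ->] := kspaceP X; rewrite kinner_norm// => /(congr1 (@complex.Re _))/=.
move=> /eqP; rewrite sqrf_eq0 => /eqP kn0.
have -> : 0 = kcls (fun=> [::]) :> kspace by exact: kzeroE.
have [ou _] := cu.
apply: kcls_eq => //; first exact: fcauchy_nil.
move=> e e0; have : fnorm \o u @ \oo --> kn u by exact: fcauchy_norm_cvg.
rewrite kn0 => /cvgrPdist_lt/(_ _ e0)[N _ H]; exists N => n /H /=.
rewrite sub0r normrN ger0_norm ?fnorm_ge0//.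
by rewrite (@fnorm_ext (fsub (u n) [::]) (u n)) ?fsum_onE ?ou// => r; rewrite !fipE; ring.
Qed.

Lemma khnormE u : fcauchy u -> Num.sqrt (complex.Re (kinner (kcls u) (kcls u))) = kn u.
Proof. by move=> cu; rewrite kinner_norm//= sqrtr_sqr ger0_norm// kn_ge0. Qed.

Fact kspace_complete (X : nat -> kspace) :
    (forall e : R, 0 < e -> exists N, forall m n, (N <= m)%N -> (N <= n)%N ->
       Num.sqrt (complex.Re (kinner (X m - X n) (X m - X n))) < e) ->
    exists L, forall e : R, 0 < e -> exists N, forall n, (N <= n)%N ->
       Num.sqrt (complex.Re (kinner (X n - L) (X n - L))) < e.
Proof.
move=> cX; pose u n := krepr (X n).
have cu n : fcauchy (u n) by exact: fcauchy_repr.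
have Xu n : X n = kcls (u n) by rewrite kcls_repr.
have ou n i : fsum_on (u n i) by have [] := cu n.
have hk n : exists i, forall j, (i <= j)%N ->
    fnorm (fsub (u n i) (u n j)) < n.+1%:R^-1.
  have [_ cn] := cu n; have [N H] := cn _ (ltac:(by rewrite invr_gt0) : 0 < n.+1%:R^-1 :> R).
  by exists N => j Nj; exact: H.
pose i n := projT1 (cid (hk n)).
have iP n j : (i n <= j)%N -> fnorm (fsub (u n (i n)) (u n j)) < n.+1%:R^-1.
  exact: (projT2 (cid (hk n))).
pose w n := u n (i n).
have XB m n : Num.sqrt (complex.Re (kinner (X m - X n) (X m - X n))) =
    kn (fun j => fsub (u m j) (u n j)).
  by rewrite !Xu kclsB// khnormE//; exact: fcauchy_sub.
have ninv (e : R) : 0 < e -> exists N, forall n, (N <= n)%N -> n.+1%:R^-1 < e.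
  move=> e0; have [N _ H] := near_infty_natSinv_lt (PosNum e0).
  by exists N => n; exact: H.
have cw : fcauchy w.
  split => [n|e e0]; first exact: ou.
  have e3 : 0 < e / 3 by rewrite divr_gt0.
  have [N1 H1] := cX _ e3; have [N2 H2] := ninv _ e3.
  exists (maxn N1 N2) => m n; rewrite !geq_max => /andP[a b] /andP[c d].
  have := H1 _ _ a c; rewrite XB => knlt.
  have /cvgr_lt : fnorm \o (fun j => fsub (u m j) (u n j)) @ \oo -->
      kn (fun j => fsub (u m j) (u n j)).
    by apply: fcauchy_norm_cvg; exact: fcauchy_sub.
  move=> /(_ _ knlt)[N3 _ H3].
  pose j := maxn N3 (maxn (i m) (i n)).
  have N3j : (N3 <= j)%N by rewrite leq_max leqnn.
  have imj : (i m <= j)%N by rewrite !leq_max leqnn !orbT.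
  have inj : (i n <= j)%N by rewrite !leq_max leqnn !orbT.
  have := iP m j imj; have := iP n j inj; have /= := H3 _ N3j.
  have := H2 _ b; have := H2 _ d.
  have := fnorm_tri (ou m (i m)) (ou m j) (ou n (i n)).
  have := fnorm_tri (ou m j) (ou n j) (ou n (i n)).
  rewrite (fnorm_subC (ou n j) (ou n (i n))) /w.
  by move: (n.+1%:R^-1) (m.+1%:R^-1) => a1 b1; lra.
exists (kcls w) => e e0.
have e3 : 0 < e / 3 by rewrite divr_gt0.
have [_ cw'] := cw; have [N1 H1] := cw' _ e3; have [N2 H2] := ninv _ e3.
exists (maxn N1 N2) => n; rewrite geq_max => /andP[a b].
rewrite Xu kclsB// khnormE; last exact: fcauchy_sub.
suff : kn (fun j => fsub (u n j) (w j)) <= e / 3 + e / 3 by lra.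
apply: limr_le; first by apply: fcauchy_norm_cvg; exact: fcauchy_sub.
exists (maxn N1 (i n)) => // j /=; rewrite geq_max => /andP[c d].
have := iP n j d; have := H1 _ _ a c; have := H2 _ b.
have := fnorm_tri (ou n j) (ou n (i n)) (ou j (i j)).
rewrite (fnorm_subC (ou n j) (ou n (i n))) /w.
by move: (n.+1%:R^-1) => a1; lra.
Qed.

HB.instance Definition _ := isHilbert.Build R kspace
  kinnerP kinner_conj kinner_ge0 kinner_eq0 kspace_complete.

End KernelSpace.

(* * L^2 spaces and their Hilbert tensor products *)

Section SquareIntegrable.
Context (R : realType) (d : measure_display) (T : measurableType d).
Variable mu : {measure set T -> \bar R}.
Local Notation C := R[i].
Implicit Types f g h : T -> C.

Definition L2 f : Prop :=
  [/\ measurable_fun setT (fun t => complex.Re (f t)),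
      measurable_fun setT (fun t => complex.Im (f t))
    & (\int[mu]_t ((complex.Re (f t)) ^+ 2 + (complex.Im (f t)) ^+ 2)%:E < +oo)%E].

Definition cintegral h : C :=
  (\int[mu]_t complex.Re (h t)) +i* (\int[mu]_t complex.Im (h t)).

Definition l2ip f g : C := cintegral (fun t => (f t)^* * g t).

Definition cintegrable h : Prop :=
  mu.-integrable setT (EFin \o (fun t => complex.Re (h t))) /\
  mu.-integrable setT (EFin \o (fun t => complex.Im (h t))).

Lemma sqr_integrable f : L2 f -> mu.-integrable setT
  (EFin \o (fun t => (complex.Re (f t)) ^+ 2 + (complex.Im (f t)) ^+ 2)).
Proof.
move=> [mr mi foo]; apply/integrableP; split.
  apply/measurable_EFinP; apply: measurable_funD; exact: measurable_funX.
under eq_integral do rewrite /= ger0_norm ?addr_ge0 ?sqr_ge0//.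
exact: foo.
Qed.

Lemma L2_cintegrable f g : L2 f -> L2 g -> cintegrable (fun t => (f t)^* * g t).
Proof.
move=> Lf Lg; have [mr mi _] := Lf; have [mr' mi' _] := Lg.
have dom : mu.-integrable setT (EFin \o (fun t =>
    ((complex.Re (f t)) ^+ 2 + (complex.Im (f t)) ^+ 2) +
    ((complex.Re (g t)) ^+ 2 + (complex.Im (g t)) ^+ 2))).
  exact: (integrableD measurableT (sqr_integrable Lf) (sqr_integrable Lg)).
split; apply: le_integrable dom => //.
- apply/measurable_EFinP.
  rewrite (_ : (fun t => _) = (fun t => complex.Re (f t) * complex.Re (g t) +
      complex.Im (f t) * complex.Im (g t))); last first.
    by apply/funext => t; rewrite cReM cReJ cImJ; ring.
  by apply: measurable_funD; exact: measurable_funM.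
- move=> t _ /=; rewrite lee_fin cReM cReJ cImJ.
  move: (complex.Re (f t)) (complex.Im (f t)) (complex.Re (g t)) (complex.Im (g t)).
  move=> a b x y; rewrite [leRHS]ger0_norm ?addr_ge0 ?sqr_ge0//.
  have := (sqr_ge0 (a + x), sqr_ge0 (a - x), sqr_ge0 (b + y), sqr_ge0 (b - y)).
  have := (sqr_ge0 (a + y), sqr_ge0 (a - y), sqr_ge0 (b + x), sqr_ge0 (b - x)).
  rewrite !expr2 => -[[[? ?] ?] ?] [[[? ?] ?] ?].
  by rewrite ler_norml; apply/andP; split; nra.
- apply/measurable_EFinP.
  rewrite (_ : (fun t => _) = (fun t => complex.Re (f t) * complex.Im (g t) -
      complex.Im (f t) * complex.Re (g t))); last first.
    by apply/funext => t; rewrite cImM cReJ cImJ; ring.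
  by apply: measurable_funB; exact: measurable_funM.
- move=> t _ /=; rewrite lee_fin cImM cReJ cImJ.
  move: (complex.Re (f t)) (complex.Im (f t)) (complex.Re (g t)) (complex.Im (g t)).
  move=> a b x y; rewrite [leRHS]ger0_norm ?addr_ge0 ?sqr_ge0//.
  have := (sqr_ge0 (a + x), sqr_ge0 (a - x), sqr_ge0 (b + y), sqr_ge0 (b - y)).
  have := (sqr_ge0 (a + y), sqr_ge0 (a - y), sqr_ge0 (b + x), sqr_ge0 (b - x)).
  rewrite !expr2 => -[[[? ?] ?] ?] [[[? ?] ?] ?].
  by rewrite ler_norml; apply/andP; split; nra.
Qed.

Lemma cintegrableZ c h : cintegrable h -> cintegrable (fun t => c * h t).
Proof.
move=> [hr hi]; split.
- rewrite (_ : _ \o _ = (fun t => (complex.Re c)%:E * (EFin \o (fun t => complex.Re (h t))) t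
     + (- complex.Im c)%:E * (EFin \o (fun t => complex.Im (h t))) t)%E); last first.
    by apply/funext => t /=; rewrite cReM EFinB EFinN mulNe.
  by apply: integrableD => //; exact: integrableZl.
- rewrite (_ : _ \o _ = (fun t => (complex.Re c)%:E * (EFin \o (fun t => complex.Im (h t))) t
     + (complex.Im c)%:E * (EFin \o (fun t => complex.Re (h t))) t)%E); last first.
    by apply/funext => t /=; rewrite cImM.
  by apply: integrableD => //; exact: integrableZl.
Qed.

Lemma cintegrableD h h' : cintegrable h -> cintegrable h' ->
  cintegrable (fun t => h t + h' t).
Proof.
move=> [hr hi] [hr' hi']; split.
- rewrite (_ : _ \o _ = (EFin \o (fun t => complex.Re (h t))) \+
     (EFin \o (fun t => complex.Re (h' t))))%E; last first.
    by apply/funext => t /=; rewrite cReD.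
  exact: integrableD.
- rewrite (_ : _ \o _ = (EFin \o (fun t => complex.Im (h t))) \+
     (EFin \o (fun t => complex.Im (h' t))))%E; last first.
    by apply/funext => t /=; rewrite cImD.
  exact: integrableD.
Qed.

Lemma cintegralD h h' : cintegrable h -> cintegrable h' ->
  cintegral (fun t => h t + h' t) = cintegral h + cintegral h'.
Proof.
move=> [hr hi] [hr' hi']; apply/eqP; rewrite eq_complex /=; apply/andP; split; apply/eqP.
- under eq_Rintegral do rewrite cReD; exact: RintegralD.
- under eq_Rintegral do rewrite cImD; exact: RintegralD.
Qed.

Lemma cintegralZ c h : cintegrable h ->
  cintegral (fun t => c * h t) = c * cintegral h.
Proof.
move=> [hr hi].
have Zl (a : R) (f : T -> R) : mu.-integrable setT (EFin \o f) ->
    mu.-integrable setT (EFin \o (fun t => a * f t)).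
  by move=> /(integrableZl measurableT a).
apply/eqP; rewrite eq_complex; apply/andP; split; apply/eqP.
- rewrite cReM /=; under eq_Rintegral do rewrite cReM.
  by rewrite RintegralB ?RintegralZl//; exact: Zl.
- rewrite cImM /=; under eq_Rintegral do rewrite cImM.
  by rewrite RintegralD ?RintegralZl//; exact: Zl.
Qed.

Lemma cintegral_sum (I : eqType) (s : seq I) (h : I -> T -> C) :
  (forall i, i \in s -> cintegrable (h i)) ->
  cintegrable (fun t => \sum_(i <- s) h i t) /\
  cintegral (fun t => \sum_(i <- s) h i t) = \sum_(i <- s) cintegral (h i).
Proof.
elim: s => [_|i s IH hs].
  rewrite big_nil (_ : (fun t => _) = (fun _ => 0)); last first.
    by apply/funext => t; rewrite big_nil.
  split; first by split; exact: integrable0.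
  by apply/eqP; rewrite eq_complex/= !Rintegral_cst// !mul0r eqxx.
have [|IH1 IH2] := IH; first by move=> j js; apply: hs; rewrite inE js orbT.
rewrite big_cons -IH2 (_ : (fun t => _) = (fun t => h i t + \sum_(j <- s) h j t)); last first.
  by apply/funext => t; rewrite big_cons.
have hi : cintegrable (h i) by apply: hs; rewrite inE eqxx.
by split; [exact: cintegrableD|exact: cintegralD].
Qed.

Lemma cintegral_ge0 h : (forall t, 0 <= h t) -> 0 <= cintegral h.
Proof.
move=> h0; have h0' t : complex.Im (h t) = 0 /\ 0 <= complex.Re (h t).
  by have := h0 t; rewrite lecE => /andP[/eqP].
rewrite lecE /=; apply/andP; split.
  by under eq_Rintegral do rewrite (h0' _).1; rewrite Rintegral_cst// mul0r.
by apply: Rintegral_ge0 => t _; have [] := h0' t.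
Qed.

Lemma l2ip_conj f g : L2 f -> L2 g -> l2ip g f = (l2ip f g)^*.
Proof.
move=> Lf Lg; apply/eqP; rewrite eq_complex; apply/andP; split; apply/eqP.
  rewrite cReJ; apply: eq_Rintegral => t _.
  by rewrite !cReM !cReJ !cImJ; ring.
rewrite cImJ /= -mulN1r -RintegralZl//; last by have [] := L2_cintegrable Lf Lg.
by apply: eq_Rintegral => t _; rewrite !cImM !cReJ !cImJ; ring.
Qed.

End SquareIntegrable.

Section TensorProduct.
Context (R : realType) (M : choiceType) (d : M -> measure_display)
  (T : forall x, measurableType (d x)).
Variable mu : forall x, {measure set (T x) -> \bar R}.
Local Notation C := R[i].

(* The family f stands for the elementary tensor of the f_x, x in lam; its
   other components are irrelevant. *)
Definition family : Type := forall x : M, T x -> C.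
HB.instance Definition _ := Choice.on family.
Implicit Types (f g : family) (lam : {fset M}).

Definition tensor_dom lam : set family :=
  [set f | forall x, x \in lam -> L2 (mu x) (f x)].

Definition tensor_ip lam f g : C := \prod_(x <- lam) l2ip (mu x) (f x) (g x).

Fact tensor_ip_conj lam f g : tensor_dom lam f -> tensor_dom lam g ->
  tensor_ip lam g f = (tensor_ip lam f g)^*.
Proof.
move=> lf lg; rewrite /tensor_ip rmorph_prod /= !big_seq.
by apply: eq_bigr => x xl; rewrite l2ip_conj//; [exact: lf|exact: lg].
Qed.

Lemma tensor_psd_seq (xs : seq M) (s : seq (C * family)) :
  (forall a, a \in s -> forall x, x \in xs -> L2 (mu x) (a.2 x)) ->
  0 <= \sum_(a <- s) \sum_(b <- s)
         a.1^* * b.1 * \prod_(x <- xs) l2ip (mu x) (a.2 x) (b.2 x).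
Proof.
elim: xs s => [|x xs IH] s sL.
  have -> : \sum_(a <- s) \sum_(b <- s)
      a.1^* * b.1 * \prod_(x <- [::]) l2ip (mu x) (a.2 x) (b.2 x) =
      (\sum_(a <- s) a.1)^* * \sum_(a <- s) a.1.
    rewrite rmorph_sum mulr_suml; apply: eq_bigr => a _ /=.
    by rewrite mulr_sumr; apply: eq_bigr => b _; rewrite big_nil mulr1.
  case: (\sum_(a <- s) a.1) => u v; rewrite lecE /=; apply/andP; split.
    by apply/eqP; ring.
  nra.
pose P (a b : C * family) : C := \prod_(y <- xs) l2ip (mu y) (a.2 y) (b.2 y).
pose h (a b : C * family) t : C := (a.1^* * b.1 * P a b) * ((a.2 x t)^* * b.2 x t).
have hI a b : a \in s -> b \in s -> cintegrable (mu x) (fun t => (a.2 x t)^* * b.2 x t).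
  by move=> sa sb; apply: L2_cintegrable; apply: sL; rewrite ?inE ?eqxx.
have hI' a b : a \in s -> b \in s -> cintegrable (mu x) (h a b).
  by move=> sa sb; apply: cintegrableZ; exact: hI.
have hS a : a \in s -> cintegrable (mu x) (fun t => \sum_(b <- s) h a b t) /\
    cintegral (mu x) (fun t => \sum_(b <- s) h a b t) =
    \sum_(b <- s) cintegral (mu x) (h a b).
  by move=> sa; apply: cintegral_sum => b sb; exact: hI'.
have [_ E] := @cintegral_sum _ _ _ (mu x) _ s (fun a t => \sum_(b <- s) h a b t)
  (fun a sa => (hS a sa).1).
have -> : \sum_(a <- s) \sum_(b <- s)
    a.1^* * b.1 * \prod_(y <- x :: xs) l2ip (mu y) (a.2 y) (b.2 y) =
    cintegral (mu x) (fun t => \sum_(a <- s) \sum_(b <- s) h a b t).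
  rewrite E; rewrite !big_seq; apply: eq_bigr => a sa.
  rewrite (hS a sa).2 !big_seq; apply: eq_bigr => b sb.
  rewrite big_cons /h cintegralZ; last exact: hI.
  by rewrite /l2ip -/(P a b); ring.
apply: cintegral_ge0 => t.
pose s' := [seq (a.1 * a.2 x t, a.2) | a : C * family <- s].
have := IH s'; rewrite /s' big_map.
under eq_bigr do rewrite big_map.
move=> H; apply: le_trans (H _) _.
  by move=> _ /mapP[a sa ->] y yxs /=; apply: sL => //; rewrite inE yxs orbT.
rewrite le_eqVlt; apply/orP; left; apply/eqP; apply: eq_bigr => a _.
by apply: eq_bigr => b _ /=; rewrite /h /P rmorphM; ring.
Qed.

Fact tensor_psd lam (s : seq (C * family)) :
  all (fun a => `[< tensor_dom lam a.2 >]) s ->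
  0 <= \sum_(a <- s) \sum_(b <- s) a.1^* * b.1 * tensor_ip lam a.2 b.2.
Proof.
by move=> /allP sP; apply: tensor_psd_seq => a /sP/asboolP.
Qed.

Definition tensor_kernel lam : psdKernel R family :=
  PsdKernel (@tensor_ip_conj lam) (@tensor_psd lam).

(* H_lam, the Hilbert tensor product of the L^2(T_x, mu_x) for x in lam: the
   completion of the formal linear combinations of elementary tensors for
   <(x)_x f_x, (x)_x g_x> = prod_x <f_x, g_x>. *)
Definition tensorL2 lam := kspace (tensor_kernel lam).

HB.instance Definition _ lam := Hilbert.on (tensorL2 lam).

(* The elementary tensor with components f_x for x in lam and g_x elsewhere. *)
Definition merge lam g f : family := fun x => if x \in lam then f x else g x.

Definition fmerge lam (t s : seq (C * family)) : seq (C * family) :=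
  [seq (b.1 * a.1, merge lam b.2 a.2) | b <- t, a <- s].

(* The canonical identification of the tensor product of H_{lam' \ lam} and
   H_lam with H_lam': this is the image of xi (x) psi. *)
Definition tensor_mul lam lam' (xi : tensorL2 (lam' `\` lam)%fset) (psi : tensorL2 lam) :
    tensorL2 lam' :=
  kcls (tensor_kernel lam') (fun n => fmerge lam (krepr xi n) (krepr psi n)).

End TensorProduct.

(* * C*-algebras and states *)

(* Unital complex algebras with an involution and a norm: operations only, the
   axioms come with CStar below. The library's algebras are nonzero by
   definition, which is not known a priori for an algebra of operators. *)
HB.mixin Record hasStarAlg (R : realType) A & GRing.Lmodule R[i] A := {
  amul : A -> A -> A ;
  aone : A ;
  star : A -> A ;
  anorm : A -> R }.

#[short(type="starAlgType")]
HB.structure Definition StarAlg (R : realType) :=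
  {A of GRing.Lmodule R[i] A & hasStarAlg R A}.

HB.mixin Record isCStar (R : realType) A & StarAlg R A := {
  amulA : associative (@amul R A) ;
  amul1l : left_id (@aone R A) (@amul R A) ;
  amul1r : right_id (@aone R A) (@amul R A) ;
  amulPl : forall (k : R[i]) (a b c : A),
    amul (k *: a + b) c = k *: amul a c + amul b c ;
  amulPr : forall (k : R[i]) (a b c : A),
    amul c (k *: a + b) = k *: amul c a + amul c b ;
  starP : forall (k : R[i]) (a b : A), star (k *: a + b) = k^* *: star a + star b ;
  starM : forall a b : A, star (amul a b) = amul (star b) (star a) ;
  starK : forall a : A, star (star a) = a ;
  anorm_eq0 : forall a : A, anorm a = 0 -> a = 0 ;
  anormD : forall a b : A, anorm (a + b) <= anorm a + anorm b ;
  anormZ : forall (k : R[i]) (a : A), anorm (k *: a) = normc k * anorm a ;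
  anormM : forall a b : A, anorm (amul a b) <= anorm a * anorm b ;
  cstar_identity : forall a : A, anorm (amul (star a) a) = anorm a ^+ 2 ;
  cstar_complete : forall u : nat -> A,
    (forall e : R, 0 < e -> exists N, forall m n, (N <= m)%N -> (N <= n)%N ->
       anorm (u m - u n) < e) ->
    exists l, forall e : R, 0 < e -> exists N, forall n, (N <= n)%N ->
       anorm (u n - l) < e }.

#[short(type="cstarType")]
HB.structure Definition CStar (R : realType) := {A of StarAlg R A & isCStar R A}.

Section StarMorphisms.
Variables (R : realType) (A B : starAlgType R).

Definition star_morphism (f : A -> B) : Prop :=
  [/\ forall (k : R[i]) a b, f (k *: a + b) = k *: f a + f b,
      forall a b, f (amul a b) = amul (f a) (f b),
      f aone = aone
    & forall a, f (star a) = star (f a)].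

Definition isometric (f : A -> B) : Prop := forall a, anorm (f a) = anorm a.

Definition star_isomorphism (f : A -> B) : Prop :=
  [/\ bijective f, star_morphism f & isometric f].

End StarMorphisms.

(* States: positive linear functionals of norm 1. *)
Definition states (R : realType) (A : starAlgType R) : set (A -> R[i]) :=
  [set s | [/\ forall (k : R[i]) a b, s (k *: a + b) = k * s a + s b,
               forall a, 0 <= s (amul (star a) a),
               has_sup [set normc (s a) | a in [set a : A | anorm a <= 1]]
             & sup [set normc (s a) | a in [set a : A | anorm a <= 1]] = 1]].

(* Pull-back of functionals along f. *)
Definition pull_state (R : realType) (A B : Type) (f : A -> B) (s : B -> R[i]) :
  A -> R[i] := s \o f.

(* The inverse of a bijection. *)
Definition inverse (A : zmodType) (B : Type) (f : A -> B) : B -> A :=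
  fun b => xget 0 [set a | f a = b].

Definition hilbert_isomorphism (R : realType) (H H' : hilbertType R)
    (U : H -> H') : Prop :=
  [/\ bijective U,
      forall (k : R[i]) x y, U (k *: x + y) = k *: U x + U y
    & forall x y, inner (U x) (U y) = inner x y].

(* * Bounded operators on a Hilbert space *)

Section HilbertTheory.
Variables (R : realType) (H : hilbertType R).
Implicit Types x y z : H.

Lemma inner0r x : inner x 0 = 0.
Proof.
have := innerP 1 x 0 0; rewrite scale1r addr0 mul1r => /(congr1 (fun c => c - inner x 0)).
by rewrite subrr addrK => <-.
Qed.

Lemma innerDr x y z : inner x (y + z) = inner x y + inner x z.
Proof. by rewrite -[in LHS](scale1r y) innerP mul1r. Qed.

Lemma innerZr k x y : inner x (k *: y) = k * inner x y.
Proof. by rewrite -[in LHS](addr0 (k *: y)) innerP inner0r addr0. Qed.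

Lemma innerDl x y z : inner (y + z) x = inner y x + inner z x.
Proof. by rewrite inner_conj innerDr rmorphD /= -!inner_conj. Qed.

Lemma innerZl k x y : inner (k *: y) x = k^* * inner y x.
Proof. by rewrite inner_conj innerZr rmorphM /= -inner_conj. Qed.

Lemma inner_re_ge0 x : 0 <= complex.Re (inner x x).
Proof. by have := inner_ge0 x; rewrite lecE => /andP[]. Qed.

Lemma hnorm_ge0 x : 0 <= hnorm x. Proof. exact: sqrtr_ge0. Qed.

Lemma hnorm2 x : hnorm x ^+ 2 = complex.Re (inner x x).
Proof. by rewrite sqr_sqrtr// inner_re_ge0. Qed.

Lemma inner_re_le x y : complex.Re (inner x y) <= hnorm x * hnorm y.
Proof.
apply: quad_form_le; try exact: inner_re_ge0.
move=> r; have := inner_re_ge0 (x + r%:C *: y).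
rewrite !(innerDl, innerDr, innerZl, innerZr) (inner_conj x y).
rewrite !(cReD, cReM, cImM, cReJ, cImJ)/=.
by congr (_ <= _); ring.
Qed.

Lemma hnormD x y : hnorm (x + y) <= hnorm x + hnorm y.
Proof.
have := inner_re_le x y => le_xy.
rewrite -(@ler_pXn2r _ 2)// ?nnegrE ?addr_ge0 ?hnorm_ge0// sqrrD !hnorm2.
rewrite !(innerDl, innerDr) (inner_conj x y) !(cReD, cReJ).
lra.
Qed.

Lemma hnormZ k x : hnorm (k *: x) = normc k * hnorm x.
Proof.
rewrite /hnorm innerZl innerZr mulrA.
have -> : k^* * k = (normc k ^+ 2)%:C.
  case: k => a b /=; rewrite sqr_sqrtr ?addr_ge0 ?sqr_ge0//.
  by apply/eqP; rewrite eq_complex/=; apply/andP; split; apply/eqP; ring.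
rewrite cReM /= mul0r subr0 sqrtrM ?sqr_ge0// sqrtr_sqr ger0_norm//.
by case: k => a b; exact: sqrtr_ge0.
Qed.

End HilbertTheory.

Section BoundedOperators.
Variables (R : realType) (H : hilbertType R).

Definition bounded_operator (a : H -> H) : Prop :=
  (forall (k : R[i]) x y, a (k *: x + y) = k *: a x + a y) /\
  exists c : R, forall x, hnorm (a x) <= c * hnorm x.

Record boundedOp := BoundedOp {
  bop_fun :> H -> H ; bop_funP : `[< bounded_operator bop_fun >] }.

HB.instance Definition _ := [isSub for bop_fun].
HB.instance Definition _ := [Choice of boundedOp by <:].

Implicit Types a b : boundedOp.

Lemma bopP a b : (forall x, a x = b x) -> a = b.
Proof. by move=> ab; apply/val_inj/funext. Qed.

Lemma bop_linear a (k : R[i]) x y : a (k *: x + y) = k *: a x + a y.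
Proof. by have /asboolP[] := bop_funP a. Qed.

Lemma bop_bounded a : exists2 c : R, 0 <= c & forall x, hnorm (a x) <= c * hnorm x.
Proof.
have /asboolP[_ [c H1]] := bop_funP a; exists `|c| => // x.
by apply: le_trans (H1 x) _; rewrite ler_wpM2r ?hnorm_ge0// ler_norm.
Qed.

Lemma bopD a x y : a (x + y) = a x + a y.
Proof. by rewrite -[x in LHS]scale1r bop_linear scale1r. Qed.

Lemma bop0 a : a 0 = 0.
Proof. by apply: (addrI (a 0)); rewrite -bopD !addr0. Qed.

Lemma bopZ a k x : a (k *: x) = k *: a x.
Proof. by rewrite -[X in a X]addr0 bop_linear bop0 addr0. Qed.

Fact bop_lin_subproof (k : R[i]) a b :
  `[< bounded_operator (fun x => k *: a x + b x) >].
Proof.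
apply/asboolP; split=> [l x y|].
  rewrite !bop_linear !scalerDr !scalerA (mulrC k l) -!scalerA -!addrA.
  by congr (_ + _); rewrite addrCA.
have [c c0 ca] := bop_bounded a; have [c' c'0 cb] := bop_bounded b.
have nk : 0 <= normc k by case: (k) => u v; exact: sqrtr_ge0.
exists (normc k * c + c') => x; apply: le_trans (hnormD _ _) _.
by rewrite mulrDl lerD// hnormZ -mulrA ler_wpM2l.
Qed.

Fact bop_id_subproof : `[< bounded_operator id >].
Proof. by apply/asboolP; split => //; exists 1 => x; rewrite mul1r. Qed.

Fact bop_zero_subproof : `[< bounded_operator (fun=> 0) >].
Proof.
apply/asboolP; split => [*|]; first by rewrite scaler0 addr0.
by exists 0 => x; rewrite mul0r /hnorm inner0r sqrtr0.
Qed.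

Fact bop_comp_subproof a b : `[< bounded_operator (a \o b) >].
Proof.
apply/asboolP; split => [k x y|]; first by rewrite /= !bop_linear.
have [c c0 ca] := bop_bounded a; have [c' c'0 cb] := bop_bounded b.
exists (c * c') => x /=; apply: le_trans (ca _) _.
by rewrite -mulrA ler_wpM2l.
Qed.

Definition bop_lin k a b := BoundedOp (bop_lin_subproof k a b).
Definition bop_zero := BoundedOp bop_zero_subproof.
Definition bop_one := BoundedOp bop_id_subproof.
Definition bop_comp a b := BoundedOp (bop_comp_subproof a b).
Definition bop_add a b := bop_lin 1 a b.
Definition bop_scale k a := bop_lin k a bop_zero.
Definition bop_opp a := bop_scale (-1) a.

Fact bop_addA : associative bop_add.
Proof. by move=> a b c; apply: bopP => x /=; rewrite !scale1r addrA. Qed.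
Fact bop_addC : commutative bop_add.
Proof. by move=> a b; apply: bopP => x /=; rewrite !scale1r addrC. Qed.
Fact bop_add0 : left_id bop_zero bop_add.
Proof. by move=> a; apply: bopP => x /=; rewrite scale1r add0r. Qed.
Fact bop_addN : left_inverse bop_zero bop_opp bop_add.
Proof. by move=> a; apply: bopP => x /=; rewrite scale1r addr0 scaleN1r addNr. Qed.

HB.instance Definition _ :=
  GRing.isZmodule.Build boundedOp bop_addA bop_addC bop_add0 bop_addN.

Fact bop_scaleA k l a : bop_scale k (bop_scale l a) = bop_scale (k * l) a.
Proof. by apply: bopP => x /=; rewrite !addr0 scalerA. Qed.
Fact bop_scale1 : left_id 1 bop_scale.
Proof. by move=> a; apply: bopP => x /=; rewrite addr0 scale1r. Qed.
Fact bop_scaleDr : right_distributive bop_scale bop_add.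
Proof. by move=> k a b; apply: bopP => x /=; rewrite !scale1r !addr0 scalerDr. Qed.
Fact bop_scaleDl a : {morph bop_scale^~ a : k l / k + l >-> bop_add k l}.
Proof. by move=> k l; apply: bopP => x /=; rewrite scale1r !addr0 scalerDl. Qed.

HB.instance Definition _ := GRing.Zmodule_isLmodule.Build R[i] boundedOp
  bop_scaleA bop_scale1 bop_scaleDr bop_scaleDl.

(* The adjoint of a. *)
Definition bop_adj a : boundedOp :=
  xget 0 [set b : boundedOp | forall x y, inner (b x) y = inner x (a y)].

Definition bop_norm a : R := sup [set hnorm (a x) | x in [set x : H | hnorm x <= 1]].

HB.instance Definition _ := 
  hasStarAlg.Build R boundedOp bop_comp bop_one bop_adj bop_norm.

End BoundedOperators.

(* * The construction from a measure field *)

Section QuantumStates.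
Context (R : realType) (M : choiceType) (d : M -> measure_display)
  (T : forall x, measurableType (d x)).
Variable mu : forall x, {measure set (T x) -> \bar R}.
Implicit Types lam : {fset M}.

Definition opAlg lam : Type := boundedOp (tensorL2 mu lam).

HB.instance Definition _ lam := StarAlg.on (opAlg lam).

(* iota_{lam' lam} a = 1 (x) a, characterized by its values on the elementary
   tensors xi (x) psi; for lam' = lam the factor xi is a scalar and this is the
   identity. *)
Definition op_iota lam lam' (a : opAlg lam) : opAlg lam' :=
  xget 0 [set b : opAlg lam' |
    forall (xi : tensorL2 mu (lam' `\` lam)%fset) (psi : tensorL2 mu lam),
      b (tensor_mul xi psi) = tensor_mul xi (a psi)].

Definition state_proj lam lam' (s : opAlg lam' -> R[i]) : opAlg lam -> R[i] :=
  pull_state (@op_iota lam lam') s.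

Definition quantum_states : set (forall lam, opAlg lam -> R[i]) :=
  [set s | (forall lam, states (s lam)) /\
           (forall lam lam', (lam `<=` lam')%fset ->
              state_proj (s lam') = s lam)].

(* B, with the maps j_lam, is the C*-inductive limit of the B_lam: the j_lam are
   compatible isometric *-homomorphisms whose images have a dense union. *)
Definition inductive_limit (B : cstarType R) (j : forall lam, opAlg lam -> B) : Prop :=
  [/\ forall lam, star_morphism (j lam) /\ isometric (j lam),
      forall lam lam', (lam `<=` lam')%fset ->
        forall a : opAlg lam, j lam' (op_iota lam' a) = j lam a
    & forall (b : B) (e : R), 0 < e ->
        exists lam, exists a : opAlg lam, anorm (b - j lam a) < e].

(* The state on B identified with a family s of quantum_states. *)
Definition limit_state (B : cstarType R) (j : forall lam, opAlg lam -> B)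
    (s : forall lam, opAlg lam -> R[i]) : B -> R[i] :=
  xget (fun=> 0) [set t : B -> R[i] |
    states t /\ forall lam (a : opAlg lam), t (j lam a) = s lam a].

End QuantumStates.

Arguments quantum_states {R M d T} mu.

Section Comparison.
Context (R : realType) (M : choiceType) (d : M -> measure_display)
  (T : forall x, measurableType (d x)).
Variables mu mu' : forall x, {measure set (T x) -> \bar R}.
Implicit Types lam : {fset M}.

(* The element of the second Hilbert space given by the same class of sequences
   of formal combinations of elementary tensors (0 if there is none). *)
Definition same_vector lam (psi : tensorL2 mu lam) : tensorL2 mu' lam :=
  insubd (0 : tensorL2 mu' lam) (kclass psi).

End Comparison.

(* a |-> U o a o U^-1 (0 if that operator is not bounded) *)
Definition conj_op (R : realType) (H H' : hilbertType R) (U : H -> H')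
    (a : boundedOp H) : boundedOp H' :=
  insubd (0 : boundedOp H') (U \o a \o inverse U).

(* Main.v *)
(* Uniqueness of the measure. Identify GL(V) with the invertible matrices.
   "Almost every matrix" is expressed by quantifying Lebesgue-almost everywhere
   over one entry after the other. By Tonelli the order of the entries is
   irrelevant, and then an LUP factorization shows that the quantifier is
   invariant under right multiplication by an invertible matrix. As GL(V) acts
   transitively on Gamma, Fubini yields for A, A' of positive measure some g
   with A meeting g^-1 A' in positive measure. If mu and nu were not
   proportional, Hahn decompositions of mu - c1 nu and mu - c2 nu with c1 < c2
   would provide two sets of positive measure contradicting this.
   Sigma-finiteness holds because Gamma is the union of the compact images of
   {g | |g_ij| <= k, |det g| >= 1/(k+1)}.

   Multiplying the measures by c multiplies the scalar product of H_lambda by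
   c^#lambda. Hence the Cauchy sequences and their equivalence classes do not
   change, and U_lambda is unitary. It respects elementary tensors, whose linear
   combinations are dense, which gives the relations for iota. The resulting
   correspondence between the images of the B_lambda in B and in B' is
   isometric, so that it extends to the completions. *)
Require Import Defs.
From HB Require Import structures.
From mathcomp Require Import all_boot all_order fingroup perm all_algebra finmap.
From mathcomp Require Import all_classical all_reals all_analysis.
From mathcomp Require Import measurable_realfun.
From mathcomp Require Import complex ring lra.
Set Implicit Arguments.
Unset Strict Implicit.
Unset Printing Implicit Defensive.
Import Order.TTheory GRing.Theory Num.Theory numFieldNormedType.Exports.
Local Open Scope classical_set_scope.
Local Open Scope ring_scope.
Local Open Scope complex_scope.

(** * Almost-everywhere quantifiers over matrices *)

(** Only the null sets of the group enter, not a Haar integral: multiplication by an invertible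
    matrix changes Lebesgue measure by a Jacobian but preserves its null sets, so a quantifier over
    almost every matrix takes the place of a Haar measure. The mixing property is proved for the
    single sigma-finite measure mu + nu, so that one group element serves both measures and no
    absolute continuity between them has to be known beforehand. Adjoints, the maps iota and the
    states on the limit algebras are selected by a choice with a default value. For each of them the
    choice is shown to succeed on one side exactly when it succeeds on the other, with a unique
    witness, and the transport is shown to send default to default. The algebras B and B' are
    arbitrary models of the inductive limits, without a concrete union of the B_lambda inside them.
    The comparison therefore starts from a relation between elements of B and B' having a common
    origin, and the isomorphism is the closure of this relation. *)

Section AlmostAll.
Context d dZ (T : measurableType d) (Z : measurableType dZ) (R : realType).
Variable m : {sigma_finite_measure set T -> \bar R}.
Variable u : Z -> T -> Z.
Hypothesis mu_ : measurable_fun setT (fun p : Z * T => u p.1 p.2).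
Implicit Types W : set Z.

(** The map [u] overwrites a part of the state [z] by [t]. Keeping the state abstract lets one
    definition serve both for a matrix entry and for the point of the space on which the group
    acts. *)
Definition almost_all W : set Z := [set z | m [set t | ~ W (u z t)] = 0%E].

Lemma measurable_not_section W z : measurable W -> measurable [set t | ~ W (u z t)].
Proof.
move=> mW.
have mz : measurable_fun setT (u z).
  exact: (measurableT_comp mu_ (pair1_measurable z)).
have := mz measurableT _ (measurableC mW); rewrite setTI; exact.
Qed.

Lemma measurable_almost_all W : measurable W -> measurable (almost_all W).
Proof.
move=> mW; pose A := [set p : Z * T | ~ W (u p.1 p.2)].
have mA : measurable A.
  have := mu_ measurableT (measurableC mW); rewrite setTI; exact.
have := measurable_fun_xsection m mA measurableT (emeasurable_set1 0%E).
rewrite setTI; congr measurable; apply/seteqP; split=> z /=;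
  by rewrite /almost_all /= xsectionE.
Qed.

Lemma almost_allS W W' : measurable W -> measurable W' -> W `<=` W' ->
  almost_all W `<=` almost_all W'.
Proof.
move=> mW mW' WW' z /= W0; apply/eqP; rewrite -measure_le0 -W0.
apply: le_measure; rewrite ?inE; try exact: measurable_not_section.
by move=> t /=; apply: contra_not => /WW'.
Qed.

End AlmostAll.

Section AlmostAllC.
Context d1 d2 dZ (T1 : measurableType d1) (T2 : measurableType d2)
  (Z : measurableType dZ) (R : realType).
Variables (m1 : {sigma_finite_measure set T1 -> \bar R})
          (m2 : {sigma_finite_measure set T2 -> \bar R}).
Variables (u1 : Z -> T1 -> Z) (u2 : Z -> T2 -> Z).
Hypothesis mu1 : measurable_fun setT (fun p : Z * T1 => u1 p.1 p.2).
Hypothesis mu2 : measurable_fun setT (fun p : Z * T2 => u2 p.1 p.2).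
Hypothesis u12 : forall z t1 t2, u2 (u1 z t1) t2 = u1 (u2 z t2) t1.

Lemma integral_eq0P d (T : measurableType d) (m : {measure set T -> \bar R})
    (f : T -> \bar R) : measurable_fun setT f -> (forall t, 0 <= f t)%E ->
  (\int[m]_t f t = 0)%E <-> m [set t | f t <> 0%E] = 0%E.
Proof.
move=> mf f0.
have mf0 : measurable [set t | f t <> 0%E].
  have := mf measurableT _ (measurableC (emeasurable_set1 0%E)).
  by rewrite setTI.
have absf : (\int[m]_t `|f t| = \int[m]_t f t)%E.
  by apply: eq_integral => t _; rewrite gee0_abs.
rewrite -absf; apply: iff_trans (ae_eq_integral_abs m measurableT mf) _; split.
  case=> N [mN N0 sN]; apply/eqP; rewrite -measure_le0 -[leRHS]N0.
  apply: le_measure; rewrite ?inE// => t /= ft.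
  by apply: sN => /= /(_ Logic.I).
move=> f00; exists [set t | f t <> 0%E]; split => // t /=.
by apply: contra_not => + _.
Qed.

(** By Tonelli both sides say that the set [A] of bad pairs is null for the product measure; [u12]
    makes the sections of [A] independent of the order of the two updates. *)
Lemma almost_allC W : measurable W ->
  almost_all m1 u1 (almost_all m2 u2 W) = almost_all m2 u2 (almost_all m1 u1 W).
Proof.
move=> mW; apply/funext => z; apply/propext.
pose A := [set t : T1 * T2 | ~ W (u2 (u1 z t.1) t.2)].
have mA : measurable A.
  have mf : measurable_fun setT (fun t : T1 * T2 => u2 (u1 z t.1) t.2).
    have mu1z : measurable_fun setT (fun t : T1 * T2 => u1 z t.1).
      exact: (measurableT_comp (measurableT_comp mu1 (pair1_measurable z))
        measurable_fst).
    exact: (measurableT_comp mu2 (measurable_fun_pair mu1z measurable_snd)).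
  have := mf measurableT _ (measurableC mW); rewrite setTI; exact.
have := indic_fubini_tonelli m1 m2 mA.
rewrite (indic_fubini_tonelli_FE _ mA) (indic_fubini_tonelli_GE _ mA) => E.
have := integral_eq0P m1 (measurable_fun_xsection m2 mA) (fun=> measure_ge0 _ _).
have := integral_eq0P m2 (measurable_fun_ysection m1 mA) (fun=> measure_ge0 _ _).
rewrite -E /= => H2 H1.
have E1 : [set t | m2 (xsection A t) <> 0%E] =
    [set t | ~ almost_all m2 u2 W (u1 z t)].
  by apply/seteqP; split=> t /=; rewrite /almost_all /= xsectionE.
have E2 : [set t | m1 (ysection A t) <> 0%E] =
    [set t | ~ almost_all m1 u1 W (u2 z t)].
  have yE t : ysection A t = [set t1 | ~ W (u1 (u2 z t) t1)].
    by rewrite ysectionE /A; apply/funext => t1 /=; rewrite u12.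
  by apply/funext => t /=; rewrite yE.
by rewrite /almost_all /= -E1 -E2; split => [/H1/H2|/H2/H1].
Qed.

End AlmostAllC.

(** The push-forward of Lebesgue measure under the affine map, multiplied by [|c|], has the right
    value on half-open intervals and hence is Lebesgue measure. For negative [c] the preimage is
    half-open on the other side, with the same length. *)
Lemma null_affine (R : realType) (c b : R) (A : set (measurableTypeR R)) : c != 0 ->
  measurable A -> lebesgue_measure A = 0%E ->
  lebesgue_measure ([set t | A (c * t + b)] : set (measurableTypeR R)) = 0%E.
Proof.
move=> c0 mA A0.
pose f (t : measurableTypeR R) : measurableTypeR R := c * t + b.
have mf : measurable_fun setT f.
  by apply: measurable_funD => //; apply: measurable_funM.
have nc0 : 0 <= `|c| by [].
pose m := mscale (NngNum nc0) (pushforward lebesgue_measure f).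
have mE X : measurable X -> lebesgue_measure X = m mf X.
  apply: lebesgue_measure_unique => _ [[x y] _ <-].
  rewrite [RHS](_ : _ =
      (`|c|%:E * lebesgue_measure (f @^-1` `]x, y]%classic))%E)//.
  rewrite lebesgue_measure_itv/= lte_fin.
  have [cp|cN] := ltP 0 c.
    have -> : f @^-1` `]x, y]%classic = `](x - b) / c, (y - b) / c]%classic.
      apply/seteqP; split => t; rewrite /= !in_itv /= /f ltr_pdivrMr//
        ler_pdivlMr// ltrBlDr lerBrDr (mulrC t).
        by [].
      by [].
    rewrite lebesgue_measure_itv/= lte_fin ltr_pM2r ?invr_gt0// ltrD2r.
    rewrite gtr0_norm//; case: ifPn => _; last by rewrite mule0.
    by rewrite -!EFinB -EFinM; congr EFin; field.
  have {}cN : c < 0 by rewrite lt_neqAle c0.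
  have -> : f @^-1` `]x, y]%classic = `[(y - b) / c, (x - b) / c[%classic.
    apply/seteqP; split => t; rewrite /= !in_itv /= /f ltr_ndivlMr//
      ler_ndivrMr// ltrBlDr lerBrDr (mulrC t) andbC.
      by [].
    by [].
  rewrite lebesgue_measure_itv/= lte_fin ltr_nM2r ?invr_lt0// ltrD2r.
  rewrite ltr0_norm//; case: ifPn => _; last by rewrite mule0.
  by rewrite -!EFinB -EFinM; congr EFin; field.
have := mE _ mA; rewrite A0 => /esym/eqP.
rewrite [m mf A](_ : _ = (`|c|%:E * lebesgue_measure (f @^-1` A))%E)//.
rewrite mule_eq0 eqe normr_eq0 (negbTE c0) /= => /eqP.
by [].
Qed.

Lemma lebesgue_measure_setT_neq0 (R : realType) :
  lebesgue_measure (setT : set (measurableTypeR R)) <> 0%E.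
Proof. by rewrite -(set_itvNyy R) lebesgue_measure_itv. Qed.

Section MatrixTuples.
Context (R : realType) (n : nat).
Local Notation rT := (measurableTypeR R).

(** Nested tuples carry the product sigma-algebra generated by the entries; [mx_of] and [mt_of]
    below pass to matrices and back. *)
Definition mtuple : Type := n.-tuple (n.-tuple rT).
HB.instance Definition _ := Measurable.on mtuple.
Local Notation I := ('I_n * 'I_n)%type.
Implicit Types (y : mtuple) (a b : I) (s : seq I).

Definition entry y a : R := tnth (tnth y a.1) a.2.
Definition mtuple_of (f : I -> R) : mtuple := [tuple [tuple f (i, j) | j < n] | i < n].

Lemma entryE f a : entry (mtuple_of f) a = f a.
Proof. by rewrite /entry !tnth_mktuple; case: a. Qed.

Lemma mtupleP y y' : (forall a, entry y a = entry y' a) -> y = y'.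
Proof.
move=> yy'; apply: eq_from_tnth => i; apply: eq_from_tnth => j.
exact: (yy' (i, j)).
Qed.

Lemma measurable_entry a : measurable_fun setT (fun y => entry y a : rT).
Proof.
exact: (measurableT_comp (measurable_tnth a.2) (measurable_tnth a.1)).
Qed.

Lemma measurable_entries d (T : measurableType d) (f : T -> mtuple) :
  (forall a, measurable_fun setT (fun t => entry (f t) a : rT)) ->
  measurable_fun setT f.
Proof.
move=> mf; apply/measurable_fun_tnthP => i; apply/measurable_fun_tnthP => j.
exact: (mf (i, j)).
Qed.

Definition upd y a (t : rT) : mtuple := mtuple_of (fun b => if b == a then t else entry y b).

Lemma upd_entry y a t b : entry (upd y a t) b = if b == a then t else entry y b.
Proof. exact: entryE. Qed.

Lemma updC y a b t t' : a != b -> upd (upd y a t) b t' = upd (upd y b t') a t.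
Proof.
move=> ab; apply: mtupleP => c; rewrite !upd_entry.
by case: (eqVneq c a) => // ->; rewrite (negbTE ab).
Qed.

Lemma measurable_upd a : measurable_fun setT (fun p : mtuple * rT => upd p.1 a p.2).
Proof.
apply: measurable_entries => b; under eq_fun do rewrite upd_entry.
case: (b == a); first exact: measurable_snd.
exact: (measurableT_comp (measurable_entry b) measurable_fst).
Qed.

Lemma measurable_not_upd y a (Q : set mtuple) :
  measurable Q -> measurable [set t : rT | ~ Q (upd y a t)].
Proof.
exact: (@measurable_not_section _ _ _ _ (fun y => upd y a) (measurable_upd a)).
Qed.

Definition ae1 a : set mtuple -> set mtuple :=
  almost_all lebesgue_measure (fun y => upd y a).

(** The head of [s] is the outermost quantifier. The entries of the argument listed in [s] are
    overwritten, so that only the remaining ones matter ([aes_agree]). *)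
Definition aes s (P : set mtuple) : set mtuple := foldr ae1 P s.

Implicit Types P : set mtuple.

Lemma measurable_aes s P : measurable P -> measurable (aes s P).
Proof.
move=> mP; elim: s => //= a s IH; apply: measurable_almost_all => //.
exact: measurable_upd.
Qed.

Lemma aes_mem s P a : measurable P -> a \in s ->
  aes s P = ae1 a (aes (rem a s) P).
Proof.
move=> mP; elim: s => //= b s IH; rewrite inE.
case: (eqVneq b a) => [->//|ba] /= /IH ->.
apply: almost_allC; [exact: measurable_upd|exact: measurable_upd| |exact: measurable_aes].
by move=> y t t'; rewrite updC.
Qed.

Lemma aes_perm s s' P : measurable P -> perm_eq s s' -> aes s P = aes s' P.
Proof.
move=> mP; elim: s s' => [|a s IH] s'.
  by rewrite perm_sym => /perm_nilP ->.
move=> pss'; have as' : a \in s' by rewrite -(perm_mem pss') mem_head.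
rewrite (aes_mem mP as') /=; congr ae1; apply: IH.
by rewrite -(perm_cons a); apply: perm_trans pss' _; exact: perm_to_rem.
Qed.

Lemma aes_agree s P y y' : (forall a, a \notin s -> entry y a = entry y' a) ->
  aes s P y -> aes s P y'.
Proof.
elim: s y y' => [|a s IH] y y' yy'.
  by rewrite (_ : y = y')//; apply: mtupleP => a; exact: yy'.
rewrite /= /ae1 /almost_all /= => H; rewrite -[RHS]H; congr lebesgue_measure.
apply/seteqP; split=> t /=; apply: contra_not; apply: IH => b bs;
  rewrite !upd_entry; case: eqVneq => // ba; rewrite yy'// inE negb_or ba//.
Qed.

Lemma aesS s P P' : measurable P -> measurable P' -> P `<=` P' -> aes s P `<=` aes s P'.
Proof.
move=> mP mP' PP'; elim: s => //= a s IH.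
apply: almost_allS => //; [exact: measurable_upd|exact: measurable_aes..].
Qed.

Lemma aesI s P P' : measurable P -> measurable P' ->
  aes s P `&` aes s P' `<=` aes s (P `&` P').
Proof.
move=> mP mP'; elim: s => //= a s IH y [Py P'y].
have mA Q : measurable Q -> measurable [set t | ~ aes s Q (upd y a t)].
  move=> mQ; exact: measurable_not_upd (measurable_aes s mQ).
apply/eqP; rewrite -measure_le0.
apply: (@le_trans _ _ (lebesgue_measure ([set t | ~ aes s P (upd y a t)] `|`
  [set t | ~ aes s P' (upd y a t)]))).
  apply: le_measure; rewrite ?inE.
  - by apply: mA; exact: measurableI.
  - by apply: measurableU; exact: mA.
  - move=> t /= nP; apply/not_andP => -[H1 H2]; apply: nP; exact: IH.
by rewrite null_set_setU//; exact: mA.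
Qed.

(** The quantifier is consistent because the line is not a null set. The final contradiction of
    [overlap] rests on this. *)
Lemma aes0 s y : ~ aes s set0 y.
Proof.
elim: s y => [y []|a s IH y] /=; rewrite /ae1 /almost_all /=.
rewrite (_ : [set t | _] = setT); last first.
  by apply/seteqP; split => // t _ /=; exact: IH.
exact: lebesgue_measure_setT_neq0.
Qed.

Lemma aes_setT s y : aes s setT y.
Proof.
elim: s y => //= a s IH y; rewrite /ae1 /almost_all /=.
rewrite (_ : [set t | _] = set0) ?measure0//.
by apply/seteqP; split => // t /= ; exact.
Qed.

Definition ae_mtuple P : Prop := aes (enum {: I}) P (mtuple_of (fun=> 0)).

Lemma ae_mtupleP P y : ae_mtuple P <-> aes (enum {: I}) P y.
Proof. by split; apply: aes_agree => a; rewrite mem_enum. Qed.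

(** The quantifier over [X] is moved past the entries one at a time by [almost_allC]; for this the
    point of [X] is carried along as a second component of the state. *)
Lemma ae_fubini d (X : measurableType d) (m : {sigma_finite_measure set X -> \bar R})
    (W : set (mtuple * X)) : measurable W ->
  m [set x | ~ ae_mtuple [set y | W (y, x)]] = 0%E <->
  ae_mtuple [set y | m [set x | ~ W (y, x)] = 0%E].
Proof.
move=> mW; pose Z := (mtuple * X)%type.
pose W' s : set Z := [set z | aes s [set y | W (y, z.2)] z.1].
have mup b : measurable_fun setT (fun p : Z * rT => (upd p.1.1 b p.2, p.1.2) : Z).
  apply: measurable_fun_pair; last first.
    exact: (measurableT_comp measurable_snd measurable_fst).
  have m1 : measurable_fun setT (fun p : Z * rT => p.1.1).
    exact: (measurableT_comp measurable_fst measurable_fst).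
  exact: (measurableT_comp (measurable_upd b) (measurable_fun_pair m1 measurable_snd)).
have W'E b s' : W' (b :: s') =
    almost_all lebesgue_measure (fun (z : Z) (t : rT) => (upd z.1 b t, z.2) : Z) (W' s').
  by [].
have mW' s' : measurable (W' s').
  elim: s' => [|b s' IHs].
    by rewrite (_ : W' [::] = W)//; apply/seteqP; split => -[].
  by rewrite W'E; exact: measurable_almost_all.
have mux : measurable_fun setT (fun p : Z * X => (p.1.1, p.2) : Z).
  apply: measurable_fun_pair; last exact: measurable_snd.
  exact: (measurableT_comp measurable_fst measurable_fst).
have E s : almost_all m (fun (z : Z) x => (z.1, x) : Z) (W' s) =
    [set z | aes s [set y | m [set x | ~ W (y, x)] = 0%E] z.1].
  elim: s => [//|a s IH].
  have /esym := @almost_allC _ _ _ _ _ _ _ lebesgue_measure m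
    (fun (z : Z) (t : rT) => (upd z.1 a t, z.2) : Z) (fun (z : Z) x => (z.1, x) : Z)
    (mup a) mux (fun _ _ _ => erefl) (W' s) (mW' s).
  by rewrite -W'E => ->; rewrite IH.
(* [E] equates subsets of [mtuple * X] and can be evaluated only if [X] has a point. For empty [X]
   both sides hold trivially. *)
case: (pselect (exists x : X, True)) => [[x _]|NX].
  pose y0 : mtuple := mtuple_of (fun=> 0).
  suff : almost_all m (fun (z : Z) x => (z.1, x) : Z) (W' (enum {: I})) (y0, x) <->
      [set z : Z | aes (enum {: I}) [set y | m [set x | ~ W (y, x)] = 0%E] z.1] (y0, x).
    exact.
  by rewrite E.
have X0 (S : set X) : m S = 0%E.
  by rewrite (_ : S = set0) ?measure0//; apply/seteqP; split => // x; case: NX; exists x.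
split => _; last exact: X0.
by rewrite (_ : [set y | _] = setT) ?/ae_mtuple; [exact: aes_setT|
  apply/seteqP; split => // y _; exact: X0].
Qed.

Lemma measurable_ae_section d (X : measurableType d) (W : set (mtuple * X)) :
  measurable W -> measurable [set x | ae_mtuple [set y | W (y, x)]].
Proof.
move=> mW; pose Z := (mtuple * X)%type.
pose W' s : set Z := [set z | aes s [set y | W (y, z.2)] z.1].
have mup b : measurable_fun setT (fun p : Z * rT => (upd p.1.1 b p.2, p.1.2) : Z).
  apply: measurable_fun_pair; last first.
    exact: (measurableT_comp measurable_snd measurable_fst).
  have m1 : measurable_fun setT (fun p : Z * rT => p.1.1).
    exact: (measurableT_comp measurable_fst measurable_fst).
  exact: (measurableT_comp (measurable_upd b) (measurable_fun_pair m1 measurable_snd)).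
have mW' s' : measurable (W' s').
  elim: s' => [|b s' IHs].
    by rewrite (_ : W' [::] = W)//; apply/seteqP; split => -[].
  exact: (@measurable_almost_all _ _ _ _ _ lebesgue_measure
    (fun (z : Z) (t : rT) => (upd z.1 b t, z.2) : Z) (mup b) _ IHs).
have := measurable_xsection (mtuple_of (fun=> 0)) (mW' (enum {: I})).
by rewrite xsectionE.
Qed.

Definition affine_upd s (c : I -> R) (be : I -> mtuple -> R) y : mtuple :=
  mtuple_of (fun a => if a \in s then c a * entry y a + be a y else entry y a).

Lemma measurable_affine_upd s c be : (forall a, measurable_fun setT (be a : _ -> rT)) ->
  measurable_fun setT (affine_upd s c be).
Proof.
move=> mbe; apply: measurable_entries => a; under eq_fun do rewrite entryE.
case: (a \in s); last exact: measurable_entry.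
apply: measurable_funD; last exact: mbe.
by apply: measurable_funM => //; exact: measurable_entry.
Qed.

(* [be a] must not depend on the entries in [s], so that the entries in [s] may
   be changed one after the other. *)
Lemma ae_affine_upd s c be P : uniq s -> (forall a, c a != 0) ->
  (forall a, measurable_fun setT (be a : _ -> rT)) ->
  (forall a b y t, b \in s -> be a (upd y b t) = be a y) ->
  measurable P -> ae_mtuple P -> ae_mtuple [set y | P (affine_upd s c be y)].
Proof.
move=> + c0 mbe; elim: s P => [|a s IH] P /=.
  move=> _ _ mP; rewrite (_ : [set y | _] = P)//; apply/seteqP.
  by split=> y /=; rewrite (_ : affine_upd _ _ _ y = y)//;
    apply: mtupleP => a; rewrite entryE.
move=> /andP[as' us] beE mP aeP.
pose P1 : set mtuple := [set y | P (affine_upd [:: a] c be y)].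
have mP1 : measurable P1.
  by have := measurable_affine_upd [:: a] c mbe measurableT mP; rewrite setTI.
have compE : [set y | P (affine_upd (a :: s) c be y)] =
    [set y | P1 (affine_upd s c be y)].
  suff E y : affine_upd (a :: s) c be y = affine_upd [:: a] c be (affine_upd s c be y).
    by apply/seteqP; split=> y /=; rewrite /P1 /= E.
  have beaE : be a (affine_upd s c be y) = be a y.
    (* The updated entries are restored one by one, none of them being seen by [be a]. The induction
       runs over subsequences of [s] because each restored entry has to be known to lie in [s]. *)
    have : forall r, subseq r s -> be a (affine_upd r c be y) = be a y.
      elim=> [|b r IHr] rs.
        congr (be a _); apply: mtupleP => b; rewrite entryE//.
      have brs : b \in s by rewrite (mem_subseq rs) ?mem_head.
      rewrite -(IHr (subseq_trans (subseq_cons _ _) rs)).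
      rewrite -(@beE a b (affine_upd r c be y) (entry (affine_upd (b :: r) c be y) b)).
        congr (be a _); apply: mtupleP => d; rewrite upd_entry.
        case: (eqVneq d b) => [->//|db]; rewrite !entryE inE (negbTE db)//=.
      by rewrite inE brs orbT.
    by move/(_ s); apply.
  apply: mtupleP => b; rewrite !entryE !inE; case: (eqVneq b a) => [->|ba] //=.
  by rewrite beaE (negbTE as').
rewrite compE; apply: IH => //.
  by move=> a' b y t bs; apply: beE; rewrite inE bs orbT.
(* With [a] as the innermost quantifier, the change of this entry is an affine substitution in one
   real variable, as treated in [null_affine]. *)
have pe : perm_eq (enum {: I}) (rcons (rem a (enum {: I})) a).
  by rewrite perm_sym perm_rcons perm_sym; apply: perm_to_rem; rewrite mem_enum.
move: aeP; rewrite /ae_mtuple (aes_perm mP pe) (aes_perm mP1 pe) /aes !foldr_rcons.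
have mae Q : measurable Q -> measurable (ae1 a Q).
  by apply: measurable_almost_all; exact: measurable_upd.
apply: (@aesS (rem a _)); [exact: mae|exact: mae|] => y; rewrite /ae1 /almost_all /=.
move=> Py; have := null_affine (be a y) (c0 a) _ Py.
rewrite (_ : [set t | ~ P1 (upd y a t)] =
   [set t | [set t | ~ P (upd y a t)] (c a * t + be a y)]).
  by apply; exact: measurable_not_upd.
suff E t : affine_upd [:: a] c be (upd y a t) = upd y a (c a * t + be a y).
  by apply/seteqP; split=> t; rewrite /P1 /= E.
apply: mtupleP => b; rewrite entryE !upd_entry inE.
by case: (eqVneq b a) => // ->; rewrite beE// mem_head.
Qed.

End MatrixTuples.

(** * Invariance of the quantifier under right multiplication *)

Section MatrixAction.
Context (R : realType) (n : nat).
Local Notation rT := (measurableTypeR R).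
Local Notation mtuple := (mtuple R n).
Local Notation I := ('I_n * 'I_n)%type.
Implicit Types (y : mtuple) (P : set mtuple) (h : 'M[R]_n).

Definition mx_of y : 'M[R]_n := \matrix_(i, j) entry y (i, j).
Definition mt_of h : mtuple := mtuple_of (fun a => h a.1 a.2).

Lemma mx_ofK y : mt_of (mx_of y) = y.
Proof. by apply: mtupleP => -[i j]; rewrite entryE mxE. Qed.

Lemma mt_ofK h : mx_of (mt_of h) = h.
Proof. by apply/matrixP => i j; rewrite mxE entryE. Qed.

Definition mulmt y h : mtuple := mt_of (mx_of y *m h).

Lemma mulmtA y h h' : mulmt (mulmt y h) h' = mulmt y (h *m h').
Proof. by rewrite /mulmt mt_ofK mulmxA. Qed.

Lemma measurable_mulmt h : measurable_fun setT (mulmt^~ h).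
Proof.
apply: measurable_entries => a; under eq_fun do rewrite entryE mxE.
apply: measurable_sum => k; apply: measurable_funM => //.
by under eq_fun do rewrite mxE; exact: measurable_entry.
Qed.

Definition ae_invariant h : Prop :=
  forall P, measurable P -> ae_mtuple P -> ae_mtuple [set y | P (mulmt y h)].

Lemma ae_invariantM h h' : ae_invariant h -> ae_invariant h' -> ae_invariant (h *m h').
Proof.
move=> ih ih' P mP aeP.
have mP' : measurable [set y | P (mulmt y h')].
  by have := measurable_mulmt h' measurableT mP; rewrite setTI.
have := ih _ mP' (ih' _ mP aeP); congr ae_mtuple; apply/seteqP.
by split=> y /=; rewrite mulmtA.
Qed.

Lemma ae_invariant1 : ae_invariant 1%:M.
Proof.
move=> P mP; congr ae_mtuple; apply/seteqP; split=> y /=;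
  by rewrite /mulmt mulmx1 mx_ofK.
Qed.

(** Right multiplication by a permutation matrix permutes the columns, which amounts to permuting
    the quantifiers. *)
Lemma ae_invariant_perm (s : 'S_n) : ae_invariant (perm_mx s).
Proof.
move=> P mP aeP.
have sE y i j : entry (mulmt y (perm_mx s)) (i, j) = entry y (i, (s^-1)%g j).
  by rewrite entryE -[s in perm_mx s]invgK -col_permE !mxE.
have aesE r y : aes r [set y | P (mulmt y (perm_mx s))] y =
    aes [seq (a.1, s a.2) | a <- r] P (mulmt y (perm_mx s)).
  elim: r y => //= a r IH y; rewrite /ae1 /almost_all /=.
  congr (_ _ = _); apply/funext => t /=; rewrite IH.
  congr (~ aes _ _ _); apply: mtupleP => -[i j]; rewrite sE !upd_entry sE.
  by case: a => k l /=; rewrite !xpair_eqE (can2_eq (permKV s) (permK s)).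
have pe : perm_eq (enum {: I}) [seq (a.1, s a.2) | a <- enum {: I}].
  apply: uniq_perm; first exact: enum_uniq.
    rewrite map_inj_uniq; first exact: enum_uniq.
    by move=> [i j] [k l] /= [-> /perm_inj ->].
  move=> [i j]; rewrite mem_enum; apply/esym/mapP; exists (i, (s^-1)%g j).
    by rewrite mem_enum.
  by rewrite /= permKV.
pose y0 : mtuple := mtuple_of (fun=> 0).
by apply/(ae_mtupleP _ y0); rewrite aesE -(aes_perm mP pe); apply/ae_mtupleP.
Qed.

Definition cols_mx (s : seq 'I_n) h : 'M[R]_n :=
  \matrix_(i, j) if j \in s then h i j else (i == j)%:R.

(** The multiplication changes column [k] only: it is scaled by the nonzero diagonal entry [h k k],
    and a combination of the other columns, which does not involve column [k], is added. *)
Lemma ae_invariant_col h k : h k k != 0 -> ae_invariant (cols_mx [:: k] h).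
Proof.
move=> hk P mP aeP.
pose s : seq I := [seq (i, k) | i <- enum 'I_n].
have memS i j : ((i, j) \in s) = (j == k).
  apply/mapP/eqP => [[i' _ [_ ->]]//|->]; exists i => //.
  by rewrite mem_enum.
pose c (a : I) := h k k.
pose be (a : I) y := \sum_(l < n | l != k) entry y (a.1, l) * h l k.
have := @ae_affine_upd R n s c be P.
rewrite (_ : [set y | P (affine_upd s c be y)] =
    [set y | P (mulmt y (cols_mx [:: k] h))]).
  apply => //.
  - by rewrite map_inj_uniq ?enum_uniq// => i j [].
  - move=> a; rewrite /be; under eq_fun do rewrite big_mkcond.
    apply: measurable_sum => l; case: (l != k) => //.
    by apply: measurable_funM => //; exact: measurable_entry.
  - move=> a [i j] y t; rewrite memS => /eqP ->; rewrite /be.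
    apply: eq_bigr => l lk; rewrite upd_entry xpair_eqE (negbTE lk) andbF//.
suff E y : affine_upd s c be y = mulmt y (cols_mx [:: k] h).
  by apply/seteqP; split=> y /=; rewrite E.
apply: mtupleP => -[i j]; rewrite !entryE memS mxE /=.
case: (eqVneq j k) => [->|jk].
  rewrite (bigD1 k)//= !mxE mem_head mulrC; congr (_ + _).
  by apply: eq_bigr => l lk; rewrite !mxE mem_head.
rewrite (bigD1 j)//= !mxE inE (negbTE jk) eqxx mulr1 big1 ?addr0// => l lj.
by rewrite !mxE inE (negbTE jk) (negbTE lj) mulr0.
Qed.

(** The triangularity condition splits off the first column [k]: as [h l k] vanishes for all later
    [l], column [k] of the product combines only columns of [cols_mx s h] that are still unit
    vectors, and it equals column [k] of [h]. *)
Lemma ae_invariant_cols s h : (forall k, h k k != 0) ->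
  pairwise (fun k l => (k != l) && (h l k == 0)) s -> ae_invariant (cols_mx s h).
Proof.
move=> h0; elim: s => [|k s IH] /=.
  move=> _; rewrite (_ : cols_mx [::] h = 1%:M); first exact: ae_invariant1.
  by apply/matrixP => i j; rewrite !mxE.
move=> /andP[/allP ks /IH is_].
rewrite (_ : cols_mx _ _ = cols_mx s h *m cols_mx [:: k] h).
  by apply: ae_invariantM => //; exact: ae_invariant_col.
have sE i l : l \in s -> cols_mx s h i l * h l k = 0.
  by move=> ls; have /andP[_ /eqP ->] := ks _ ls; rewrite mulr0.
apply/matrixP => i j; rewrite !mxE inE; case: (eqVneq j k) => [->|jk] /=.
  transitivity (\sum_l cols_mx s h i l * h l k); last first.
    by apply: eq_bigr => l _; rewrite [cols_mx [:: k] h l k]mxE mem_head.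
  case: (boolP (i \in s)) => is1.
    have /andP[_ /eqP ->] := ks _ is1; rewrite big1// => l _.
    have [/sE->//|ls] := boolP (l \in s).
    rewrite mxE (negbTE ls); case: eqP => [il|_]; last by rewrite mul0r.
    by move: ls; rewrite -il is1.
  rewrite (bigD1 i)//= mxE (negbTE is1) eqxx mul1r big1 ?addr0// => l li.
  have [/sE->//|ls] := boolP (l \in s).
  by rewrite mxE (negbTE ls) [i == l]eq_sym (negbTE li) mul0r.
rewrite (bigD1 j)//= !mxE inE (negbTE jk) eqxx mulr1 big1 ?addr0// => l lj.
by rewrite !mxE inE (negbTE jk) (negbTE lj) mulr0.
Qed.

Lemma cols_mx_enum h s : (forall k, k \in s) -> cols_mx s h = h.
Proof. by move=> hs; apply/matrixP => i j; rewrite mxE hs. Qed.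

End MatrixAction.

Lemma ae_invariant_unit (R : realType) (n : nat) (h : 'M[R]_n) :
  h \in unitmx -> ae_invariant h.
Proof.
(* The LUP factorization is stated for positive size; there is only one matrix of size 0, the
   identity. *)
case: n h => [h _|n h uh].
  by rewrite [h]flatmx0 -[0](flatmx0 1%:M); exact: ae_invariant1.
have := cormen_lup_correct h; have := @cormen_lup_lower _ _ h.
have := @cormen_lup_upper _ _ h; have := cormen_lup_perm h; have := cormen_lup_detL h.
case: (cormen_lup h) => [[P L] U] /= detL /is_perm_mxP[s ->] Uu Ll hE.
have {}hE : h = perm_mx s^-1 *m (L *m U).
  by rewrite -[L *m U]hE mulmxA -perm_mxM mulVg perm_mx1 mul1mx.
have sorted_enum : pairwise ltn (map val (enum 'I_n.+1)).
  rewrite val_enum_ord -sorted_pairwise; last exact: ltn_trans.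
  exact: iota_ltn_sorted.
have uU : U \in unitmx by move: uh; rewrite hE !unitmx_mul => /and3P[].
have U0 k : U k k != 0.
  have : \det U != 0 by rewrite -unitfE -unitmxE.
  rewrite -det_tr det_trig.
    apply: contra => /eqP Uk; apply/prodf_eq0; exists k => //.
    by rewrite mxE Uk.
  by apply/is_trig_mxP => i j ij; rewrite mxE Uu.
have L0 k : L k k != 0 by rewrite Ll// eqxx oner_eq0.
rewrite hE; apply: ae_invariantM; first exact: ae_invariant_perm.
apply: ae_invariantM.
  (* [L l k] vanishes for [l < k], so the columns of the lower factor are listed in decreasing
     order; those of the upper factor are listed in increasing order. *)
  rewrite -(@cols_mx_enum _ _ L (rev (enum 'I_n.+1))); last first.
    by move=> k; rewrite mem_rev mem_enum.
  apply: ae_invariant_cols => //.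
  have : pairwise (fun k l => ltn l k) (map val (rev (enum 'I_n.+1))).
    rewrite map_rev -sorted_pairwise; last by move=> a b c /= ba cb; exact: ltn_trans cb ba.
    rewrite rev_sorted val_enum_ord; exact: iota_ltn_sorted.
  rewrite pairwise_map; apply: sub_pairwise => k l /= lk.
  rewrite Ll ?(ltnW lk)//.
  have -> : (l == k) = false by apply/negbTE; rewrite -val_eqE neq_ltn lk.
  by rewrite eqxx andbT -val_eqE neq_ltn lk orbT.
rewrite -(@cols_mx_enum _ _ U (enum 'I_n.+1)); last by move=> k; rewrite mem_enum.
apply: ae_invariant_cols => //.
move: sorted_enum; rewrite pairwise_map; apply: sub_pairwise => k l /= kl.
by rewrite Uu// eqxx andbT -val_eqE neq_ltn kl.
Qed.

Section AlmostAllUnits.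
Context (R : realType) (n : nat).
Local Notation rT := (measurableTypeR R).
Local Notation mtuple := (mtuple R n).
Local Notation I := ('I_n * 'I_n)%type.

Lemma measurable_det d (T : measurableType d) (f : T -> 'M[R]_n) :
  (forall i j, measurable_fun setT (fun t => f t i j : rT)) ->
  measurable_fun setT (fun t => \det (f t) : rT).
Proof.
move=> mf; rewrite /determinant; apply: measurable_sum => s.
apply: measurable_funM => //; apply: measurable_prod => i _; exact: mf.
Qed.

Lemma null_roots (p : {poly R}) : p != 0 ->
  lebesgue_measure ([set t | root p t] : set rT) = 0%E.
Proof.
move=> p0; apply: countable_lebesgue_measure0; apply: finite_set_countable.
apply: contrapT => /(infinite_set_fset (size p))[B sB szB].
have aB : all (root p) B by apply/allP => x xB; exact: (sB x).
by have := max_poly_roots p0 aB (fset_uniq B); rewrite ltnNge szB.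
Qed.

(* Almost every translate of a matrix by a scalar is invertible, and almost-all
   statements are invariant under translations. *)
Lemma ae_mtuple_unit : ae_mtuple [set y : mtuple | mx_of y \in unitmx].
Proof.
pose W : set (mtuple * rT) := [set z | mx_of z.1 + (z.2)%:M \in unitmx].
have mdet (T : measurableType _) (f : T -> 'M[R]_n) :
    (forall i j, measurable_fun setT (fun t => f t i j : rT)) ->
    measurable [set t | f t \in unitmx].
  move=> mf; have := measurable_det mf measurableT (measurableC (measurable_set1 0)).
  rewrite setTI; congr measurable; apply/seteqP; split=> t /=;
  by rewrite unitmxE unitfE => /eqP.
have mW : measurable W.
  apply: mdet => i j.
  under eq_fun do rewrite !mxE.
  apply: measurable_funD.
    exact: (measurableT_comp (measurable_entry (i, j)) measurable_fst).
  case: (i == j).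
    by under eq_fun do rewrite mulr1n; exact: measurable_snd.
  by under eq_fun do rewrite mulr0n; exact: measurable_cst.
(* The matrix [y + t] is singular exactly when [t] is an eigenvalue of [- y], which leaves finitely
   many [t]. *)
have W0 y : lebesgue_measure ([set t | ~ W (y, t)] : set rT) = 0%E.
  rewrite (_ : [set t | _] = [set t | root (char_poly (- mx_of y)) t]).
    by apply: null_roots; apply: monic_neq0; exact: char_poly_monic.
  apply/funext => t; apply/propext; rewrite /W /=.
  rewrite -eigenvalue_root_char /eigenvalue /eigenspace kermx_eq0 row_free_unit.
  rewrite -opprD -scaleN1r unitmxZ ?unitrN1//.
  by split=> /negP.
have [t Wt] : exists t : rT, ae_mtuple [set y | W (y, t)].
  apply: contrapT => /forallNP NW.
  apply: (@lebesgue_measure_setT_neq0 R); have /(ae_fubini _ mW) <- :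
      ae_mtuple [set y | lebesgue_measure ([set t | ~ W (y, t)] : set rT) = 0%E].
    rewrite (_ : [set y | _] = setT); first exact: aes_setT.
    by apply/seteqP; split => // y _; exact: W0.
  by congr lebesgue_measure; apply/seteqP; split => // t _ /=.
(* For the fixed [t] just found, subtracting [t] from the diagonal entries undoes the
   translation. *)
pose s : seq I := [seq (i, i) | i <- enum 'I_n].
have memS i j : ((i, j) \in s) = (i == j).
  apply/mapP/eqP => [[i' _ [-> ->]]//|->]; exists j => //.
  by rewrite mem_enum.
have := @ae_affine_upd R n s (fun=> 1) (fun _ _ => - t) [set y | W (y, t)].
rewrite (_ : [set y | _ (affine_upd _ _ _ y)] = [set y | mx_of y \in unitmx]).
  apply => //.
  - by rewrite map_inj_uniq ?enum_uniq// => i j /(congr1 fst).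
  - by have := @measurable_ysection _ _ _ _ W t mW; rewrite ysectionE.
apply/funext => y /=; congr (is_true (_ \in unitmx)).
apply/matrixP => i j; rewrite !mxE entryE memS.
by case: eqP => [->|_]; rewrite ?mulr1n ?mulr0n ?addr0 ?mul1r ?subrK.
Qed.

End AlmostAllUnits.

(** * Uniqueness of invariant measures *)

Section InvariantUniqueness.
Context (R : realType) (n : nat) d (X : measurableType d).
Local Notation mtuple := (mtuple R n).
Variable act : 'M[R]_n -> X -> X.
Hypothesis measurable_act :
  measurable_fun setT (fun p : mtuple * X => act (mx_of p.1) p.2).
Hypothesis actM : forall g h x, g \in unitmx -> h \in unitmx ->
  act (g *m h) x = act g (act h x).
Hypothesis act_trans : forall x x', exists2 h, h \in unitmx & x' = act h x.

Definition act_invariant (m : set X -> \bar R) : Prop :=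
  forall g A, g \in unitmx -> measurable A -> m (act g @^-1` A) = m A.

Lemma measurable_act_fun g : measurable_fun setT (act g).
Proof.
have := measurableT_comp measurable_act (pair1_measurable (mt_of g)).
by rewrite /comp /=; under eq_fun do rewrite mt_ofK.
Qed.

Lemma measurable_mx_unit : measurable [set y : mtuple | mx_of y \in unitmx].
Proof.
have mdet : measurable_fun setT (fun y : mtuple => \det (mx_of y)).
  apply: measurable_det => i j; under eq_fun do rewrite mxE.
  exact: measurable_entry.
have := mdet measurableT _ (measurableC (measurable_set1 0)).
rewrite setTI; congr measurable; apply/seteqP; split=> t /=;
by rewrite unitmxE unitfE => /eqP.
Qed.

(** Suppose all the intersections are null. By Fubini some [x] in [A] is moved outside [A'] by
    almost every matrix. Transitivity and right invariance carry this over to every point, and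
    Fubini in the other direction makes a translate of [A'] null, against the invariance of [m]. *)
Lemma overlap (m : {sigma_finite_measure set X -> \bar R}) A A' :
  act_invariant m -> measurable A -> measurable A' -> m A <> 0%E -> m A' <> 0%E ->
  exists2 g, g \in unitmx & m (A `&` act g @^-1` A') <> 0%E.
Proof.
move=> minv mA mA' A0 A'0; apply: contrapT => H.
have Z g : g \in unitmx -> m (A `&` act g @^-1` A') = 0%E.
  by move=> gu; apply: contrapT => NZ; apply: H; exists g.
pose u : set (mtuple * X) := [set p | mx_of p.1 \in unitmx].
have mu_ : measurable u.
  by have := @measurable_fst _ _ mtuple X measurableT _ measurable_mx_unit; rewrite setTI.
pose W' : set (mtuple * X) := u `&` [set p | ~ A' (act (mx_of p.1) p.2)].
have mW' : measurable W'.
  apply: measurableI => //.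
  by have := measurable_act measurableT (measurableC mA'); rewrite setTI.
(* [W (y, x)] is the implication: if [y] is invertible and [x] lies in [A], then [y] moves [x]
   outside [A']. In [W'] invertibility is a conjunct instead, so that it does not depend on [A] and
   can be moved to other points. *)
pose W : set (mtuple * X) := ~` u `|` W' `|` [set p | ~ A p.2].
have mW : measurable W.
  apply: measurableU; first by apply: measurableU => //; exact: measurableC.
  by have := @measurable_snd _ _ mtuple X measurableT _ (measurableC mA); rewrite setTI.
have WE y x : ~ W (y, x) <-> [/\ mx_of y \in unitmx, A x & A' (act (mx_of y) x)].
  split=> [nW|[uy Ax A'x]].
    have uy : mx_of y \in unitmx by apply: contrapT => nu; apply: nW; left; left.
    split => //; first by apply: contrapT => nA; apply: nW; right.
    by apply: contrapT => nA; apply: nW; left; right.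
  by case=> [[|[_]]|]; exact.
have /(ae_fubini _ mW) W0 : ae_mtuple [set y | m [set x | ~ W (y, x)] = 0%E].
  rewrite (_ : [set y | _] = setT); first exact: aes_setT.
  apply/seteqP; split => // y _ /=.
  case: (boolP (mx_of y \in unitmx)) => [uy|nu].
    rewrite (_ : [set x | _] = A `&` act (mx_of y) @^-1` A'); first exact: Z.
    by apply/seteqP; split => x /=; [case/WE|case=> ? ?; apply/WE].
  rewrite (_ : [set x | _] = set0) ?measure0//.
  by apply/seteqP; split => // x /WE[]; rewrite (negbTE nu).
have [x Ax aex] : exists2 x, A x & ae_mtuple [set y | W (y, x)].
  apply: contrapT => NA; apply: A0; apply/eqP; rewrite -measure_le0 -[leRHS]W0.
  apply: le_measure; rewrite ?inE//.
    by apply: measurableC; exact: measurable_ae_section.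
  by move=> x Ax /= aex; apply: NA; exists x.
have mys (S : set (mtuple * X)) z : measurable S -> measurable [set y | S (y, z)].
  by move=> mS; have := measurable_ysection z mS; rewrite ysectionE.
have aex' : ae_mtuple [set y | W' (y, x)].
  have := aesI (mys _ x mW) measurable_mx_unit (conj aex (@ae_mtuple_unit R n)).
  apply: aesS; [|exact: mys|].
    by apply: measurableI; [exact: mys|exact: measurable_mx_unit].
  by move=> y /= [[[]|]].
(* Write [x'] as [h] applied to [x]. The matrix [y] acts on [x'] as [y *m h] acts on [x], and almost
   every [y] has [y *m h] in the good set of [x]. *)
have all x' : ae_mtuple [set y | W' (y, x')].
  have [h uh ->] := act_trans x x'.
  have := ae_invariant_unit uh (mys _ x mW') aex'.
  apply: aesS; [|exact: mys|].
    by have := measurable_mulmt h measurableT (mys _ x mW'); rewrite setTI.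
  move=> y [] /=; rewrite /u /= /mulmt mt_ofK unitmx_mul => /andP[uy _].
  by rewrite actM.
have : m [set x | ~ ae_mtuple [set y | W' (y, x)]] = 0%E.
  by rewrite (_ : [set x | _] = set0) ?measure0//; apply/seteqP; split => // z /=; exact.
move=> /(ae_fubini _ mW') aeA'.
suff : ae_mtuple (set0 : set mtuple) by exact: aes0.
move: aeA'.
have -> : [set y | m [set x0 | ~ W' (y, x0)] = 0%E] = set0 => //.
apply/seteqP; split => // y /= W'0.
(* No [y] can satisfy the statement: for invertible [y] the exceptional set is a translate of [A'],
   and for singular [y] it is the whole space and contains [A]. *)
case: (boolP (mx_of y \in unitmx)) => [uy|nu].
  apply: A'0; rewrite -(minv _ _ uy mA') -[RHS]W'0.
  rewrite (_ : act (mx_of y) @^-1` A' = [set x0 | ~ W' (y, x0)])//.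
  apply/seteqP; split => [z A'z [_]|z nW]; first exact.
  by apply: contrapT => nA'; apply: nW; split.
apply: A0; apply/eqP; rewrite -measure_le0 -[leRHS]W'0.
apply: le_measure; rewrite ?inE//.
  have := measurable_xsection y (measurableC mW'); rewrite xsectionE//.
by move=> z _ []; rewrite /u /= (negbTE nu).
Qed.

End InvariantUniqueness.

(** To be read with [a], [b] the mu-measures and [a'], [b'] the nu-measures of two sets. The
    hypothesis says without division that the ratio mu / nu is smaller on the first set, possibly
    infinite on the second; two distinct slopes fit strictly in between. *)
Lemma slope_gap (R : realFieldType) (a b a' b' : R) : 0 <= a -> 0 <= b ->
  0 <= a' -> 0 <= b' -> a * b' < b * a' ->
  exists c1 c2, [/\ c1 < c2, a < c1 * a' & c2 * b' < b].
Proof.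
move=> a0 b0 a'0 b'0 lt.
have a'p : 0 < a' by rewrite lt_neqAle a'0 andbT; apply/eqP => a'E; nra.
have bp : 0 < b by rewrite lt_neqAle b0 andbT; apply/eqP => bE; nra.
have [b'E|b'n] := eqVneq b' 0.
  exists (a / a' + 1), (a / a' + 2); split; first by rewrite ltrD2l; lra.
    by rewrite mulrDl mul1r divfK ?gt_eqF//; lra.
  by rewrite b'E mulr0.
have b'p : 0 < b' by rewrite lt_neqAle eq_sym b'n.
have ltq : a / a' < b / b' by rewrite ltr_pdivrMr// mulrAC ltr_pdivlMr.
(* The slopes lie at one third and at one half of the way between the two ratios. *)
exists (a / a' + (b / b' - a / a') / 3), (a / a' + (b / b' - a / a') / 2); split.
- by lra.
- by rewrite -ltr_pdivrMr//; lra.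
- by rewrite -ltr_pdivlMr//; lra.
Qed.

(** * Mixing implies proportionality *)

Section Proportional.
Context (R : realType) d (X : measurableType d) (I : Type).
Variables (f f' : I -> X -> X).
Hypothesis f'K : forall i, cancel (f' i) (f i).
Hypothesis mf : forall i, measurable_fun setT (f i).
Hypothesis mf' : forall i, measurable_fun setT (f' i).
Variables (mu nu : {measure set X -> \bar R}).
Hypothesis mu_f' : forall i A, measurable A -> mu (f' i @^-1` A) = mu A.
Hypothesis nu_f' : forall i A, measurable A -> nu (f' i @^-1` A) = nu A.
Hypothesis mix : forall A A', measurable A -> measurable A' ->
  (mu A + nu A <> 0)%E -> (mu A' + nu A' <> 0)%E ->
  exists i, (mu (A `&` f i @^-1` A') + nu (A `&` f i @^-1` A') <> 0)%E.
Local Open Scope ereal_scope.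

Section FinitePart.
Variables (E : set X) (mE : measurable E) (muE : mu E < +oo) (nuE : nu E < +oo).

Let fin_sub (m : {measure set X -> \bar R}) (mEoo : m E < +oo) (A : set X) :
  measurable A -> A `<=` E -> m A \is a fin_num.
Proof.
move=> mA AE; rewrite ge0_fin_numE//; apply: le_lt_trans mEoo.
by apply: le_measure; rewrite ?inE.
Qed.

Let hahn (c : R) : exists N P, [/\ measurable N, measurable P, N `|` P = setT,
  forall A, measurable A -> A `<=` E -> A `<=` N -> mu A <= c%:E * nu A &
  forall A, measurable A -> A `<=` E -> A `<=` P -> c%:E * nu A <= mu A].
Proof.
(* Restricting both measures to [E] makes them finite, so that their linear combination is a signed
   measure with a Hahn decomposition. *)
pose s : {charge set X -> \bar R} :=
  cadd (charge_of_finite_measure (mfrestr mE muE))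
       (cscale (- c) (charge_of_finite_measure (mfrestr mE nuE))).
have sE A : measurable A -> A `<=` E -> s A = mu A - c%:E * nu A.
  move=> mA AE.
  rewrite [LHS](_ : _ = mu (A `&` E) + (- c)%:E * nu (A `&` E))//.
  by rewrite setIidl// EFinN mulNe.
have [P [N [[mP Pp] [mN Nn] PN _]]] := Hahn_decomposition s.
exists N, P; split => //; first by rewrite setUC.
  move=> A mA AE AN; have := Nn A mA AN; rewrite sE// sube_le0//.
move=> A mA AE AP; have := Pp A mA AP; rewrite sE// sube_ge0//.
by apply/orP; right; apply: fin_sub.
Qed.

(** [A1] is cut down to the part where mu is at most [c1] nu, and [A2] to the part where mu is at
    least [c2] nu. Neither part is null, as the parts removed satisfy the opposite inequalities.
    Mixing gives a set [C] inside the first part with a translate inside the second; by invariance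
    [c2] nu <= mu <= [c1] nu on [C], so [C] is null. *)
Let no_gap (c1 c2 : R) (A1 A2 : set X) : measurable A1 -> measurable A2 ->
  A1 `<=` E -> A2 `<=` E -> (c1 < c2)%R ->
  mu A1 < c1%:E * nu A1 -> c2%:E * nu A2 < mu A2 -> False.
Proof.
move=> mA1 mA2 A1E A2E c12 lt1 lt2.
have [N1 [P1 [mN1 mP1 NP1 N1P P1P]]] := hahn c1.
have [N2 [P2 [mN2 mP2 NP2 N2P P2P]]] := hahn c2.
pose C1 := A1 `&` N1; pose C2 := A2 `&` P2.
have mC1 : measurable C1 by exact: measurableI.
have mC2 : measurable C2 by exact: measurableI.
have split_eq (m : {measure set X -> \bar R}) A N : measurable A -> measurable N ->
    m A = m (A `&` N) + m (A `\` N).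
  by move=> mA mN; rewrite addeC -measureDI.
have N1C : C1 `<=` E by move=> x [/A1E].
have C2E : C2 `<=` E by move=> x [/A2E].
have C10 : mu C1 + nu C1 <> 0.
  move=> /eqP; rewrite padde_eq0 ?measure_ge0// => /andP[/eqP mu0 /eqP nu0].
  move: lt1; rewrite (split_eq mu A1 N1)// (split_eq nu A1 N1)// -/C1 mu0 nu0 !add0e.
  rewrite ltNge => /negP; apply; apply: P1P; first exact: measurableD.
    by move=> x [/A1E].
  by move=> x [_ nx]; have : setT x by []; rewrite -NP1 => -[].
have C20 : mu C2 + nu C2 <> 0.
  move=> /eqP; rewrite padde_eq0 ?measure_ge0// => /andP[/eqP mu0 /eqP nu0].
  move: lt2; rewrite (split_eq mu A2 P2)// (split_eq nu A2 P2)// -/C2 mu0 nu0 !add0e.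
  rewrite ltNge => /negP; apply; apply: N2P; first exact: measurableD.
    by move=> x [/A2E].
  by move=> x [_ nx]; have : setT x by []; rewrite -NP2 => -[].
case: (mix mC1 mC2 C10 C20) => i.
set C := C1 `&` _; apply.
have mC : measurable C.
  by apply: measurableI => //; rewrite -[X in measurable X]setTI; exact: mf.
have CE : C `<=` E by move=> x [/N1C].
have le1 : mu C <= c1%:E * nu C by apply: N1P => // x [[]].
have mC' : measurable (f' i @^-1` C).
  by rewrite -[X in measurable X]setTI; exact: mf'.
have le2 : c2%:E * nu C <= mu C.
  rewrite -(mu_f' i mC) -(nu_f' i mC); apply: P2P => //.
    by move=> x [_]; rewrite /= f'K => /C2E.
  by move=> x [_]; rewrite /= f'K => -[].
have fmu : mu C \is a fin_num by exact: fin_sub.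
have fnu : nu C \is a fin_num by exact: fin_sub.
have nuC0 : nu C = 0.
  apply/eqP; rewrite eq_le measure_ge0 andbT leNgt; apply/negP => nu_gt0.
  have := le_trans le2 le1; move: nu_gt0; rewrite -(fineK fnu) -!EFinM lee_fin lte_fin.
  by move=> n0; rewrite ler_pM2r// leNgt c12.
by move: le1; rewrite nuC0 mule0 adde0 measure_le0 => /eqP.
Qed.

(** If the equality failed, the ratios of mu to nu on [A] and on its complement in [E] would differ,
    and [slope_gap] would contradict [no_gap] in one of the two orders. The product form allows
    [nu E = 0]. *)
Lemma invariant_finite_proportional A : measurable A -> A `<=` E ->
  mu A * nu E = mu E * nu A.
Proof.
move=> mA AE.
have mD : measurable (E `\` A) by exact: measurableD.
have DE : E `\` A `<=` E by move=> x [].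
have fE (m : {measure set X -> \bar R}) : m E < +oo -> exists a b : R,
    [/\ m A = a%:E, m E = (a + b)%:E, m (E `\` A) = b%:E, (0 <= a)%R & (0 <= b)%R].
  move=> moo; have fA := fin_sub moo mA AE; have fD := fin_sub moo mD DE.
  exists (fine (m A)), (fine (m (E `\` A))).
  rewrite EFinD !fineK//; split; rewrite ?fine_ge0//.
  have mEA : m A = m (E `&` A) by rewrite setIidr.
  by rewrite mEA addeC -measureDI.
have [a [b [muA -> muD a0 b0]]] := fE mu muE.
have [a' [b' [nuA -> nuD a'0 b'0]]] := fE nu nuE.
move: (fun c1 c2 => @no_gap c1 c2 _ _ mA mD AE DE)
  (fun c1 c2 => @no_gap c1 c2 _ _ mD mA DE AE).
rewrite muA nuA muD nuD -!EFinM => H1 H2; congr EFin.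
have [lt|lt|//] := ltgtP (a * (a' + b'))%R ((a + b) * a')%R.
- have /(slope_gap a0 b0 a'0 b'0)[c1 [c2 [c12 l1 l2]]] : (a * b' < b * a')%R.
    by move: lt; rewrite mulrDr mulrDl ltrD2l.
  by case: (H1 c1 c2) => //; rewrite lte_fin.
- have /(slope_gap b0 a0 b'0 a'0)[c1 [c2 [c12 l1 l2]]] : (b * a' < a * b')%R.
    by move: lt; rewrite mulrDr mulrDl ltrD2l.
  by case: (H2 c1 c2) => //; rewrite lte_fin.
Qed.

End FinitePart.

(** From an index [k0] on, both measures are positive on [E k]. The ratio there does not depend on
    [k], since [E k0] is itself a subset to which the finite case applies in [E k]. A general set is
    the increasing limit of its intersections with the [E k]. *)
Lemma invariant_measures_proportional (E : nat -> set X) :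
  (forall k, measurable (E k)) -> nondecreasing_seq E -> \bigcup_k E k = setT ->
  (forall k, mu (E k) < +oo) -> (forall k, nu (E k) < +oo) ->
  mu setT != 0 -> nu setT != 0 ->
  exists2 c : R, (0 < c)%R & forall A, measurable A -> nu A = c%:E * mu A.
Proof.
move=> mE ndE ET muE nuE mu0 nu0.
have cvgE (m : {measure set X -> \bar R}) A : measurable A ->
    (fun k => m (A `&` E k)) @ \oo --> m A.
  move=> mA; have AE : \bigcup_k (A `&` E k) = A by rewrite -setI_bigcupr ET setIT.
  rewrite -[in X in _ --> X]AE; apply: nondecreasing_cvg_mu.
  - by move=> i; exact: measurableI.
  - by rewrite AE.
  - by move=> i k ik; apply/subsetPset; apply: setIS; apply/subsetPset; exact: ndE.
have exE (m : {measure set X -> \bar R}) : m setT != 0 -> exists k, m (E k) != 0.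
  move=> m0; apply: contrapT => /forallNP H; move/eqP: m0; apply.
  apply: cvg_unique (cvgE m setT measurableT) _ => //.
  rewrite (_ : (fun _ => _) = fun=> 0); first exact: cvg_cst.
  by apply/funext => k; rewrite setTI; apply/eqP; rewrite -[_ == _]negbK; apply/negP/H.
have [k1 k1P] := exE mu mu0; have [k2 k2P] := exE nu nu0.
pose k0 := maxn k1 k2.
have leE (m : {measure set X -> \bar R}) i k : (i <= k)%N -> m (E i) <= m (E k).
  by move=> ik; apply: le_measure; rewrite ?inE//; apply/subsetPset; exact: ndE.
have posE (m : {measure set X -> \bar R}) i k : (i <= k)%N -> m (E i) != 0 ->
    m (E k) < +oo -> exists2 r : R, (0 < r)%R & m (E k) = r%:E.
  move=> ik mi moo; exists (fine (m (E k))).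
    apply: fine_gt0; rewrite moo andbT; apply: lt_le_trans (leE m _ _ ik).
    by rewrite lt_neqAle eq_sym mi measure_ge0.
  by rewrite fineK// ge0_fin_numE.
have [a ap aE] := posE mu k1 k0 (leq_maxl _ _) k1P (muE _).
have [b bp bE] := posE nu k2 k0 (leq_maxr _ _) k2P (nuE _).
exists (b / a)%R; first exact: divr_gt0.
have sub_eq k A : (k0 <= k)%N -> measurable A -> A `<=` E k ->
    nu A = (b / a)%:E * mu A.
  move=> k0k mA AE.
  have [a1 a1p a1E] := posE mu k1 k (leq_trans (leq_maxl _ _) k0k) k1P (muE _).
  have [b1 b1p b1E] := posE nu k2 k (leq_trans (leq_maxr _ _) k0k) k2P (nuE _).
  have E0k : E k0 `<=` E k by apply/subsetPset; exact: ndE.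
  have := invariant_finite_proportional (mE k) (muE k) (nuE k) (mE k0) E0k.
  rewrite aE bE a1E b1E -!EFinM => -[q].
  have := invariant_finite_proportional (mE k) (muE k) (nuE k) mA AE.
  have fmu : mu A \is a fin_num.
    rewrite ge0_fin_numE//; apply: le_lt_trans (muE k).
    by apply: le_measure; rewrite ?inE.
  have fnu : nu A \is a fin_num.
    rewrite ge0_fin_numE//; apply: le_lt_trans (nuE k).
    by apply: le_measure; rewrite ?inE.
  rewrite a1E b1E -(fineK fmu) -(fineK fnu) -!EFinM => -[q']; congr EFin.
  apply: (mulfI (lt0r_neq0 a1p)); rewrite -q'; have -> : (b / a = b1 / a1)%R.
    by apply/eqP; rewrite eqr_div ?lt0r_neq0// mulrC -q mulrC.
  by field; rewrite lt0r_neq0.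
move=> A mA; apply: cvg_unique (cvgE nu A mA) _ => //.
apply: (@cvg_trans _ ((fun k => (b / a)%:E * mu (A `&` E k)) @ \oo)).
  apply: near_eq_cvg; exists k0 => // k /= k0k.
  by rewrite (sub_eq k (A `&` E k) k0k (measurableI _ _ mA (mE k)) (@subIsetr _ _ _)).
by apply: cvgeZl => //; exact: cvgE.
Qed.

End Proportional.

(** * The space of scalar products *)

Section GammaTopology.
Context (R : realType) (p q : nat) (V : fdspaceType R (p + q)).
Local Notation Gam := (Gamma p q V).

Lemma gamma_eq (g h : Gam) : (forall u v, g u v = h u v) -> g = h.
Proof. by move=> gh; apply: val_inj; apply/funext => u; apply/funext => v; exact: gh. Qed.

Lemma gamma_cvg (T : Type) (F : set_system T) (h : T -> Gam) (g : Gam) : Filter F ->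
  (forall u v, (fun t => h t u v) @ F --> g u v) -> h @ F --> g.
Proof.
move=> FF hg A /= [_ [[B oB <-] Bg sBA]].
have : (fun t => gamma_eval (h t)) @ F --> gamma_eval g.
  have FF' := fmap_filter (fun t => gamma_eval (h t)) FF.
  apply/(@pointwise_cvgP (discrete_topology (V * V)%type) R _ _ FF') => -[u v].
  exact: hg.
move=> evg; have FB : F [set t | B (gamma_eval (h t))].
  exact: (evg B (open_nbhs_nbhs (conj oB Bg))).
suff : F (h @^-1` A) by [].
by apply: filterS FB => t Bt; exact: (sBA (h t) Bt).
Qed.

Lemma gamma_eval_continuous u v : continuous (fun g : Gam => g u v).
Proof.
have c1 : continuous (@gamma_eval R p q V : Gam -> _) by exact: initial_continuous.
have c2 := @proj_continuous (V * V)%type (fun=> R) (u, v).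
by move=> g; apply: (continuous_comp (c1 g) (c2 _)).
Qed.

Lemma gamma_hausdorff : hausdorff_space Gam.
Proof.
move=> g h clgh; apply: gamma_eq => u v.
apply: (@Rhausdorff R); move=> A B nA nB.
have [k [Ak Bk]] := clgh _ _ (gamma_eval_continuous nA) (gamma_eval_continuous nB).
by exists (k u v).
Qed.

Lemma gammaDl (g : Gam) u v w : g (u + v) w = g u w + g v w.
Proof.
by have /asboolP[[_ gD _] _] := gformP g; rewrite -[u]scale1r gD mul1r scale1r.
Qed.

Lemma gammaC (g : Gam) u v : g u v = g v u.
Proof. by have /asboolP[[]] := gformP g. Qed.

Lemma gamma0l (g : Gam) w : g 0 w = 0.
Proof. by apply: (addrI (g 0 w)); rewrite -gammaDl !addr0. Qed.

Lemma gammaZl (g : Gam) a u w : g (a *: u) w = a * g u w.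
Proof.
have /asboolP[[_ gD _] _] := gformP g.
by rewrite -[a *: u]addr0 gD gamma0l addr0.
Qed.

Lemma gamma_suml (g : Gam) (I : Type) (r : seq I) (F : I -> V) w :
  g (\sum_(i <- r) F i) w = \sum_(i <- r) g (F i) w.
Proof.
elim: r => [|i r IH]; first by rewrite !big_nil gamma0l.
by rewrite !big_cons gammaDl IH.
Qed.

Lemma gamma_expand (g : Gam) (I : finType) (e : I -> V) (a b : I -> R) :
  g (\sum_i a i *: e i) (\sum_i b i *: e i) =
  \sum_i \sum_j a i * b j * g (e i) (e j).
Proof.
rewrite gamma_suml; apply: eq_bigr => i _; rewrite gammaZl gammaC gamma_suml mulr_sumr.
by apply: eq_bigr => j _; rewrite gammaZl gammaC; ring.
Qed.

Variables (co : {linear V -> 'rV[R]_(p + q)}) (co' : 'rV[R]_(p + q) -> V).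
Hypothesis (coK : cancel co co') (co'K : cancel co' co).
Local Notation n := (p + q)%N.

Definition co_basis (i : 'I_n) : V := co' (delta_mx ord0 i).

Lemma co_sum v : v = \sum_i co v ord0 i *: co_basis i.
Proof.
apply: (can_inj coK); rewrite linear_sum /= {1}(row_sum_delta (co v)).
by apply: eq_bigr => i _; rewrite linearZ /= /co_basis co'K.
Qed.

Lemma gamma_gram (g : Gam) u v :
  g u v = \sum_i \sum_j co u ord0 i * co v ord0 j * g (co_basis i) (co_basis j).
Proof. by rewrite {1}(co_sum u) {1}(co_sum v) gamma_expand. Qed.

Lemma cvg_sum (T : Type) (F : set_system T) (I : Type) (r : seq I)
    (f : I -> T -> R) (a : I -> R) {FF : Filter F} : (forall i, f i @ F --> a i) ->
  (fun t => \sum_(i <- r) f i t) @ F --> \sum_(i <- r) a i.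
Proof.
move=> fa; apply: cvg_big => // ; exact: add_continuous.
Qed.

Lemma gram_cvg (T : Type) (F : set_system T) (h : T -> Gam) (g : Gam) {FF : Filter F} :
  (forall i j, (fun t => h t (co_basis i) (co_basis j)) @ F --> g (co_basis i) (co_basis j)) ->
  h @ F --> g.
Proof.
move=> hg; apply: gamma_cvg => u v.
rewrite gamma_gram; under eq_fun do rewrite gamma_gram.
apply: cvg_sum => i; apply: cvg_sum => j.
by apply: cvgM; [exact: cvg_cst|exact: hg].
Qed.

(** Otherwise there would be a sequence outside [U] whose Gram matrices converge to that of [g]; by
    [gram_cvg] it converges to [g], and must enter [U]. *)
Lemma gamma_open_box (U : set Gam) (g : Gam) : open U -> U g ->
  exists N : nat, forall h : Gam,
    (forall i j, `|g (co_basis i) (co_basis j) - h (co_basis i) (co_basis j)| < N.+1%:R^-1) ->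
    U h.
Proof.
move=> oU Ug; apply: contrapT => /forallNP H.
have H' N : exists h : Gam, (forall i j,
   `|g (co_basis i) (co_basis j) - h (co_basis i) (co_basis j)| < N.+1%:R^-1) /\ ~ U h.
  have /existsNP[h /not_implyP Hh] := H N; by exists h.
have [h hP] := choice H'.
have hg : h @ \oo --> g.
  apply: gram_cvg => i j; apply/cvgrPdist_lt => e e0.
  have [N _ HN] := near_infty_natSinv_lt (PosNum e0).
  exists N => // k /= Nk; apply: lt_trans (HN k Nk).
  by have [/(_ i j)] := hP k.
have /hg [N _ HN] : nbhs g U by exact: open_nbhs_nbhs.
by have [_] := hP N; apply; exact: (HN N (leqnn N)).
Qed.

Definition rat_box (Q : 'M[rat]_n * nat) : set Gam :=
  [set h : Gam | forall i j, `|h (co_basis i) (co_basis j) - ratr (Q.1 i j)| < Q.2.+1%:R^-1].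

(** The index set of rational boxes is countable, so this provides second countability: the Borel
    sigma-algebra is generated by evaluations on basis vectors. The rational centre need not be the
    Gram matrix of a scalar product. *)
Lemma gamma_open_rat_boxes (U : set Gam) : open U ->
  U = \bigcup_(Q in [set Q | rat_box Q `<=` U]) rat_box Q.
Proof.
move=> oU; apply/seteqP; split => [g Ug|g [Q QU]]; last exact: QU.
have [N HN] := gamma_open_box oU Ug.
(* [k.+1] is twice [N.+1], so that two radii [k.+1%:R^-1] add up to [N.+1%:R^-1]. *)
pose k := (2 * N).+1.
have k0 : 0 < k.+1%:R^-1 :> R by rewrite invr_gt0.
have HQ i j : exists r : rat, `|g (co_basis i) (co_basis j) - ratr r| < k.+1%:R^-1.
  have [r] := rat_in_itvoo (ltr_pwDr k0 (lexx (g (co_basis i) (co_basis j)))).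
  rewrite in_itv /= => /andP[r1 r2]; exists r.
  move: k0 r1 r2; move: (_^-1) (g _ _) (ratr r) => x y z x0 yz zx.
  by rewrite ltr_norml; apply/andP; split; lra.
pose Q : 'M[rat]_n := \matrix_(i, j) projT1 (cid (HQ i j)).
have QP i j : `|g (co_basis i) (co_basis j) - ratr (Q i j)| < k.+1%:R^-1.
  by rewrite mxE; case: (cid _).
exists (Q, k) => // h hQ; apply: HN => i j.
have := QP i j; have := hQ i j; rewrite /= => h1 h2.
have -> : g (co_basis i) (co_basis j) - h (co_basis i) (co_basis j) =
  (g (co_basis i) (co_basis j) - ratr (Q i j)) - (h (co_basis i) (co_basis j) - ratr (Q i j)).
  by ring.
apply: le_lt_trans (ler_normB _ _) _.
have -> : N.+1%:R^-1 = k.+1%:R^-1 + k.+1%:R^-1 :> R.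
  have -> : k.+1 = (2 * N.+1)%N by rewrite /k mulnS.
  have half2 : 2^-1 + 2^-1 = 1 :> R by lra.
  by rewrite natrM invfM -mulrDl half2 mul1r.
exact: ltrD.
Qed.

Lemma measurable_gamma_eval u v :
  measurable_fun setT (fun g : gammaB p q V => g u v : measurableTypeR R).
Proof.
apply: (measurability _ (@RGenOpens.measurableE R)) => _ [_ [a [b ->]] <-].
rewrite setTI; apply: sub_sigma_algebra.
have /continuousP := @gamma_eval_continuous u v; apply; exact: interval_open.
Qed.

Lemma measurable_gamma d (T : measurableType d) (h : T -> gammaB p q V) :
  (forall u v, measurable_fun setT (fun t => h t u v : measurableTypeR R)) ->
  measurable_fun setT h.
Proof.
move=> mh; have E : @measurable _ (gammaB p q V) = <<s @open Gam >> by [].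
apply: (measurability _ E) => _ [U oU <-].
rewrite setTI (gamma_open_rat_boxes oU) preimage_bigcup.
rewrite bigcup_mkcond; apply: countable_bigcupT_measurable; first exact: countableP.
move=> Q; case: ifP => // _.
rewrite (_ : _ @^-1` _ = \bigcap_(ij in [set: 'I_n * 'I_n]) [set t |
    `|h t (co_basis ij.1) (co_basis ij.2) - ratr (Q.1 ij.1 ij.2)| < Q.2.+1%:R^-1]).
  apply: fin_bigcap_measurable => // -[i j] _ /=.
  have m1 : measurable_fun setT (fun t => h t (co_basis i) (co_basis j) - ratr (Q.1 i j) : R).
    by apply: measurable_funB => //; exact: mh.
  have := measurableT_comp (@normr_measurable R setT) m1.
  move=> /(_ measurableT _ (measurable_itv `]-oo, Q.2.+1%:R^-1[)); rewrite setTI.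
  by congr measurable; apply/seteqP; split => t; rewrite /= in_itv.
apply/seteqP; split => [t ht [i j] _ /=|t ht i j]; first exact: ht.
exact: (ht (i, j)).
Qed.

End GammaTopology.

Section GammaAction.
Context (R : realType) (p q : nat) (V : fdspaceType R (p + q)).
Local Notation Gam := (Gamma p q V).
Local Notation n := (p + q)%N.
Variables (co : {linear V -> 'rV[R]_n}) (co' : 'rV[R]_n -> V).
Hypothesis (coK : cancel co co') (co'K : cancel co' co).

Lemma co'_linear (a : R) u v : co' (a *: u + v) = a *: co' u + co' v.
Proof. by apply: (can_inj coK); rewrite linearP !co'K. Qed.

Definition mul_fun (g : 'M[R]_n) (v : V) : V := co' (co v *m g).

Fact mul_fun_linear g : linear (mul_fun g).
Proof. by move=> a u v; rewrite /mul_fun linearP mulmxDl -scalemxAl co'_linear. Qed.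

Definition mul_lin g : {linear V -> V} :=
  HB.pack (mul_fun g) (GRing.isLinear.Build _ _ _ _ (mul_fun g) (@mul_fun_linear g)).

Fact mul_linK g : g \in unitmx -> cancel (mul_lin g) (mul_lin (invmx g)).
Proof. by move=> gu v; rewrite /= /mul_fun co'K mulmxK// coK. Qed.

Fact mul_linVK g : g \in unitmx -> cancel (mul_lin (invmx g)) (mul_lin g).
Proof. by move=> gu v; rewrite /= /mul_fun co'K mulmxKV// coK. Qed.

Definition mul_iso g (gu : g \in unitmx) : liniso V V :=
  LinIso (mul_linK gu) (mul_linVK gu).

(** Matrices act on coordinate rows from the right, so the pull-back along them is a left action
    ([gamma_actM]); in terms of [gl_action] it belongs to the inverse map. Singular matrices act as
    the identity, which makes the map total. *)
Definition gamma_act (g : 'M[R]_n) (x : Gam) : Gam :=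
  if pselect (g \in unitmx) is left gu then pullback (mul_iso gu) x else x.

Lemma gamma_actE g x u v : g \in unitmx ->
  gamma_act g x u v = x (mul_fun g u) (mul_fun g v).
Proof. by rewrite /gamma_act; case: pselect. Qed.

Lemma gamma_act_nonunit g x : g \notin unitmx -> gamma_act g x = x.
Proof. by rewrite /gamma_act; case: pselect => // gu /negP. Qed.

Lemma gamma_actM g h x : g \in unitmx -> h \in unitmx ->
  gamma_act (g *m h) x = gamma_act g (gamma_act h x).
Proof.
move=> gu hu; apply: gamma_eq => u v; rewrite !gamma_actE ?unitmx_mul ?gu//.
by rewrite /mul_fun !co'K !mulmxA.
Qed.

Lemma gamma_act1 x : gamma_act 1%:M x = x.
Proof.
by apply: gamma_eq => u v; rewrite gamma_actE ?unitmx1// /mul_fun !mulmx1 !coK.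
Qed.

Lemma gamma_act_invariant (m : {measure set (gammaB p q V) -> \bar R}) :
  gl_invariant m ->
  forall g (A : set (gammaB p q V)), g \in unitmx -> measurable A ->
    m (gamma_act g @^-1` A) = m A.
Proof.
move=> minv g A gu mA; rewrite -(minv (liniso_inv (mul_iso gu)) A mA) /pushforward.
congr (m _); apply/seteqP; split => x /=;
by rewrite (_ : gl_action _ x = gamma_act g x)//;
  apply: gamma_eq => u v; rewrite gamma_actE.
Qed.

(** The family spans, so its coordinate matrix [E] has a left inverse, and a square matrix with a
    left inverse is invertible. *)
Lemma gamma_orthonormal (x : Gam) : exists (e : 'I_n -> V) (E : 'M[R]_n),
  [/\ E \in unitmx, forall i, co (e i) = row i E,
      forall v, exists a : 'I_n -> R, v = \sum_i a i *: e i &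
      forall i j, x (e i) (e j) = if i == j then (if (i < p)%N then 1 else -1) else 0].
Proof.
have /asboolP[_ [e [espan eo]]] := gformP x.
pose E : 'M[R]_n := \matrix_i co (e i).
exists e, E; split => //; last by move=> i; rewrite rowK.
have [a aP] := choice (fun j => espan (co' (delta_mx ord0 j))).
have : (\matrix_(j, i) a j i) *m E = 1%:M.
  apply/row_matrixP => j; rewrite row_mul row1.
  have /(congr1 co) := aP j; rewrite co'K => ->.
  rewrite linear_sum mulmx_sum_row; apply: eq_bigr => i _ /=.
  by rewrite linearZ rowK !mxE.
by case/mulmx1_unit.
Qed.

(** The matrix sends an orthonormal basis of [x'] to one of [x]. Both have the same signs in the
    same order, because the signature is the same. *)
Lemma gamma_act_trans (x x' : Gam) : exists2 h, h \in unitmx & x' = gamma_act h x.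
Proof.
have [e [E [Eu eE es eo]]] := gamma_orthonormal x.
have [e' [E' [E'u e'E e's e'o]]] := gamma_orthonormal x'.
have hu : invmx E' *m E \in unitmx by rewrite unitmx_mul unitmx_inv E'u.
exists (invmx E' *m E) => //.
have he i : mul_fun (invmx E' *m E) (e' i) = e i.
  apply: (can_inj coK); rewrite /mul_fun co'K e'E eE mulmxA -row_mul mulmxV//.
  by rewrite row1 -rowE.
apply: gamma_eq => u v; have [a ->] := e's u; have [b ->] := e's v.
rewrite !gamma_expand; apply: eq_bigr => i _; apply: eq_bigr => j _.
by rewrite gamma_actE// !he e'o eo.
Qed.

(** On invertible matrices each evaluation is a polynomial in the matrix entries and the Gram
    matrix; on the measurable set of singular ones it is an evaluation of the form. *)
Lemma measurable_gamma_act :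
  measurable_fun setT (fun z : mtuple R n * gammaB p q V =>
    gamma_act (mx_of z.1) z.2 : gammaB p q V).
Proof.
apply: measurable_gamma => // u v.
rewrite (_ : (fun t => _) = (fun t : mtuple R n * gammaB p q V =>
  if mx_of t.1 \in unitmx then
    \sum_i \sum_j (\sum_k co u ord0 k * entry t.1 (k, i)) *
      (\sum_k co v ord0 k * entry t.1 (k, j)) * t.2 (co_basis co' i) (co_basis co' j)
  else t.2 u v)); last first.
  apply/funext => -[y x] /=; case: ifPn => uy.
    rewrite gamma_actE// (gamma_gram coK co'K).
    apply: eq_bigr => i _; apply: eq_bigr => j _; rewrite /mul_fun !co'K !mxE.
    by congr (_ * _ * _); apply: eq_bigr => k _; rewrite mxE.
  by rewrite gamma_act_nonunit.
apply: measurable_fun_ifT.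
- apply: (measurable_fun_bool true).
  have := @measurable_fst _ _ (mtuple R n) (gammaB p q V) measurableT _
    (@measurable_mx_unit R n).
  by rewrite setTI; congr measurable.
- have ment a : measurable_fun setT (fun t : mtuple R n * gammaB p q V => entry t.1 a : R).
    exact: (measurableT_comp (measurable_entry a) measurable_fst).
  apply: measurable_sum => i; apply: measurable_sum => j.
  apply: measurable_funM.
    by apply: measurable_funM; apply: measurable_sum => k; apply: measurable_funM.
  exact: (measurableT_comp (measurable_gamma_eval _ _) measurable_snd).
- exact: (measurableT_comp (measurable_gamma_eval _ _) measurable_snd).
Qed.

Lemma cvg_prod_R (T : Type) (F : set_system T) (I : Type) (r : seq I)
    (f : I -> T -> R) (a : I -> R) {FF : Filter F} : (forall i, f i @ F --> a i) ->
  (fun t => \prod_(i <- r) f i t) @ F --> \prod_(i <- r) a i.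
Proof. by move=> fa; apply: cvg_big => //; exact: mul_continuous. Qed.

Lemma vec_mx_continuous i j : continuous (fun v : 'rV[R]_(n * n) => vec_mx v i j).
Proof.
rewrite (_ : (fun v => _) = (fun v : 'rV[R]_(n * n) => v ord0 (mxvec_index i j))).
  exact: coord_continuous.
by apply/funext => v; rewrite mxE.
Qed.

Lemma det_vec_mx_continuous : continuous (fun v : 'rV[R]_(n * n) => \det (vec_mx v : 'M[R]_n)).
Proof.
move=> v; have FF := nbhs_filter v.
apply: (cvg_sum (FF := FF)) => s; apply: cvgM; first exact: cvg_cst.
by apply: (cvg_prod_R (FF := FF)) => i; exact: vec_mx_continuous.
Qed.

Lemma norm_det_continuous :
  continuous (fun v : 'rV[R]_(n * n) => `|\det (vec_mx v : 'M[R]_n)|).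
Proof.
move=> v.
exact: (continuous_comp (@det_vec_mx_continuous v) (@norm_continuous R R _)).
Qed.

(** Matrices are flattened to row vectors, where a product of segments is compact. The lower bound
    on the determinant keeps the limits invertible, so that the orbit map is continuous on the
    box. *)
Definition mx_box (k : nat) : set 'rV[R]_(n * n) :=
  [set v : 'rV[R]_(n * n) | forall i, v ord0 i \in `[- k%:R, k%:R]] `&`
  [set v : 'rV[R]_(n * n) | k.+1%:R^-1 <= `|\det (vec_mx v : 'M[R]_n)|].

Lemma mx_box_compact k : compact (mx_box k).
Proof.
apply: compact_closedI.
  apply: (@rV_compact R (n * n) (fun=> [set` `[- k%:R, k%:R]])) => _.
  exact: segment_compact.
apply: (@preimage_closed _ _ (fun v : 'rV[R]_(n * n) => `|\det (vec_mx v : 'M[R]_n)|)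
  [set x | k.+1%:R^-1 <= x]); last exact: closed_ge.
by move=> v _; exact: norm_det_continuous.
Qed.

Definition gamma_ball (x0 : Gam) (k : nat) : set Gam :=
  [set gamma_act (vec_mx v) x0 | v in mx_box k].

Lemma gamma_ball_compact x0 k : compact (gamma_ball x0 k).
Proof.
suff wc : {within mx_box k,
    continuous (fun v : 'rV[R]_(n * n) => gamma_act (vec_mx v) x0)}.
  exact: (continuous_compact wc (@mx_box_compact k)).
apply: continuous_in_subspaceT => v /[!inE] -[_ detv].
have FF := nbhs_filter v.
(* Invertibility is an open condition; hence near [v] the action is given by its polynomial formula
   and not by the convention for singular matrices. *)
have unear : \forall w \near v, (vec_mx w : 'M[R]_n) \in unitmx.
  have d0 : 0 < `|\det (vec_mx v : 'M[R]_n)|.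
    by apply: lt_le_trans detv; rewrite invr_gt0.
  have nc : {for v, continuous (fun w : 'rV[R]_(n * n) => `|\det (vec_mx w : 'M[R]_n)|)}.
    exact (@norm_det_continuous v).
  have H0 : Filter (nbhs v) -> \forall w \near v, 0 < `|\det (vec_mx w : 'M[R]_n)|.
    by move=> FF'; exact: cvgr_gt nc _ d0.
  by apply: (@filterS _ _ FF _ _ _ (H0 FF)) => w /=; rewrite normr_gt0 unitmxE unitfE.
have uv : (vec_mx v : 'M[R]_n) \in unitmx := nbhs_singleton unear.
apply: (gram_cvg coK co'K (FF := FF)) => i j.
rewrite gamma_actE//.
apply: (@cvg_trans _ ((fun w => x0 (mul_fun (vec_mx w) (co_basis co' i))
    (mul_fun (vec_mx w) (co_basis co' j))) @ v)).
  by apply: near_eq_cvg; apply: (@filterS _ _ (nbhs_filter v) _ _ _ unear) => w uw;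
    rewrite gamma_actE.
rewrite (gamma_gram coK co'K); under eq_fun do rewrite (gamma_gram coK co'K).
apply: (cvg_sum (FF := FF)) => k1; apply: (cvg_sum (FF := FF)) => k2.
apply: cvgM; last exact: cvg_cst.
have cc u k' : (fun w => co (mul_fun (vec_mx w) u) ord0 k') @ v -->
    co (mul_fun (vec_mx v) u) ord0 k'.
  rewrite /mul_fun co'K mxE; under eq_fun do rewrite co'K mxE.
  by apply: (cvg_sum (FF := FF)) => l; apply: cvgM; [exact: cvg_cst|exact: vec_mx_continuous].
by apply: cvgM; exact: cc.
Qed.

Lemma gamma_ball_nondecreasing x0 : nondecreasing_seq (gamma_ball x0).
Proof.
move=> k l kl; apply/subsetPset => _ [v [vk dv] <-]; exists v => //; split.
  move=> i; have := vk i; rewrite !in_itv /= => /andP[a b].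
  have kl' : k%:R <= l%:R :> R by rewrite ler_nat.
  by apply/andP; split; lra.
by apply: le_trans dv; rewrite lef_pV2 ?posrE// ler_nat.
Qed.

Lemma gamma_ball_cover x0 : \bigcup_k gamma_ball x0 k = setT.
Proof.
apply/seteqP; split => // x _; have [h hu ->] := gamma_act_trans x0 x.
pose a := \sum_i \sum_j `|h i j|.
(* The first bound controls every entry, being at least the sum of their absolute values; the second
   makes the determinant at least [k.+1%:R^-1] in absolute value. *)
pose k := maxn (Num.bound a) (Num.bound `|\det h|^-1).
have a0 : 0 <= a by apply: sumr_ge0 => i _; apply: sumr_ge0.
have ak : a <= k%:R.
  apply: ltW; apply: lt_le_trans (archi_boundP a0) _.
  by rewrite ler_nat leq_maxl.
have d0 : 0 < `|\det h| by rewrite normr_gt0 -unitfE -unitmxE.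
have dk : `|\det h|^-1 <= k%:R.
  have d0' : 0 <= `|\det h|^-1 by rewrite invr_ge0.
  apply: ltW; apply: lt_le_trans (archi_boundP d0') _.
  by rewrite ler_nat leq_maxr.
exists k => //; exists (mxvec h); last by rewrite mxvecK.
split => /=; last first.
  rewrite mxvecK -[leRHS]invrK lef_pV2 ?posrE ?invr_gt0//.
  by apply: le_trans dk _; rewrite ler_nat.
move=> ij; case/mxvec_indexP: ij => i j; rewrite mxvecE in_itv /= -ler_norml.
apply: le_trans ak; rewrite /a (bigD1 i)//= (bigD1 j)//= -addrA lerDl.
by rewrite addr_ge0// ?sumr_ge0// => l _; apply: sumr_ge0.
Qed.

Lemma measurable_compact_gamma (K : set Gam) : compact K ->
  measurable (K : set (gammaB p q V)).
Proof.
move=> cK; rewrite -[K]setCK; apply: measurableC; apply: sub_sigma_algebra.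
apply: closed_openC; apply: compact_closed cK; exact: gamma_hausdorff.
Qed.

End GammaAction.

Section SigmaFinite.
Context d (T : measurableType d) (R : realType) (m : {measure set T -> \bar R}).

(** The proof of sigma-finiteness is an argument of the copy, so that an instance can be attached to
    a measure for which it is only proved. *)
Definition sigma_finite_copy & sigma_finite setT m : set T -> \bar R := m.

Variable sfm : sigma_finite setT m.
HB.instance Definition _ := Measure.on (sigma_finite_copy sfm).
HB.instance Definition _ :=
  Measure_isSigmaFinite.Build _ _ _ (sigma_finite_copy sfm) sfm.

End SigmaFinite.

(** * Uniqueness at a point and along the manifold *)

Section InvariantMeasures.
Context (R : realType) (p q : nat).

Lemma gl_invariant_unique (V : fdspaceType R (p + q))
    (mu nu : {measure set (gammaB p q V) -> \bar R}) :
  (forall K : set (Gamma p q V), compact K -> (mu K < +oo)%E) ->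
  (forall K : set (Gamma p q V), compact K -> (nu K < +oo)%E) ->
  gl_invariant mu -> gl_invariant nu -> nonzero_measure mu -> nonzero_measure nu ->
  exists2 c : R, 0 < c & forall A, measurable A -> nu A = (c%:E * mu A)%E.
Proof.
move=> muK nuK mui nui mu0 nu0.
have [co [co' coK co'K]] := @coordinates_exist R (p + q)%N V.
have [x0 _] := @Gamma_inhabited R p q V.
pose E := gamma_ball coK co'K x0.
have cE k : compact (E k) by exact: gamma_ball_compact.
have mE k : measurable (E k : set (gammaB p q V)) by exact: measurable_compact_gamma.
have ndE : nondecreasing_seq E by exact: gamma_ball_nondecreasing.
have ET : \bigcup_k E k = setT by exact: gamma_ball_cover.
pose act (g : 'M[R]_(p + q)) : gammaB p q V -> gammaB p q V := gamma_act coK co'K g.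
have mact := measurable_gamma_act coK co'K.
(* Mixing is needed for sets charged by either measure, with an intersection charged by at least one
   of them; both conditions are positivity for the sum. *)
pose r0 : {measure set (gammaB p q V) -> \bar R} := measure_add mu nu.
have r0E A : r0 A = (mu A + nu A)%E by exact: measure_addE.
have r0s : sigma_finite setT r0.
  exists E => // k; split => //.
  by rewrite r0E lte_add_pinfty// ?muK ?nuK.
pose rho : {sigma_finite_measure set (gammaB p q V) -> \bar R} :=
  sigma_finite_copy r0s.
have rhoE A : rho A = (mu A + nu A)%E by exact: r0E.
have mui' := gamma_act_invariant coK co'K mui.
have nui' := gamma_act_invariant coK co'K nui.
have rinv : act_invariant act rho.
  by move=> g A gu mA; rewrite !rhoE mui'// nui'.
have ov := overlap mact (@gamma_actM _ _ _ _ _ _ coK co'K)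
  (@gamma_act_trans _ _ _ _ _ _ coK co'K) rinv.
pose I := {g : 'M[R]_(p + q) | g \in unitmx}.
have mf g : measurable_fun setT (act g : gammaB p q V -> gammaB p q V).
  exact: (measurable_act_fun mact).
apply: (@invariant_measures_proportional R _ _ I (fun g => act (sval g))
  (fun g => act (invmx (sval g))) _ _ _ mu nu _ _ _ E).
- move=> [g gu] x; rewrite /= /act -gamma_actM ?unitmx_inv// mulmxV//.
  exact: gamma_act1.
- by move=> [g gu]; exact: mf.
- by move=> [g gu]; exact: mf.
- by move=> [g gu] A mA; apply: mui' => //; rewrite unitmx_inv.
- by move=> [g gu] A mA; apply: nui' => //; rewrite unitmx_inv.
- move=> A A' mA mA'; rewrite -!rhoE => A0 A'0.
  by have [g gu H] := ov A A' mA mA' A0 A'0; exists (exist _ g gu); rewrite -rhoE.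
- exact: mE.
- exact: ndE.
- exact: ET.
- by move=> k; exact: muK.
- by move=> k; exact: nuK.
- exact: mu0.
- exact: nu0.
Qed.

Section Transport.
Context (V W : fdspaceType R (p + q)).
Implicit Types (l : liniso V W).

Lemma pullback_cvg l (T : Type) (F : set_system T) (h : T -> Gamma p q W) g : Filter F ->
  h @ F --> g -> (fun t => pullback l (h t)) @ F --> pullback l g.
Proof.
move=> FF hg; apply: gamma_cvg => u v.
exact: (cvg_comp _ _ hg (@gamma_eval_continuous _ _ _ W (l u) (l v) g)).
Qed.

Lemma pullback_continuous l : continuous (pullback l : Gamma p q W -> Gamma p q V).
Proof. by move=> g; apply: (@pullback_cvg l _ (nbhs g) id). Qed.

Lemma measurable_pullback l :
  measurable_fun setT (pullback l : gammaB p q W -> gammaB p q V).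
Proof.
have [co [co' coK co'K]] := @coordinates_exist R (p + q)%N V.
by apply: (measurable_gamma coK co'K) => u v; exact: measurable_gamma_eval.
Qed.

End Transport.

Lemma pullbackK (V W : fdspaceType R (p + q)) (l : liniso V W) :
  cancel (pullback l : Gamma p q W -> Gamma p q V) (pullback (liniso_inv l)).
Proof. by move=> g; apply: gamma_eq => u v /=; rewrite !iso_invK. Qed.

Lemma pullbackVK (V W : fdspaceType R (p + q)) (l : liniso V W) :
  cancel (pullback (liniso_inv l)) (pullback l : Gamma p q W -> Gamma p q V).
Proof. by move=> g; apply: gamma_eq => u v /=; rewrite !iso_funK. Qed.

Definition liniso_comp (U V W : lmodType R) (l : liniso V W) (k : liniso U V) :
    liniso U W :=
  @LinIso R U W (iso_fun l \o iso_fun k) (iso_inv k \o iso_inv l)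
    (can_comp (@iso_funK _ _ _ l) (@iso_funK _ _ _ k))
    (can_comp (@iso_invK _ _ _ k) (@iso_invK _ _ _ l)).

Section InvariantField.
Context (M : manifold R (p + q)) (mu : measure_field M).
Hypothesis mu_inv : invariant_field mu.

(** Going from the base point to [y], then by [k] to [x] and back gives an element of the general
    linear group at the base point, which the invariance of [mu0] absorbs. The field is therefore
    independent of the chosen isomorphisms [l]. *)
Lemma invariant_field_transport (x y : M) (k : liniso (tangent y) (tangent x))
    (A : set (gammaB p q (tangent y))) : measurable A ->
  mu x (pullback k @^-1` A) = mu y A.
Proof.
have [x0 [mu0 [l [_ mu0i _ muE]]]] := mu_inv; move=> mA.
have mpre (z w : M) (j : liniso (tangent z) (tangent w)) (B : set (gammaB p q (tangent z))) :
    measurable B -> measurable (pullback j @^-1` B : set (gammaB p q (tangent w))).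
  by move=> mB; have := measurable_pullback j measurableT mB; rewrite setTI.
rewrite muE; last exact: mpre.
rewrite muE// /pushforward.
pose g := liniso_comp (liniso_comp (l x) k) (liniso_inv (l y)).
rewrite -(mu0i (liniso_inv g) _ (mpre _ _ (l y) _ mA)) /pushforward.
congr (mu0 _); apply/seteqP; split => ga /=;
by rewrite (_ : pullback (l y) _ = pullback k (pullback (l x) ga))//;
  apply: gamma_eq => u v /=; rewrite !iso_funK.
Qed.

Lemma invariant_field_regular (x : M) :
  [/\ forall K : set (Gamma p q (tangent x)), compact K -> (mu x K < +oo)%E,
      gl_invariant (mu x) & nonzero_measure (mu x)].
Proof.
have [x0 [mu0 [l [[muK _ _] mu0i mu0n muE]]]] := mu_inv; split.
- move=> K cK; have [co [co' coK co'K]] := @coordinates_exist R (p + q)%N (tangent x).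
  rewrite muE; last exact: measurable_compact_gamma.
  apply: muK; rewrite (_ : _ @^-1` _ = pullback (liniso_inv (l x)) @` K).
    apply: continuous_compact cK; apply: continuous_subspaceT.
    exact: pullback_continuous.
  apply/seteqP; split => [g Kg|_ [g Kg <-]] /=.
    by exists (pullback (l x) g) => //; exact: pullbackK.
  by rewrite pullbackVK.
- by move=> g A mA; exact: invariant_field_transport.
- by rewrite /nonzero_measure muE.
Qed.

End InvariantField.

(** The two fields may have different base points. They are compared at one point [x0], and the
    constant spreads to every [x] because the same isomorphism transports both fields. *)
Lemma invariant_fields_proportional (M : manifold R (p + q)) (mu mu' : measure_field M) :
  invariant_field mu -> invariant_field mu' ->
  exists2 c : R, 0 < c & forall (x : M) (A : set (gammaB p q (tangent x))),
    measurable A -> mu' x A = (c%:E * mu x A)%E.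
Proof.
move=> mui mui'; have [x0 [_ [l _]]] := mui.
have [muK mug mun] := invariant_field_regular mui x0.
have [muK' mug' mun'] := invariant_field_regular mui' x0.
have [c c0 cE] := gl_invariant_unique muK muK' mug mug' mun mun'.
exists c => // x A mA.
rewrite -(invariant_field_transport mui (l x) mA).
rewrite -(invariant_field_transport mui' (l x) mA); apply: cE.
by have := measurable_pullback (l x) measurableT mA; rewrite setTI.
Qed.

End InvariantMeasures.

(** * Hilbert spaces of proportional kernels *)

Section KernelScale.
Variables (R : realType) (K : choiceType) (k k' : psdKernel R K) (a : R).
Hypothesis a_gt0 : 0 < a.
Hypothesis kdomE : kdom k = kdom k'.
Hypothesis kfunE : forall x y, kdom k x -> kdom k y ->
  kfun k' x y = (a ^+ 2)%:C * kfun k x y.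
Implicit Types (s t : fsum R K) (u v : nat -> fsum R K).

Lemma scale_fsum_on s : fsum_on k' s = fsum_on k s.
Proof. by rewrite /fsum_on kdomE. Qed.

Lemma scale_fip s t : fsum_on k s -> fsum_on k t -> fip k' s t = (a ^+ 2)%:C * fip k s t.
Proof.
move=> /allP os /allP ot; rewrite /fip mulr_sumr !big_seq; apply: eq_bigr => x /os/asboolP dx.
rewrite mulr_sumr !big_seq; apply: eq_bigr => y /ot/asboolP dy.
by rewrite kfunE//; ring.
Qed.

Lemma scale_fnorm s : fsum_on k s -> fnorm k' s = a * fnorm k s.
Proof.
move=> os; rewrite /fnorm scale_fip// cReM /= mul0r subr0 sqrtrM ?sqr_ge0//.
by rewrite sqrtr_sqr gtr0_norm.
Qed.

Lemma scale_fcauchy u : fcauchy k u -> fcauchy k' u.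
Proof.
move=> [ou cu]; split => [n|e e0]; first by rewrite scale_fsum_on.
have [N H] := cu _ (divr_gt0 e0 a_gt0); exists N => m n Nm Nn.
rewrite scale_fnorm ?fsum_onE ?ou//.
by have := H _ _ Nm Nn; rewrite ltr_pdivlMr// mulrC.
Qed.

Lemma scale_fequiv u v : fcauchy k u -> fcauchy k v -> fequiv k u v -> fequiv k' u v.
Proof.
move=> [ou _] [ov _] uv e e0.
have [N H] := uv _ (divr_gt0 e0 a_gt0); exists N => n Nn.
rewrite scale_fnorm ?fsum_onE ?ou ?ov//.
by have := H _ Nn; rewrite ltr_pdivlMr// mulrC.
Qed.

End KernelScale.

Section SameVector.
Variables (R : realType) (K : choiceType) (k k' : psdKernel R K) (a : R).
Hypothesis a_gt0 : 0 < a.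
Hypothesis kdomE : kdom k = kdom k'.
Hypothesis kfunE : forall x y, kdom k x -> kdom k y ->
  kfun k' x y = (a ^+ 2)%:C * kfun k x y.

Let kfunVE x y : kdom k' x -> kdom k' y -> kfun k x y = (a^-1 ^+ 2)%:C * kfun k' x y.
Proof.
rewrite -kdomE => dx dy; rewrite kfunE// mulrA -rmorphM /= -exprMn mulVf ?gt_eqF//.
by rewrite expr1n mul1r.
Qed.

Let aV_gt0 : 0 < a^-1. Proof. by rewrite invr_gt0. Qed.

Definition same_class (X : kspace k) : kspace k' := insubd (0 : kspace k') (kclass X).

(** Norms are multiplied by [a], so Cauchy sequences and equivalence pass from [k] to [k'], and back
    with the factor [a^-1]. The two classes are equal as sets, hence [insubd] does not return its
    default. *)
Lemma same_class_kcls u : fcauchy k u -> same_class (kcls k u) = kcls k' u.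
Proof.
move=> cu; have cu' := scale_fcauchy a_gt0 kdomE kfunE cu.
suff E : kclass (kcls k u) = kclass (kcls k' u).
  by apply: val_inj; rewrite /same_class E val_insubd ifT//; exact: kclassP.
rewrite !val_kcls//; apply/seteqP; split=> v [cv uv]; split.
- exact: (scale_fcauchy a_gt0 kdomE kfunE cv).
- exact: (scale_fequiv a_gt0 kfunE cu cv uv).
- exact: (scale_fcauchy aV_gt0 (esym kdomE) kfunVE cv).
- exact: (scale_fequiv aV_gt0 kfunVE cu' cv uv).
Qed.

Lemma same_class_linear (c : R[i]) X Y :
  same_class (c *: X + Y) = c *: same_class X + same_class Y.
Proof.
have [u cu ->] := kspaceP X; have [v cv ->] := kspaceP Y.
have cuv : fcauchy k (sadd (sscale c u) v).
  by apply: fcauchy_add => //; exact: fcauchy_scale.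
rewrite kclsP// !same_class_kcls// kclsP//; exact: (scale_fcauchy a_gt0 kdomE kfunE).
Qed.

Lemma same_class_inner X Y :
  inner (same_class X) (same_class Y) = (a ^+ 2)%:C * inner X Y.
Proof.
have [u cu ->] := kspaceP X; have [v cv ->] := kspaceP Y.
have [ou _] := cu; have [ov _] := cv.
rewrite !same_class_kcls//; pose z := inner (kcls k u) (kcls k v).
rewrite -/z.
rewrite [LHS](@kinnerE _ _ _ u v
  (complex.Re ((a ^+ 2)%:C * z)) (complex.Im ((a ^+ 2)%:C * z))).
- by case: (_ * z).
- exact: (scale_fcauchy a_gt0 kdomE kfunE).
- exact: (scale_fcauchy a_gt0 kdomE kfunE).
- rewrite (_ : (fun n => _) = (fun n => a ^+ 2 * complex.Re (fip k (u n) (v n)))).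
    rewrite cReM /= mul0r subr0; apply: cvgM; first exact: cvg_cst.
    exact: kinner_re.
  by apply/funext => n; rewrite (scale_fip kfunE)// cReM /= mul0r subr0.
- rewrite (_ : (fun n => _) = (fun n => a ^+ 2 * complex.Im (fip k (u n) (v n)))).
    rewrite cImM /= mul0r addr0; apply: cvgM; first exact: cvg_cst.
    exact: kinner_im.
  by apply/funext => n; rewrite (scale_fip kfunE)// cImM /= mul0r addr0.
Qed.

End SameVector.

Lemma same_classK (R : realType) (K : choiceType) (k k' : psdKernel R K) (a : R) :
  0 < a -> kdom k = kdom k' ->
  (forall x y, kdom k x -> kdom k y -> kfun k' x y = (a ^+ 2)%:C * kfun k x y) ->
  cancel (@same_class R K k k') (@same_class R K k' k).
Proof.
move=> a0 dE fE X; have [u cu ->] := kspaceP X.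
have a0' : 0 < a^-1 by rewrite invr_gt0.
have fE' x y : kdom k' x -> kdom k' y -> kfun k x y = (a^-1 ^+ 2)%:C * kfun k' x y.
  rewrite -dE => dx dy; rewrite fE// mulrA -rmorphM /= -exprMn mulVf ?gt_eqF//.
  by rewrite expr1n mul1r.
rewrite (same_class_kcls a0 dE fE cu) (same_class_kcls a0' (esym dE) fE')//.
exact: (scale_fcauchy a0 dE fE cu).
Qed.

(** * Scaling of the tensor products *)

Section TensorScale.
Context (R : realType) (M : choiceType) (d : M -> measure_display)
  (T : forall x, measurableType (d x)).
Variables (mu mu' : forall x, {measure set (T x) -> \bar R}) (c : R).
Hypothesis c_gt0 : 0 < c.
Hypothesis mu'E : forall x A, measurable A -> mu' x A = (c%:E * mu x A)%E.

Lemma scale_ge0_integral x (f : T x -> \bar R) : measurable_fun setT f ->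
  (forall t, 0 <= f t)%E -> (\int[mu' x]_t f t = c%:E * \int[mu x]_t f t)%E.
Proof.
move=> mf f0.
have := @ge0_integral_mscale _ _ _ (mu x) setT measurableT (NngNum (ltW c_gt0)) f
  mf (fun t _ => f0 t).
move=> /= <-; by apply: eq_measure_integral => A mA _; rewrite mu'E.
Qed.

Lemma scale_Rintegral x (f : T x -> R) : (mu x).-integrable setT (EFin \o f) ->
  \int[mu' x]_t f t = c * \int[mu x]_t f t.
Proof.
move=> fi; have mf := measurable_int _ fi.
have fp := integrable_pos_fin_num measurableT fi.
have fn := integrable_neg_fin_num measurableT fi.
rewrite /Rintegral integralE [in RHS]integralE.
rewrite !scale_ge0_integral//; last 2 first.
- exact: measurable_funeneg.
- exact: measurable_funepos.
rewrite -muleBr//; last by rewrite fin_num_adde_defr// fin_numN.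
by rewrite fineM// fin_numB fp fn.
Qed.

Lemma scale_L2 x (f : T x -> R[i]) : L2 (mu x) f <-> L2 (mu' x) f.
Proof.
suff E : measurable_fun setT (fun t => complex.Re (f t)) ->
    measurable_fun setT (fun t => complex.Im (f t)) ->
    (\int[mu' x]_t ((complex.Re (f t)) ^+ 2 + (complex.Im (f t)) ^+ 2)%:E =
    c%:E * \int[mu x]_t ((complex.Re (f t)) ^+ 2 + (complex.Im (f t)) ^+ 2)%:E)%E.
  split=> -[m1 m2 foo]; split => //; move: foo; rewrite E//.
    by move=> foo; rewrite lte_mul_pinfty// lee_fin ltW.
  by rewrite !ltey; apply: contra_neq => ->; rewrite gt0_muley ?lte_fin.
move=> m1 m2; apply: scale_ge0_integral.
  by apply/measurable_EFinP; apply: measurable_funD; exact: measurable_funX.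
by move=> t; rewrite lee_fin addr_ge0 ?sqr_ge0.
Qed.

Lemma scale_l2ip x f g : L2 (mu x) f -> L2 (mu x) g ->
  l2ip (mu' x) f g = c%:C * l2ip (mu x) f g.
Proof.
move=> Lf Lg; have [ir ii] := L2_cintegrable Lf Lg.
rewrite /l2ip /cintegral !scale_Rintegral//.
by apply/eqP; rewrite eq_complex /=; apply/andP; split; apply/eqP; ring.
Qed.

Lemma scale_tensor_dom (lam : {fset M}) : tensor_dom mu lam = tensor_dom mu' lam.
Proof. by apply/seteqP; split => f fl x /fl; rewrite scale_L2. Qed.

(** Each point of [lam] contributes one factor [c]. The total is written as a square to match the
    form required of proportional kernels, with the norms scaled by the root. *)
Lemma scale_tensor_ip (lam : {fset M}) f g : tensor_dom mu lam f -> tensor_dom mu lam g ->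
  tensor_ip mu' lam f g = ((Num.sqrt c ^+ #|` lam|) ^+ 2)%:C * tensor_ip mu lam f g.
Proof.
move=> df dg; rewrite /tensor_ip.
transitivity (\prod_(x <- lam) (c%:C * l2ip (mu x) (f x) (g x))).
  by rewrite !big_seq; apply: eq_bigr => x xl; rewrite scale_l2ip//; [exact: df|exact: dg].
rewrite big_split /=; congr (_ * _).
rewrite big_const_seq count_predT -exprM mulnC exprM sqr_sqrtr ?ltW// rmorphXn /=.
by elim: (size _) => //= m ->; rewrite exprS.
Qed.

End TensorScale.

(** * Density of elementary tensors and tensor multiplication *)

Section KernelDensity.
Variables (R : realType) (K : choiceType) (k : psdKernel R K).
Implicit Types (s t : fsum R K) (u v : nat -> fsum R K).

Lemma fcauchy_cst s : fsum_on k s -> fcauchy k (fun=> s).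
Proof. by move=> os; split => // e e0; exists 0%N => m n _ _; rewrite fnorm_sub0. Qed.

Lemma fcauchy_bounded u : fcauchy k u ->
  exists2 B : R, 0 < B & exists N, forall n, (N <= n)%N -> fnorm k (u n) <= B.
Proof.
move=> [ou cu]; have [N H] := cu 1 ltr01.
exists (fnorm k (u N) + 1); first by rewrite ltr_wpDl ?fnorm_ge0.
exists N => n Nn; have := H _ _ Nn (leqnn N).
by have := fnorm_dist (ou n) (ou N); rewrite ler_norml => /andP[_]; lra.
Qed.

Definition kelem (x : K) : kspace k := kcls k (fun=> [:: (1, x)]).

(** The difference is linear and vanishes on finite combinations of kernel elements, which are
    dense; the bound [C] is the continuity that carries this to the completion. *)
Lemma kspace_op_ext (H : hilbertType R) (f g : kspace k -> H) (C : R) :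
  (forall (c : R[i]) X Y, f (c *: X + Y) = c *: f X + f Y) ->
  (forall (c : R[i]) X Y, g (c *: X + Y) = c *: g X + g Y) ->
  (forall X, hnorm (f X - g X) <= C * hnorm X) ->
  (forall x, kdom k x -> f (kelem x) = g (kelem x)) -> forall X, f X = g X.
Proof.
move=> fl gl bd fg X; pose h Y := f Y - g Y.
have hl c Y Z : h (c *: Y + Z) = c *: h Y + h Z.
  by rewrite /h fl gl scalerBr opprD addrACA.
have h0 : h 0 = 0.
  by have := hl 1 0 0; rewrite !scale1r addr0 => /(congr1 (fun z => z - h 0));
    rewrite subrr addrK => <-.
have hs s : fsum_on k s -> h (kcls k (fun=> s)) = 0.
  elim: s => [_|[c x] s IH /= /andP[/asboolP kx os]].
    by rewrite -h0; congr h; rewrite -kzeroE.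
  have o1 : fsum_on k [:: (1, x)] by rewrite /fsum_on /= andbT; apply/asboolP.
  have -> : kcls k (fun=> (c, x) :: s) = c *: kelem x + kcls k (fun=> s).
    rewrite /kelem kclsP//; try exact: fcauchy_cst.
    apply: kcls_ext.
    - by apply: fcauchy_cst; apply/andP; split => //; apply/asboolP.
    - by apply: fcauchy_add; [apply: fcauchy_scale|]; exact: fcauchy_cst.
    - move=> n r; rewrite /sadd /sscale /fadd /fscale /= mulr1.
      by [].
  by rewrite hl IH// addr0 /h fg// subrr scaler0.
suff : h X = 0 by move/eqP; rewrite subr_eq0 => /eqP.
have [u cu ->] := kspaceP X; have [ou cu'] := cu.
have e0 : forall e : R, 0 < e -> hnorm (h (kcls k u)) <= `|C| * e.
  move=> e ep; have [N HN] := cu' _ ep.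
  have -> : h (kcls k u) = h (kcls k u - kcls k (fun=> u N)).
    have -> : kcls k u - kcls k (fun=> u N) = (-1) *: kcls k (fun=> u N) + kcls k u.
      by rewrite scaleN1r addrC.
    by rewrite hl hs// scaler0 add0r.
  apply: le_trans (bd _) _; apply: le_trans (ler_wpM2r (hnorm_ge0 _) (ler_norm C)) _.
  apply: ler_wpM2l => //; rewrite kclsB//; last exact: fcauchy_cst.
  have cc : fcauchy k (fun n => Defs.fsub (u n) (u N)).
    by apply: fcauchy_sub => //; exact: fcauchy_cst.
  rewrite /hnorm khnormE//; apply: limr_le; first exact: fcauchy_norm_cvg.
  by exists N => // n /= Nn; apply: ltW; exact: HN.
apply: inner_eq0; have := hnorm_ge0 (h (kcls k u)).
rewrite le_eqVlt => /orP[/eqP/esym h00|hp].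
  have := inner_ge0 (h (kcls k u)); rewrite lecE /= => /andP[/eqP im re].
  apply/eqP; rewrite eq_complex im eqxx andbT; have := hnorm2 (h (kcls k u)).
  by rewrite h00 expr0n /= => <-.
(* Approximating within the norm of the difference divided by [|C| + 1] would make that norm
   strictly smaller than itself. *)
have C1 : 0 < `|C| + 1 by rewrite ltr_wpDl.
have := e0 _ (divr_gt0 hp C1); rewrite mulrCA leNgt => /negP[].
rewrite -[ltRHS]mulr1 ltr_pM2l// ltr_pdivrMr// mul1r ltrDl//.
Qed.

End KernelDensity.

Section TensorMul.
Context (R : realType) (M : choiceType) (d : M -> measure_display)
  (T : forall x, measurableType (d x)).
Variables (mu : forall x, {measure set (T x) -> \bar R}) (lam lam' : {fset M}).
Local Notation D := (lam' `\` lam)%fset.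
Local Notation k1 := (tensor_kernel mu D).
Local Notation k2 := (tensor_kernel mu lam).
Local Notation k' := (tensor_kernel mu lam').
Implicit Types (t s r : seq (R[i] * Defs.family R T)).

Lemma merge_dom f g : tensor_dom mu D g -> tensor_dom mu lam f ->
  tensor_dom mu lam' (Defs.merge lam g f).
Proof.
move=> dg df x xl; rewrite /Defs.merge; case: ifPn => xlam; first exact: df.
by apply: dg; rewrite inE xlam.
Qed.

Lemma fmerge_on t s : fsum_on k1 t -> fsum_on k2 s -> fsum_on k' (fmerge lam t s).
Proof.
move=> /allP ot /allP os; apply/allP => _ /allpairsP[[b a] [bt as_ ->]] /=.
by apply/asboolP; apply: merge_dom; apply/asboolP; [exact: (ot b)|exact: (os a)].
Qed.

Lemma fip_fmerger r t s : fip k' r (fmerge lam t s) =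
  \sum_(b <- t) \sum_(a <- s) b.1 * a.1 * fip k' r [:: (1, Defs.merge lam b.2 a.2)].
Proof.
rewrite /fip; under eq_bigr do rewrite big_allpairs_dep.
rewrite exchange_big; apply: eq_bigr => b _; rewrite exchange_big; apply: eq_bigr => a _ /=.
by rewrite mulr_sumr; apply: eq_bigr => x _; rewrite big_seq1 /=; ring.
Qed.

Lemma fmerge_addl t t' s : fext k' (fmerge lam (fadd t t') s)
  (fadd (fmerge lam t s) (fmerge lam t' s)).
Proof. by move=> r; rewrite fip_addr !fip_fmerger big_cat. Qed.

(** The two lists contain the same terms in a different order, so the equality holds only after
    pairing with an arbitrary [r], which is what [fext] records. *)
Lemma fmerge_addr t s s' : fext k' (fmerge lam t (fadd s s'))
  (fadd (fmerge lam t s) (fmerge lam t s')).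
Proof.
move=> r; rewrite fip_addr !fip_fmerger -big_split; apply: eq_bigr => b _.
by rewrite big_cat.
Qed.

Lemma fmerge_scale c c' t s : fext k' (fmerge lam (fscale c t) (fscale c' s))
  (fscale (c * c') (fmerge lam t s)).
Proof.
move=> r; rewrite fip_scaler !fip_fmerger big_map mulr_sumr; apply: eq_bigr => b _.
by rewrite big_map mulr_sumr; apply: eq_bigr => a _ /=; ring.
Qed.

Lemma fmerge_subl t t' s r : fip k' r (fmerge lam (Defs.fsub t t') s) =
  fip k' r (fmerge lam t s) - fip k' r (fmerge lam t' s).
Proof.
rewrite fmerge_addl fip_addr; congr (_ + _).
have E : s = fscale 1 s :> seq _.
  by rewrite /fscale; under eq_map do rewrite mul1r -surjective_pairing; rewrite map_id.
by rewrite {1}E fmerge_scale fip_scaler; ring.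
Qed.

Lemma fmerge_subr t s s' r : fip k' r (fmerge lam t (Defs.fsub s s')) =
  fip k' r (fmerge lam t s) - fip k' r (fmerge lam t s').
Proof.
rewrite fmerge_addr fip_addr; congr (_ + _).
have E : t = fscale 1 t :> seq _.
  by rewrite /fscale; under eq_map do rewrite mul1r -surjective_pairing; rewrite map_id.
by rewrite {1}E fmerge_scale fip_scaler; ring.
Qed.

Hypothesis sub : (lam `<=` lam')%fset.

Lemma tensor_ip_merge g f g' f' :
  tensor_ip mu lam' (Defs.merge lam g f) (Defs.merge lam g' f') =
  tensor_ip mu D g g' * tensor_ip mu lam f f'.
Proof.
have pe : perm_eq lam' (D ++ lam).
  apply: uniq_perm; first exact: fset_uniq.
    rewrite cat_uniq !fset_uniq andbT /=; apply/hasPn => x xlam.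
    by rewrite inE xlam.
  move=> x; rewrite mem_cat inE; case: (boolP (x \in lam)) => xl /=.
    by rewrite (fsubsetP sub).
  by rewrite orbF.
rewrite /tensor_ip (perm_big _ pe) big_cat /=; congr (_ * _).
  rewrite !big_seq; apply: eq_bigr => x; rewrite inE => /andP[/negbTE xl _].
  by rewrite /Defs.merge xl.
by rewrite !big_seq; apply: eq_bigr => x xl; rewrite /Defs.merge xl.
Qed.

Lemma fip_fmerge t s t' s' : fip k' (fmerge lam t s) (fmerge lam t' s') =
  fip k1 t t' * fip k2 s s'.
Proof.
rewrite /fip big_allpairs_dep mulr_suml; apply: eq_bigr => b _ /=.
rewrite mulr_sumr; apply: eq_bigr => a _ /=.
rewrite big_allpairs_dep mulr_suml; apply: eq_bigr => b' _ /=.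
rewrite mulr_sumr; apply: eq_bigr => a' _ /=.
by rewrite tensor_ip_merge rmorphM /=; ring.
Qed.

Lemma fnorm_fmerge t s : fsum_on k1 t -> fsum_on k2 s ->
  fnorm k' (fmerge lam t s) = fnorm k1 t * fnorm k2 s.
Proof.
move=> ot os; rewrite /fnorm fip_fmerge cReM (fip_im0 ot) mul0r subr0 sqrtrM//.
exact: fip_re_ge0.
Qed.

(** This is the product estimate from ts - t's' = (t - t')s + t'(s - s'), the norm being
    multiplicative on tensor products. *)
Lemma fnorm_fmerge_sub t s t' s' :
  fsum_on k1 t -> fsum_on k2 s -> fsum_on k1 t' -> fsum_on k2 s' ->
  fnorm k' (Defs.fsub (fmerge lam t s) (fmerge lam t' s')) <=
  fnorm k1 (Defs.fsub t t') * fnorm k2 s + fnorm k1 t' * fnorm k2 (Defs.fsub s s').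
Proof.
move=> ot os ot' os'.
rewrite -!fnorm_fmerge ?fsum_onE ?ot ?os ?ot'//.
apply: le_trans (fnorm_add _ _); rewrite ?fmerge_on ?fsum_onE ?ot ?os ?ot'//.
rewrite le_eqVlt; apply/orP; left; apply/eqP.
apply: fnorm_ext; rewrite ?fsum_onE ?fmerge_on ?fsum_onE ?ot ?os ?ot'//.
by move=> r; rewrite !fip_addr fip_scaler fmerge_subl fmerge_subr; ring.
Qed.

Lemma fcauchy_fmerge u v : fcauchy k1 u -> fcauchy k2 v ->
  fcauchy k' (fun n => fmerge lam (u n) (v n)).
Proof.
move=> cu cv; have [ou cu'] := cu; have [ov cv'] := cv.
split => [n|e e0]; first exact: fmerge_on.
have [B B0 [N1 H1]] := fcauchy_bounded cu; have [B' B'0 [N2 H2]] := fcauchy_bounded cv.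
(* [B] and [B'] bound the tails of the two sequences, so the tolerances e / (2 B') and e / (2 B)
   give e / 2 for each term of the product estimate. *)
have [N3 H3] := cu' _ (divr_gt0 e0 (mulr_gt0 (ltr0n _ 2) B'0)).
have [N4 H4] := cv' _ (divr_gt0 e0 (mulr_gt0 (ltr0n _ 2) B0)).
exists (maxn (maxn N1 N2) (maxn N3 N4)) => m n; rewrite !geq_max.
move=> /andP[/andP[m1 m2] /andP[m3 m4]] /andP[/andP[n1 n2] /andP[n3 n4]].
apply: le_lt_trans (fnorm_fmerge_sub (ou m) (ov m) (ou n) (ov n)) _.
have := H3 _ _ m3 n3; have := H4 _ _ m4 n4; rewrite !ltr_pdivlMr ?mulr_gt0//.
have := H2 _ m2; have := H1 _ n1.
have := fnorm_ge0 k1 (Defs.fsub (u m) (u n)); have := fnorm_ge0 k2 (Defs.fsub (v m) (v n)).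
move: (fnorm _ _) (fnorm _ _) (fnorm _ _) (fnorm _ _) => a b x y; nra.
Qed.

Lemma fequiv_fmerge u v u' v' : fcauchy k1 u -> fcauchy k2 v ->
  fcauchy k1 u' -> fcauchy k2 v' -> fequiv k1 u u' -> fequiv k2 v v' ->
  fequiv k' (fun n => fmerge lam (u n) (v n)) (fun n => fmerge lam (u' n) (v' n)).
Proof.
move=> [ou cu] cv cu' [ov' _] eu ev e e0; have [ov _] := cv; have [ou' _] := cu'.
have [B B0 [N1 H1]] := fcauchy_bounded cu'; have [B' B'0 [N2 H2]] := fcauchy_bounded cv.
have [N3 H3] := eu _ (divr_gt0 e0 (mulr_gt0 (ltr0n _ 2) B'0)).
have [N4 H4] := ev _ (divr_gt0 e0 (mulr_gt0 (ltr0n _ 2) B0)).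
exists (maxn (maxn N1 N2) (maxn N3 N4)) => n; rewrite !geq_max.
move=> /andP[/andP[n1 n2] /andP[n3 n4]].
apply: le_lt_trans (fnorm_fmerge_sub (ou n) (ov n) (ou' n) (ov' n)) _.
have := H3 _ n3; have := H4 _ n4; rewrite !ltr_pdivlMr ?mulr_gt0//.
have := H2 _ n2; have := H1 _ n1.
have := fnorm_ge0 k1 (Defs.fsub (u n) (u' n)); have := fnorm_ge0 k2 (Defs.fsub (v n) (v' n)).
move: (fnorm _ _) (fnorm _ _) (fnorm _ _) (fnorm _ _) => a b x y; nra.
Qed.

Lemma tensor_mul_kcls u v : fcauchy k1 u -> fcauchy k2 v ->
  tensor_mul (kcls k1 u) (kcls k2 v) = kcls k' (fun n => fmerge lam (u n) (v n)).
Proof.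
move=> cu cv; have [cu' uu'] := krepr_cls cu; have [cv' vv'] := krepr_cls cv.
apply/esym/kcls_eq; [exact: fcauchy_fmerge|exact: fcauchy_fmerge|].
exact: fequiv_fmerge.
Qed.

Lemma tensor_mulZ (c c' : R[i]) (xi : tensorL2 mu D) (psi : tensorL2 mu lam) :
  tensor_mul (lam' := lam') (c *: xi) (c' *: psi) = (c * c') *: tensor_mul xi psi.
Proof.
have [u cu ->] := kspaceP xi; have [v cv ->] := kspaceP psi.
have -> : c *: (kcls k1 u : tensorL2 mu D) = kcls k1 (sscale c u) by exact: kscale_cls.
have -> : c' *: (kcls k2 v : tensorL2 mu lam) = kcls k2 (sscale c' v) by exact: kscale_cls.
rewrite !tensor_mul_kcls//; try exact: fcauchy_scale.
rewrite [RHS](kscale_cls _ (fcauchy_fmerge cu cv)).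
apply: kcls_ext.
- by apply: fcauchy_fmerge; exact: fcauchy_scale.
- by apply: fcauchy_scale; exact: fcauchy_fmerge.
- by move=> n; exact: fmerge_scale.
Qed.

Lemma tensor_mul_kelem f : tensor_dom mu lam' f ->
  tensor_mul (kelem k1 f) (kelem k2 f) = kelem k' f.
Proof.
move=> df; have o1 : fsum_on k1 [:: (1, f)].
  by rewrite /fsum_on /= andbT; apply/asboolP => x; rewrite inE => /andP[_ /df].
have o2 : fsum_on k2 [:: (1, f)].
  by rewrite /fsum_on /= andbT; apply/asboolP => x /(fsubsetP sub)/df.
rewrite /kelem tensor_mul_kcls; try exact: fcauchy_cst.
congr kcls; apply/funext => _; rewrite /fmerge /= mulr1; congr [:: (_, _)].
by apply: functional_extensionality_dep => x; rewrite /Defs.merge if_same.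
Qed.

(** An elementary tensor over [lam'] is the product of its restrictions to the two parts of [lam'],
    so products determine a bounded operator. This makes the operator chosen in [op_iota] unique. *)
Lemma tensor_op_ext (a b : boundedOp (tensorL2 mu lam')) :
  (forall (xi : tensorL2 mu D) (psi : tensorL2 mu lam),
    a (tensor_mul xi psi) = b (tensor_mul xi psi)) -> a = b.
Proof.
move=> ab; apply: bopP; have [ca ca0 Ha] := bop_bounded (a - b).
apply: (@kspace_op_ext _ _ k' _ a b ca).
- by move=> c X Y; exact: bop_linear.
- by move=> c X Y; exact: bop_linear.
- move=> X; apply: le_trans (Ha X); rewrite le_eqVlt; apply/orP; left; apply/eqP.
  by congr hnorm; rewrite /= !(scale1r, addr0, scaleN1r).
- by move=> f df; rewrite -(tensor_mul_kelem df) ab.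
Qed.

End TensorMul.

(** On representing sequences the product is the formal operation [fmerge], which does not involve
    the measure. *)
Lemma same_class_tensor_mul (R : realType) (M : choiceType) (d : M -> measure_display)
    (T : forall x, measurableType (d x))
    (mu mu' : forall x, {measure set (T x) -> \bar R}) (c : R) (lam lam' : {fset M})
    (xi : tensorL2 mu (lam' `\` lam)%fset) (psi : tensorL2 mu lam) : 0 < c ->
  (forall x A, measurable A -> mu' x A = (c%:E * mu x A)%E) ->
  (lam `<=` lam')%fset ->
  same_vector mu' (tensor_mul (lam' := lam') xi psi) =
  tensor_mul (same_vector mu' xi) (same_vector mu' psi).
Proof.
move=> c0 cE sub; have [u cu ->] := kspaceP xi; have [v cv ->] := kspaceP psi.
have sE (l : {fset M}) w : fcauchy (tensor_kernel mu l) w ->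
    same_vector mu' (kcls (tensor_kernel mu l) w : tensorL2 mu l) =
    kcls (tensor_kernel mu' l) w.
  apply: (same_class_kcls (exprn_gt0 #|` l| (_ : 0 < Num.sqrt c))).
  - by rewrite sqrtr_gt0.
  - exact: (scale_tensor_dom c0 cE).
  - exact: (scale_tensor_ip c0 cE).
have cw (l : {fset M}) w : fcauchy (tensor_kernel mu l) w ->
    fcauchy (tensor_kernel mu' l) w.
  apply: (scale_fcauchy (exprn_gt0 #|` l| (_ : 0 < Num.sqrt c))).
  - by rewrite sqrtr_gt0.
  - exact: (scale_tensor_dom c0 cE).
  - exact: (scale_tensor_ip c0 cE).
rewrite tensor_mul_kcls// !sE//; last exact: fcauchy_fmerge.
by rewrite tensor_mul_kcls//; exact: cw.
Qed.

(** * Operators and states *)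

Section Inverse.
Context (A : zmodType) (B : Type) (f : A -> B).
Hypothesis fb : bijective f.

Lemma inverseK : cancel f (inverse f).
Proof.
move=> a; apply: (bij_inj fb).
by have [] := xgetPex (P := [set x | f x = f a]) 0 (ex_intro _ a erefl).
Qed.

Lemma inverseVK : cancel (inverse f) f.
Proof.
have [g fK gK] := fb.
by move=> b; have := xgetPex (P := [set x | f x = b]) 0 (ex_intro _ (g b) (gK b)).
Qed.

End Inverse.

Section HilbertIsomorphism.
Context (R : realType) (H H' : hilbertType R) (U : H -> H').
Hypothesis Ui : hilbert_isomorphism U.

Lemma hilbert_iso_bij : bijective U. Proof. by case: Ui. Qed.

Lemma hilbert_iso_hnorm x : hnorm (U x) = hnorm x.
Proof. by case: Ui => _ _ Uin; rewrite /hnorm Uin. Qed.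

Lemma hilbert_iso_inverse : hilbert_isomorphism (inverse U).
Proof.
case: (Ui) => Ub Ul Uin; have VK := inverseVK Ub; have UK := inverseK Ub.
split; first by exists U.
  by move=> k x y; apply: (bij_inj Ub); rewrite Ul !VK.
by move=> x y; rewrite -Uin !VK.
Qed.

(** The conjugated map is bounded with the same constant, so the default of [insubd] does not
    occur. *)
Lemma conj_opE (a : boundedOp H) x : conj_op U a x = U (a (inverse U x)).
Proof.
case: (Ui) => Ub Ul Uin; have VK := inverseVK Ub.
have [_ Vl _] := hilbert_iso_inverse.
suff bd : `[< bounded_operator (U \o a \o inverse U) >].
  by rewrite /conj_op -[bop_fun _]/(val _) val_insubd bd.
apply/asboolP; split => [k y z|]; first by rewrite /= Vl bop_linear Ul.
have [c c0 ca] := bop_bounded a; exists c => y /=.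
by rewrite hilbert_iso_hnorm (le_trans (ca _))// -hilbert_iso_hnorm VK.
Qed.

Lemma conj_op_lin k a b : conj_op U (k *: a + b) = k *: conj_op U a + conj_op U b.
Proof.
case: (Ui) => Ub Ul Uin; apply: bopP => x; rewrite conj_opE /= !conj_opE.
by rewrite !(scale1r, addr0) Ul.
Qed.

Lemma conj_op0 : conj_op U 0 = 0.
Proof.
by have := conj_op_lin (-1) 0 0; rewrite scaleN1r addNr scaleN1r addNr.
Qed.

End HilbertIsomorphism.

Section ConjOp.
Context (R : realType) (H H' : hilbertType R) (U : H -> H').
Hypothesis Ui : hilbert_isomorphism U.
Let Vi := hilbert_iso_inverse Ui.
Let Ub := hilbert_iso_bij Ui.
Let Vb := hilbert_iso_bij Vi.

Lemma inverse_inverse : inverse (inverse U) = U.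
Proof.
apply/funext => x; apply: (bij_inj Vb); rewrite (inverseVK Vb).
by rewrite inverseK.
Qed.

Lemma conj_opK : cancel (conj_op U) (conj_op (inverse U)).
Proof.
move=> a; apply: bopP => x; rewrite (conj_opE Vi) (conj_opE Ui) inverse_inverse.
by rewrite !(inverseK Ub).
Qed.

Lemma conj_opVK : cancel (conj_op (inverse U)) (conj_op U).
Proof.
move=> a; apply: bopP => x; rewrite (conj_opE Ui) (conj_opE Vi) inverse_inverse.
by rewrite !(inverseVK Ub).
Qed.

Lemma adjoint_unique (K : hilbertType R) (a b b' : boundedOp K) :
  (forall x y, inner (b x) y = inner x (a y)) ->
  (forall x y, inner (b' x) y = inner x (a y)) -> b = b'.
Proof.
move=> H1 H2; apply: bopP => x; apply/eqP; rewrite -subr_eq0; apply/eqP.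
apply: inner_eq0; rewrite -[X in - X]scale1r -scaleNr innerDl innerZl H1 H2.
by rewrite rmorphN rmorph1 mulN1r subrr.
Qed.

Lemma conj_op_adjoint (a b : boundedOp H) :
  (forall x y, inner (b x) y = inner x (a y)) ->
  forall x y, inner (conj_op U b x) y = inner x (conj_op U a y).
Proof.
case: (Ui) => _ _ Uin ab x y; rewrite !(conj_opE Ui).
by rewrite -{1}(inverseVK Ub y) -{2}(inverseVK Ub x) !Uin.
Qed.

Lemma conj_op_bij : bijective (conj_op U).
Proof. by exists (conj_op (inverse U)); [exact: conj_opK|exact: conj_opVK]. Qed.

End ConjOp.

Section ConjOpMorphism.
Context (R : realType) (H H' : hilbertType R) (U : H -> H').
Hypothesis Ui : hilbert_isomorphism U.
Let Vi := hilbert_iso_inverse Ui.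
Let Ub := hilbert_iso_bij Ui.

(** Conjugation by [U] and by its inverse carries adjoints to adjoints, so [a] has one exactly when
    its conjugate does. If so, uniqueness identifies the chosen values; if not, both are the default
    0, which is preserved. *)
Lemma conj_op_star (a : boundedOp H) : conj_op U (bop_adj a) = bop_adj (conj_op U a).
Proof.
have [[b ab]|nab] := pselect (exists b : boundedOp H,
  forall x y, inner (b x) y = inner x (a y)).
  rewrite /bop_adj (xget_unique _ (x := b))//; last first.
    by move=> b' ab'; exact: adjoint_unique ab' ab.
  rewrite (xget_unique _ (x := conj_op U b))//; first exact: conj_op_adjoint.
  move=> b' ab'; exact: adjoint_unique ab' (conj_op_adjoint Ui ab).
rewrite /bop_adj xgetPN; last by move=> b ab; apply: nab; exists b.
rewrite xgetPN ?conj_op0//; move=> b ab; apply: nab.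
exists (conj_op (inverse U) b) => x y.
by rewrite (conj_op_adjoint Vi ab) (conj_opK Ui).
Qed.

Lemma conj_op_norm (a : boundedOp H) : bop_norm (conj_op U a) = bop_norm a.
Proof.
rewrite /bop_norm; congr sup; apply/seteqP; split => [_ [x x1 <-]|_ [x x1 <-]] /=.
  exists (inverse U x); first by rewrite /= (hilbert_iso_hnorm Vi).
  by rewrite (conj_opE Ui) (hilbert_iso_hnorm Ui).
exists (U x); first by rewrite /= (hilbert_iso_hnorm Ui).
by rewrite (conj_opE Ui) (hilbert_iso_hnorm Ui) (inverseK Ub).
Qed.

Lemma conj_op_star_isomorphism :
  star_isomorphism (conj_op U : boundedOp H -> boundedOp H').
Proof.
split; first exact: conj_op_bij.
  split.
  - by move=> k a b; exact: conj_op_lin.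
  - move=> a b; apply: bopP => x; rewrite [RHS]/= !(conj_opE Ui) /=.
    by rewrite (inverseK Ub).
  - by apply: bopP => x; rewrite (conj_opE Ui) /= (inverseVK Ub).
  - exact: conj_op_star.
exact: conj_op_norm.
Qed.

End ConjOpMorphism.

Section StateTransport.
Context (R : realType) (A B : starAlgType R) (f : A -> B).
Hypothesis fi : star_isomorphism f.

Lemma star_isomorphism_inverse : star_isomorphism (inverse f).
Proof.
case: (fi) => fb [fl fM f1 fS] fn; have VK := inverseVK fb; have fK := inverseK fb.
split; first by exists f.
  split=> [k a b|a b||a]; apply: (bij_inj fb).
  - by rewrite fl !VK.
  - by rewrite fM !VK.
  - by rewrite f1 VK.
  - by rewrite fS !VK.
by move=> a; rewrite -fn VK.
Qed.

Lemma pull_state_states (s : B -> R[i]) : states s -> states (pull_state f s).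
Proof.
case: (fi) => fb [fl fM f1 fS] fn; have VK := inverseVK fb.
move=> [sl s0 sh s1]; rewrite /pull_state.
have E : [set ComplexField.Normc.normc ((s \o f) a) | a in [set a : A | anorm a <= 1]] =
    [set ComplexField.Normc.normc (s a) | a in [set a : B | anorm a <= 1]].
  apply/seteqP; split=> [_ [a a1 <-]|_ [b b1 <-]].
    by exists (f a) => //=; rewrite fn.
  by exists (inverse f b); rewrite /= ?VK// -fn VK.
split; rewrite ?E//.
- by move=> k a b; rewrite /= fl sl.
- by move=> a; rewrite /= fM fS.
Qed.

End StateTransport.

Section OpIota.
Context (R : realType) (M : choiceType) (d : M -> measure_display)
  (T : forall x, measurableType (d x)).
Variables (mu mu' : forall x, {measure set (T x) -> \bar R}).
Variables (lam lam' : {fset M}).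
Hypothesis sub : (lam `<=` lam')%fset.
Variables (U : tensorL2 mu lam -> tensorL2 mu' lam)
  (U' : tensorL2 mu lam' -> tensorL2 mu' lam')
  (UD : tensorL2 mu (lam' `\` lam)%fset -> tensorL2 mu' (lam' `\` lam)%fset).
Hypothesis Ui : hilbert_isomorphism U.
Hypothesis U'i : hilbert_isomorphism U'.
Hypothesis UDi : hilbert_isomorphism UD.
Hypothesis U_mul : forall xi psi, U' (tensor_mul xi psi) = tensor_mul (UD xi) (U psi).

Definition is_iota (nu : forall x, {measure set (T x) -> \bar R})
    (a : opAlg nu lam) (b : opAlg nu lam') : Prop :=
  forall (xi : tensorL2 nu (lam' `\` lam)%fset) (psi : tensorL2 nu lam),
    b (tensor_mul xi psi) = tensor_mul xi (a psi).

Lemma op_iotaE nu (a : opAlg nu lam) (b : opAlg nu lam') : is_iota a b ->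
  op_iota lam' a = b.
Proof.
move=> ab; apply: xget_unique => // b' ab'.
by apply: (tensor_op_ext sub) => xi psi; rewrite ab ab'.
Qed.

(** Every product vector of the second space is the [U']-image of a product vector of the first, as
    [UD] and [U] are onto; on such vectors the defining equation is transported by [U_mul]. *)
Lemma is_iota_conj (a : opAlg mu lam) (b : opAlg mu lam') : is_iota a b ->
  is_iota (conj_op U a : opAlg mu' lam) (conj_op U' b : opAlg mu' lam').
Proof.
move=> ab xi psi; have UDK := inverseVK (hilbert_iso_bij UDi).
have UK := inverseVK (hilbert_iso_bij Ui).
rewrite (conj_opE U'i) (conj_opE Ui) -{1}(UDK xi) -{1}(UK psi) -U_mul.
by rewrite (inverseK (hilbert_iso_bij U'i)) ab U_mul UDK.
Qed.

End OpIota.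

Lemma op_iota_conj (R : realType) (M : choiceType) (d : M -> measure_display)
  (T : forall x, measurableType (d x))
  (mu mu' : forall x, {measure set (T x) -> \bar R})
  (lam lam' : {fset M})
  (U : tensorL2 mu lam -> tensorL2 mu' lam)
  (U' : tensorL2 mu lam' -> tensorL2 mu' lam')
  (UD : tensorL2 mu (lam' `\` lam)%fset -> tensorL2 mu' (lam' `\` lam)%fset) :
  (lam `<=` lam')%fset ->
  hilbert_isomorphism U -> hilbert_isomorphism U' -> hilbert_isomorphism UD ->
  (forall xi psi, U' (tensor_mul xi psi) = tensor_mul (UD xi) (U psi)) ->
  forall a : opAlg mu lam,
  op_iota lam' (conj_op U a : opAlg mu' lam) =
  (conj_op U' (op_iota lam' a : opAlg mu lam') : opAlg mu' lam').
Proof.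
move=> sub Ui U'i UDi U_mul a.
have [[b ab]|nab] := pselect (exists b : opAlg mu lam', is_iota a b).
  rewrite (op_iotaE sub ab); apply: (op_iotaE sub).
  exact: (is_iota_conj Ui U'i UDi U_mul).
(* Without an operator extending [a], [op_iota] is the junk value [0] on both
   sides. *)
rewrite [X in conj_op U' X]xgetPN; last by move=> b ab; apply: nab; exists b.
rewrite (conj_op0 U'i) /op_iota xgetPN// => b ab; apply: nab.
exists (conj_op (inverse U') b).
have := @is_iota_conj _ _ _ _ mu' mu lam lam' (inverse U) (inverse U') (inverse UD)
  (hilbert_iso_inverse Ui) (hilbert_iso_inverse U'i) (hilbert_iso_inverse UDi) _ _ b ab.
rewrite (conj_opK Ui); apply => xi psi.
apply: (bij_inj (hilbert_iso_bij U'i)); rewrite (inverseVK (hilbert_iso_bij U'i)) U_mul.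
by rewrite (inverseVK (hilbert_iso_bij Ui)) (inverseVK (hilbert_iso_bij UDi)).
Qed.

(** * Inductive limits *)

Section CStarNorm.
Context (R : realType) (A : cstarType R).
Implicit Types a b : A.
Local Notation normc := ComplexField.Normc.normc.

Lemma anorm0 : anorm (0 : A) = 0.
Proof. by rewrite -(scale0r (0 : A)) anormZ /= expr0n /= addr0 sqrtr0 mul0r. Qed.

Lemma anormN a : anorm (- a) = anorm a.
Proof.
by rewrite -scaleN1r anormZ /= oppr0 expr0n /= addr0 sqrrN expr1n sqrtr1 mul1r.
Qed.

Lemma anormB a b : anorm (a - b) = anorm (b - a).
Proof. by rewrite -anormN opprB. Qed.

Lemma anorm_ge0 a : 0 <= anorm a.
Proof. by have := anormD a (- a); rewrite subrr anorm0 anormN; lra. Qed.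

Lemma anorm_tri b a c : anorm (a - c) <= anorm (a - b) + anorm (b - c).
Proof. by apply: le_trans (anormD _ _); rewrite addrA subrK. Qed.

(** The C*-identity and submultiplicativity bound the square of the norm of [b] by the norms of
    [star b] and [b]; cancel one factor and apply the result to [star a] as well. *)
Lemma anorm_star a : anorm (star a) = anorm a.
Proof.
have H b : anorm b <= anorm (star b).
  have := anormM (star b) b; rewrite cstar_identity.
  have := anorm_ge0 b; rewrite le_eqVlt => /orP[/eqP <- _|b0]; first exact: anorm_ge0.
  by rewrite expr2 ler_pM2r.
by apply/eqP; rewrite eq_le H -{2}(starK a) H.
Qed.

Lemma anorm_small_eq a b : (forall e, 0 < e -> anorm (a - b) < e) -> a = b.
Proof.
move=> H; apply/eqP; rewrite -subr_eq0; apply/eqP; apply: anorm_eq0.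
apply/eqP; rewrite eq_le anorm_ge0 andbT leNgt; apply/negP => /H.
by rewrite ltxx.
Qed.

Lemma anorm_lin k a b a' b' :
  anorm (k *: a + b - (k *: a' + b')) <= normc k * anorm (a - a') + anorm (b - b').
Proof. by rewrite opprD addrACA -scalerBr -anormZ anormD. Qed.

Lemma anorm_mul_sub a b a' b' :
  anorm (amul a b - amul a' b') <=
  anorm (a - a') * anorm b + anorm a' * anorm (b - b').
Proof.
apply: le_trans (lerD (anormM _ _) (anormM _ _)); apply: le_trans (anormD _ _).
have mBl x y z : amul (x - y) z = amul x z - amul y z :> A.
  by rewrite -scaleN1r addrC amulPl scaleN1r addrC.
have mBr x y z : amul z (x - y) = amul z x - amul z y :> A.
  by rewrite -scaleN1r addrC amulPr scaleN1r addrC.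
by rewrite mBl mBr addrA subrK.
Qed.

Lemma state_normc_le (s : A -> R[i]) a : states s -> normc (s a) <= anorm a.
Proof.
move=> [sl _ sh s1].
have s00 : s 0 = 0.
  by have := sl 1 0 0; rewrite scale1r addr0 mul1r => /(congr1 (fun z => z - s 0));
    rewrite subrr addrK => <-.
have [a0|a0] := eqVneq (anorm a) 0.
  by rewrite a0 (anorm_eq0 a a0) s00 ComplexField.Normc.normc0.
have ap : 0 < anorm a by rewrite lt_neqAle eq_sym a0 anorm_ge0.
have nV : normc ((anorm a)^-1%:C) = (anorm a)^-1.
  by rewrite /= expr0n /= addr0 sqrtr_sqr ger0_norm// invr_ge0 ltW.
have : normc (s ((anorm a)^-1%:C *: a)) <= 1.
  rewrite -s1; apply: (sup_upper_bound sh).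
  exists ((anorm a)^-1%:C *: a) => //=.
  by rewrite anormZ nV mulVf.
rewrite -[_ *: a]addr0 sl s00 addr0 ComplexField.Normc.normcM nV.
by rewrite mulrC ler_pdivrMr// mul1r.
Qed.

Lemma states_dense_eq (s t : A -> R[i]) (D : set A) : states s -> states t ->
  (forall a e, 0 < e -> exists2 b, D b & anorm (a - b) < e) ->
  (forall a, D a -> s a = t a) -> s = t.
Proof.
move=> ss st Dd eqD; apply/funext => a; apply/eqP; rewrite -subr_eq0; apply/eqP.
have sB (r : A -> R[i]) x y : states r -> r (x - y) = r x - r y.
  by move=> [rl _ _ _]; rewrite -scaleN1r addrC rl mulN1r addrC.
apply: (@ComplexField.Normc.eq0_normc R).
have n0 (z : R[i]) : 0 <= normc z by case: z => x y; exact: sqrtr_ge0.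
apply/eqP; rewrite eq_le n0 andbT leNgt; apply/negP => n_gt0.
have [b Db ab] := Dd a _ (divr_gt0 n_gt0 (ltr0n R 2)).
have : normc (s a - t a) <= anorm (a - b) + anorm (a - b).
  have -> : s a - t a = s (a - b) - t (a - b) by rewrite !sB// (eqD b Db); ring.
  apply: le_trans (le_normcD _ _) _.
  by rewrite normcN lerD// state_normc_le.
move: (normc _) ab => x; lra.
Qed.

End CStarNorm.

Section ExtendIsomorphism.
Context (R : realType) (B B' : cstarType R) (G : B -> B' -> Prop).
Local Notation normc := ComplexField.Normc.normc.
Hypothesis Glin : forall k a a' b b', G a a' -> G b b' -> G (k *: a + b) (k *: a' + b').
Hypothesis Gmul : forall a a' b b', G a a' -> G b b' -> G (amul a b) (amul a' b').
Hypothesis Gone : G (aone (s := B)) (aone (s := B')).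
Hypothesis Gstar : forall a a', G a a' -> G (star a) (star a').
Hypothesis Gnorm : forall a a', G a a' -> anorm a = anorm a'.
Hypothesis Gdense : forall (b : B) (e : R), 0 < e -> exists a a', G a a' /\ anorm (b - a) < e.
Hypothesis Gdense' : forall (b : B') (e : R), 0 < e ->
  exists a a', G a a' /\ anorm (b - a') < e.

(** The closure of the graph [G] in the product of the two algebras. The definition is symmetric, so
    the inverse map comes from the transposed relation. *)
Definition Gbar (b : B) (b' : B') : Prop := forall e : R, 0 < e ->
  exists a a', [/\ G a a', anorm (b - a) < e & anorm (b' - a') < e].

Let Gsub a a' b b' : G a a' -> G b b' -> anorm (a - b) = anorm (a' - b').
Proof.
move=> ga gb; have := Gnorm (Glin (-1) gb ga).
by rewrite !scaleN1r ![- b + _]addrC ![- b' + _]addrC.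
Qed.

Lemma Gbar_norm b b' : Gbar b b' -> anorm b = anorm b'.
Proof.
move=> bb; apply/eqP; rewrite -subr_eq0 -normr_eq0; apply/eqP.
apply/eqP; rewrite eq_le normr_ge0 andbT leNgt; apply/negP => n_gt0.
have [a [a' [ga ba ba']]] := bb _ (divr_gt0 n_gt0 (ltr0n R 2)).
have E := Gnorm ga.
have : `|anorm b - anorm b'| <= anorm (b - a) + anorm (b' - a').
  have := anormD (b - a) a; have := anormD (a - b) b; rewrite !subrK.
  have := anormD (b' - a') a'; have := anormD (a' - b') b'; rewrite !subrK.
  rewrite (anormB a b) (anormB a' b') -E => h1 h2 h3 h4.
  by rewrite ler_norml; apply/andP; split; lra.
lra.
Qed.

Lemma Gbar_lin k a a' b b' : Gbar a a' -> Gbar b b' -> Gbar (k *: a + b) (k *: a' + b').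
Proof.
move=> ga gb e e0.
have n0 : 0 <= normc k by case: (k) => x y; exact: sqrtr_ge0.
have n1 : 0 < normc k + 1 by lra.
have [a0 [a0' [g0 h0 h0']]] := ga _ (divr_gt0 e0 (mulr_gt0 (ltr0n R 2) n1)).
have [b0 [b0' [g1 h1 h1']]] := gb _ (divr_gt0 e0 (ltr0n R 2)).
have bound x y : 0 <= x -> x < e / (2%:R * (normc k + 1)) -> y < e / 2%:R ->
    normc k * x + y < e.
  move=> x0; rewrite !ltr_pdivlMr ?mulr_gt0//; nra.
exists (k *: a0 + b0), (k *: a0' + b0'); split; first exact: Glin.
- by apply: le_lt_trans (anorm_lin _ _ _ _ _) _; apply: bound => //; exact: anorm_ge0.
- by apply: le_lt_trans (anorm_lin _ _ _ _ _) _; apply: bound => //; exact: anorm_ge0.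
Qed.

Lemma Gbar_mul a a' b b' : Gbar a a' -> Gbar b b' -> Gbar (amul a b) (amul a' b').
Proof.
move=> ga gb e e0.
pose K := anorm a + anorm a' + anorm b + anorm b' + 1.
have a0 := anorm_ge0 a; have a'0 := anorm_ge0 a'.
have b0 := anorm_ge0 b; have b'0 := anorm_ge0 b'.
have K1 : 1 <= K by rewrite /K; lra.
(* [de <= 1] bounds the approximating factors by the norms of the originals plus 1. The second bound
   makes the two error terms at most [de * K], and the factor 2 leaves room for a strict
   inequality. *)
pose de := Num.min 1 (e / (2%:R * K)).
have de0 : 0 < de by rewrite lt_min ltr01 divr_gt0// mulr_gt0//; lra.
have de1 : de <= 1 by rewrite ge_min lexx.
have deK : de * (2%:R * K) <= e by rewrite -ler_pdivlMr ?ge_min ?lexx ?orbT// mulr_gt0//; lra.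
have [x [x' [gx hx hx']]] := ga _ de0; have [y [y' [gy hy hy']]] := gb _ de0.
have bound p q r s u : 0 <= u -> 0 <= p -> p < de -> 0 <= q -> q < de ->
    r + s + 1 <= K -> 0 <= r -> 0 <= s -> u <= r + p -> p * s + u * q < e.
  move=> u0 p0 pd q0 qd rsK r0 s0 ur; nra.
exists (amul x y), (amul x' y'); split; first exact: Gmul.
- apply: le_lt_trans (anorm_mul_sub _ _ _ _) _.
  apply: (bound _ _ (anorm a)); rewrite ?anorm_ge0//; first by rewrite /K; lra.
  by rewrite -{1}(subrK a x) addrC (anormB a) anormD.
- apply: le_lt_trans (anorm_mul_sub _ _ _ _) _.
  apply: (bound _ _ (anorm a')); rewrite ?anorm_ge0//; first by rewrite /K; lra.
  by rewrite -{1}(subrK a' x') addrC (anormB a') anormD.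
Qed.

Lemma Gbar_G a a' : G a a' -> Gbar a a'.
Proof. by move=> g e e0; exists a, a'; rewrite !subrr !anorm0. Qed.

Lemma Gbar_star a a' : Gbar a a' -> Gbar (star a) (star a').
Proof.
move=> ga e e0; have [x [x' [gx hx hx']]] := ga _ e0.
have sB (D : cstarType R) (u v : D) : star (u - v) = star u - star v.
  by rewrite -scaleN1r addrC starP rmorphN rmorph1 scaleN1r addrC.
by exists (star x), (star x'); split; [exact: Gstar|rewrite -sB anorm_star..].
Qed.

(** The approximants of [b] in the domain of [G] form a Cauchy sequence; since [G] preserves
    distances, so do their partners, which converge by completeness of [B']. *)
Lemma Gbar_ex b : exists b', Gbar b b'.
Proof.
have ninv (e : R) : 0 < e -> exists N, forall n, (N <= n)%N -> n.+1%:R^-1 < e.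
  move=> e0; have [N _ H] := near_infty_natSinv_lt (PosNum e0).
  by exists N => n; exact: H.
have hn n : exists p : B * B', G p.1 p.2 /\ anorm (b - p.1) < n.+1%:R^-1.
  have n0 : 0 < n.+1%:R^-1 :> R by rewrite invr_gt0.
  by have [a [a' H]] := Gdense b n0; exists (a, a').
have [u uP] := choice hn.
have [|b' hb'] := @cstar_complete R B' (fun n => (u n).2).
  move=> e e0; have [N HN] := ninv _ (divr_gt0 e0 (ltr0n R 2)).
  exists N => m n Nm Nn; rewrite -(Gsub (uP m).1 (uP n).1).
  apply: le_lt_trans (anorm_tri b _ _) _; rewrite anormB.
  have := (uP m).2; have := (uP n).2; have := HN _ Nm; have := HN _ Nn.
  by move: (m.+1%:R^-1) (n.+1%:R^-1) => x y; lra.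
exists b' => e e0; have [N1 H1] := ninv _ e0; have [N2 H2] := hb' _ e0.
exists (u (maxn N1 N2)).1, (u (maxn N1 N2)).2; have [g h] := uP (maxn N1 N2).
split => //; first by apply: lt_trans h (H1 _ (leq_maxl _ _)).
by rewrite anormB; exact: H2 (leq_maxr _ _).
Qed.

(** By linearity 0 is related to the difference of the two values, whose norm is then 0. *)
Lemma Gbar_fun b b1 b2 : Gbar b b1 -> Gbar b b2 -> b1 = b2.
Proof.
move=> g1 g2; apply: anorm_small_eq => e e0.
have := Gbar_norm (Gbar_lin (-1) g2 g1).
rewrite !scaleN1r addNr anorm0 addrC => <-.
exact: e0.
Qed.

Lemma Gbar_inj b1 b2 b : Gbar b1 b -> Gbar b2 b -> b1 = b2.
Proof.
move=> g1 g2; apply: anorm_small_eq => e e0.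
have := Gbar_norm (Gbar_lin (-1) g2 g1).
rewrite !scaleN1r addNr anorm0 addrC => ->.
exact: e0.
Qed.

End ExtendIsomorphism.

Lemma dense_star_isomorphism (R : realType) (B B' : cstarType R) (G : B -> B' -> Prop) :
  (forall k a a' b b', G a a' -> G b b' -> G (k *: a + b) (k *: a' + b')) ->
  (forall a a' b b', G a a' -> G b b' -> G (amul a b) (amul a' b')) ->
  G (aone (s := B)) (aone (s := B')) ->
  (forall a a', G a a' -> G (star a) (star a')) ->
  (forall a a', G a a' -> anorm a = anorm a') ->
  (forall (b : B) (e : R), 0 < e -> exists a a', G a a' /\ anorm (b - a) < e) ->
  (forall (b : B') (e : R), 0 < e -> exists a a', G a a' /\ anorm (b - a') < e) ->
  exists V : B -> B', star_isomorphism V /\ forall a a', G a a' -> V a = a'.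
Proof.
move=> Gl Gm G1 Gs Gn Gd Gd'.
pose G' b' b := G b b'.
have Gl' k a a' b b' : G' a a' -> G' b b' -> G' (k *: a + b) (k *: a' + b') by exact: Gl.
have Gn' a a' : G' a a' -> anorm a = anorm a' by move=> g; rewrite (Gn _ _ g).
have Gd2 (b : B') (e : R) : 0 < e -> exists a a', G' a a' /\ anorm (b - a) < e.
  by move=> e0; have [a [a' H]] := Gd' b e e0; exists a', a.
have [V VP] := choice (Gbar_ex Gl Gn Gd).
have [W WP] := choice (Gbar_ex Gl' Gn' Gd2).
have WP' b' : Gbar G (W b') b'.
  by move=> e e0; have [a [a' [g h h']]] := WP b' e e0; exists a', a.
exists V; split; last first.
  by move=> a a' g; apply: (Gbar_fun Gl Gn (VP a)); exact: Gbar_G.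
split.
- exists W => b; first exact: (Gbar_inj Gl Gn (WP' _) (VP _)).
  exact: (Gbar_fun Gl Gn (VP _) (WP' _)).
- split.
  + by move=> k a b; apply: (Gbar_fun Gl Gn (VP _)); exact: Gbar_lin.
  + by move=> a b; apply: (Gbar_fun Gl Gn (VP _)); exact: Gbar_mul.
  + by apply: (Gbar_fun Gl Gn (VP _)); exact: Gbar_G.
  + by move=> a; apply: (Gbar_fun Gl Gn (VP _)); exact: Gbar_star.
- by move=> a; rewrite (Gbar_norm Gn (VP a)).
Qed.

(** * Comparison of the two constructions and of their limits *)

Section RescaledConstruction.
Context (R : realType) (M : choiceType) (d : M -> measure_display)
  (T : forall x, measurableType (d x)).
Variables (mu mu' : forall x, {measure set (T x) -> \bar R}) (c : R).
Hypothesis c_gt0 : 0 < c.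
Hypothesis mu'E : forall x A, measurable A -> mu' x A = (c%:E * mu x A)%E.

Definition rescale (lam : {fset M}) (psi : tensorL2 mu lam) : tensorL2 mu' lam :=
  (Num.sqrt c ^- #|` lam|)%:C *: same_vector mu' psi.

Definition rescale_op (lam : {fset M}) : opAlg mu lam -> opAlg mu' lam :=
  conj_op (@rescale lam).

Let scale (lam : {fset M}) : R := Num.sqrt c ^+ #|` lam|.

Let scale_gt0 lam : 0 < scale lam. Proof. by rewrite exprn_gt0// sqrtr_gt0. Qed.

Lemma rescale_hilbert_isomorphism lam : hilbert_isomorphism (@rescale lam).
Proof.
have dE := scale_tensor_dom c_gt0 mu'E lam.
have fE := @scale_tensor_ip _ _ _ _ mu mu' c c_gt0 mu'E lam.
have s0 := scale_gt0 lam.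
have dE' := esym dE.
have sK := @same_classK _ _ (tensor_kernel mu lam) (tensor_kernel mu' lam) _ s0 dE fE.
have s0' : 0 < (scale lam)^-1 by rewrite invr_gt0.
have fE' x y : tensor_dom mu' lam x -> tensor_dom mu' lam y ->
    tensor_ip mu lam x y = ((scale lam)^-1 ^+ 2)%:C * tensor_ip mu' lam x y.
  rewrite -dE => dx dy; rewrite fE// mulrA -rmorphM /= -exprMn mulVf ?gt_eqF//.
  by rewrite expr1n mul1r.
have sVK := @same_classK _ _ (tensor_kernel mu' lam) (tensor_kernel mu lam) _ s0' dE' fE'.
have sC : (scale lam)%:C != 0 :> R[i] by rewrite eq_complex /= gt_eqF.
have scE : (Num.sqrt c ^- #|` lam|)%:C = ((scale lam)%:C)^-1 :> R[i].
  by rewrite -fmorphV.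
split.
- exists (fun y => same_vector mu ((scale lam)%:C *: y : tensorL2 mu' lam)) => x.
    rewrite /rescale scE scalerA mulfV// scale1r; exact: sK.
  rewrite /rescale [X in _ *: X](sVK _) scalerA scE mulVf// scale1r//.
- move=> k x y; rewrite /rescale.
  rewrite [X in _ *: X](@same_class_linear _ _ (tensor_kernel mu lam)
    (tensor_kernel mu' lam) _ s0 dE fE) scalerDr.
  by rewrite !scalerA mulrC.
- move=> x y; rewrite /rescale innerZl innerZr.
  rewrite [X in _ * (_ * X)](@same_class_inner _ _ (tensor_kernel mu lam)
    (tensor_kernel mu' lam) _ s0 dE fE).
  rewrite !mulrA -[RHS]mul1r; congr (_ * _).
  have conjR (r : R) : Num.conj (r%:C : R[i]) = r%:C.
    by apply/eqP; rewrite eq_complex /= oppr0 !eqxx.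
  rewrite conjR.
  by rewrite -!rmorphM /= -expr2 -exprMn mulVf ?gt_eqF// expr1n.
Qed.

(** The scalar factors match because the cardinalities of [lam] and of its complement in [lam'] add
    up to that of [lam']. *)
Lemma rescale_tensor_mul (lam lam' : {fset M}) : (lam `<=` lam')%fset ->
  forall (xi : tensorL2 mu (lam' `\` lam)%fset) (psi : tensorL2 mu lam),
  rescale (tensor_mul (lam' := lam') xi psi) = tensor_mul (rescale xi) (rescale psi).
Proof.
move=> sub xi psi; rewrite /rescale tensor_mulZ// (same_class_tensor_mul _ _ c_gt0 mu'E sub).
have -> : #|` lam'| = (#|` (lam' `\` lam)%fset| + #|` lam|)%N.
  by rewrite cardfsDS// subnK// fsubset_leq_card.
by rewrite exprD invfM rmorphM.
Qed.

Lemma rescale_op_iso lam : star_isomorphism (@rescale_op lam).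
Proof. exact: conj_op_star_isomorphism (rescale_hilbert_isomorphism lam). Qed.

Lemma rescale_op_iota (lam lam' : {fset M}) : (lam `<=` lam')%fset ->
  forall a : opAlg mu lam, op_iota lam' (rescale_op a) = rescale_op (op_iota lam' a).
Proof.
move=> sub; apply: (op_iota_conj sub); try exact: rescale_hilbert_isomorphism.
exact: rescale_tensor_mul.
Qed.

Let uK lam := inverseVK (let: And3 b _ _ := rescale_op_iso lam in b).

Lemma op_iota_rescale (lam lam' : {fset M}) (a : opAlg mu' lam) : (lam `<=` lam')%fset ->
  op_iota lam' a = rescale_op (op_iota lam' (inverse (@rescale_op lam) a)).
Proof. by move=> sub; rewrite -rescale_op_iota// uK. Qed.

Lemma state_proj_rescale (lam lam' : {fset M}) (s : opAlg mu' lam' -> R[i]) :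
  (lam `<=` lam')%fset ->
  state_proj s = pull_state (inverse (@rescale_op lam))
    (state_proj (pull_state (@rescale_op lam') s) : opAlg mu lam -> R[i]).
Proof.
by move=> sub; apply/funext => a; rewrite /state_proj /pull_state /= (op_iota_rescale a sub).
Qed.

Lemma states_rescale lam (s : opAlg mu' lam -> R[i]) :
  states s -> states (pull_state (@rescale_op lam) s).
Proof. exact: (pull_state_states (rescale_op_iso lam)). Qed.

Definition pull_states (s : forall lam, opAlg mu' lam -> R[i]) lam : opAlg mu lam -> R[i] :=
  pull_state (@rescale_op lam) (s lam).

Lemma quantum_states_rescale : set_bij (quantum_states mu') (quantum_states mu) pull_states.
Proof.
have VK lam := inverseK (let: And3 b _ _ := rescale_op_iso lam in b).
split.
- move=> s [ss sp]; split => [lam|lam lam' sub]; first exact: states_rescale.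
  apply/funext => a; rewrite /state_proj /pull_states /pull_state /=.
  by rewrite -rescale_op_iota// -(sp lam lam' sub).
- move=> s t _ _ st; apply: functional_extensionality_dep => lam; apply/funext => a.
  by have := congr1 (fun f => f lam (inverse (@rescale_op lam) a)) st;
    rewrite /pull_states /pull_state /= uK.
- move=> s [ss sp]; exists (fun lam => pull_state (inverse (@rescale_op lam)) (s lam)).
    split => [lam|lam lam' sub].
      exact: (pull_state_states (star_isomorphism_inverse (rescale_op_iso lam)) (ss lam)).
    apply/funext => a; rewrite /state_proj /pull_state /= op_iota_rescale// VK.
    by rewrite -(sp lam lam' sub).
  apply: functional_extensionality_dep => lam; apply/funext => a.
  by rewrite /pull_states /pull_state /= VK.
Qed.

Section InductiveLimit.
Variables (B B' : cstarType R).
Variables (j : forall lam, opAlg mu lam -> B) (j' : forall lam, opAlg mu' lam -> B').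
Hypotheses (Bj : inductive_limit j) (B'j' : inductive_limit j').

Let G (b : B) (b' : B') : Prop :=
  exists lam (a : opAlg mu lam), b = j a /\ b' = j' (rescale_op a).

Let G_widen lam lam' (a : opAlg mu lam) : (lam `<=` lam')%fset ->
  j a = j (op_iota lam' a) /\ j' (rescale_op a) = j' (rescale_op (op_iota lam' a)).
Proof.
move=> sub; have [_ ji _] := Bj; have [_ ji' _] := B'j'.
by rewrite (ji _ _ sub) -rescale_op_iota// (ji' _ _ sub).
Qed.

(** Related pairs coming from different finite sets are moved to the union of these sets, where the
    algebraic operations can be performed. *)
Let G2 b b' c0 c' : G b b' -> G c0 c' -> exists lam (a1 a2 : opAlg mu lam),
  [/\ b = j a1, b' = j' (rescale_op a1), c0 = j a2 & c' = j' (rescale_op a2)].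
Proof.
move=> [l1 [a1 [-> ->]]] [l2 [a2 [-> ->]]]; pose l := (l1 `|` l2)%fset.
have [e1 e1'] := G_widen a1 (fsubsetUl l1 l2).
have [e2 e2'] := G_widen a2 (fsubsetUr l1 l2).
exists l, (op_iota l a1), (op_iota l a2).
by split; [exact: e1|exact: e1'|exact: e2|exact: e2'].
Qed.

Lemma limit_isomorphism : exists V : B -> B', star_isomorphism V /\
  forall lam (a : opAlg mu lam), V (j a) = j' (rescale_op a).
Proof.
have [jm _ jd] := Bj; have [jm' _ jd'] := B'j'.
have [V [Vi VG]] : exists V : B -> B', star_isomorphism V /\ forall b b', G b b' -> V b = b'.
  apply: dense_star_isomorphism.
  - move=> k b b' c0 c' g1 g2; have [l [a1 [a2 [-> -> -> ->]]]] := G2 g1 g2.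
    have [[jl _ _ _] _] := jm l; have [[jl' _ _ _] _] := jm' l.
    have [_ [ul _ _ _] _] := rescale_op_iso l.
    by exists l, (k *: a1 + a2); rewrite jl ul jl'.
  - move=> b b' c0 c' g1 g2; have [l [a1 [a2 [-> -> -> ->]]]] := G2 g1 g2.
    have [[_ jM _ _] _] := jm l; have [[_ jM' _ _] _] := jm' l.
    have [_ [_ uM _ _] _] := rescale_op_iso l.
    by exists l, (amul a1 a2); rewrite jM uM jM'.
  - have [[_ _ j1 _] _] := jm fset0; have [[_ _ j1' _] _] := jm' fset0.
    have [_ [_ _ u1 _] _] := rescale_op_iso fset0.
    by exists fset0, aone; rewrite j1 u1 j1'.
  - move=> b b' [l [a [-> ->]]].
    have [[_ _ _ jS] _] := jm l; have [[_ _ _ jS'] _] := jm' l.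
    have [_ [_ _ _ uS] _] := rescale_op_iso l.
    by exists l, (star a); rewrite jS uS jS'.
  - move=> b b' [l [a [-> ->]]]; have [_ jn] := jm l; have [_ jn'] := jm' l.
    by have [_ _ un] := rescale_op_iso l; rewrite jn jn' un.
  - move=> b e e0; have [l [a ba]] := jd b e e0.
    by exists (j a), (j' (rescale_op a)); split => //; exists l, a.
  - move=> b e e0; have [l [a ba]] := jd' b e e0.
    exists (j (inverse (@rescale_op l) a)), (j' a); split => //.
    by exists l, (inverse (@rescale_op l) a); rewrite uK.
by exists V; split => // lam a; apply: VG; exists lam, a.
Qed.

Lemma limit_state_unique (s : forall lam, opAlg mu lam -> R[i]) (t t' : B -> R[i]) :
  states t -> (forall lam (a : opAlg mu lam), t (j a) = s lam a) ->
  states t' -> (forall lam (a : opAlg mu lam), t' (j a) = s lam a) -> t = t'.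
Proof.
move=> ts tj ts' tj'; have [_ _ jd] := Bj.
apply: (states_dense_eq (D := [set b | exists lam (a : opAlg mu lam), b = j a]) ts ts').
  by move=> b e e0; have [l [a ba]] := jd b e e0; exists (j a) => //; exists l, a.
by move=> _ [l [a ->]]; rewrite tj tj'.
Qed.

End InductiveLimit.
End RescaledConstruction.

Section LimitStates.
Context (R : realType) (M : choiceType) (d : M -> measure_display)
  (T : forall x, measurableType (d x)).
Variables (mu mu' : forall x, {measure set (T x) -> \bar R}) (c : R).
Hypothesis c_gt0 : 0 < c.
Hypothesis mu'E : forall x A, measurable A -> mu' x A = (c%:E * mu x A)%E.
Variables (B B' : cstarType R).
Variables (j : forall lam, opAlg mu lam -> B) (j' : forall lam, opAlg mu' lam -> B').
Hypotheses (Bj : inductive_limit j) (B'j' : inductive_limit j').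
Variable V : B -> B'.
Hypothesis Vi : star_isomorphism V.
Hypothesis Vj : forall lam (a : opAlg mu lam), V (j a) = j' (rescale_op mu' c a).

(** Pulling back along [V] and along its inverse matches the states on [B'] that extend [s] with the
    states on [B] that extend its pull-back. Such states are unique by density. *)
Lemma limit_state_rescale (s : forall lam, opAlg mu' lam -> R[i]) (b : B) :
  limit_state j (pull_states c s) b = limit_state j' s (V b).
Proof.
have Vb : bijective V by case: Vi.
have uK lam := inverseVK (let: And3 b _ _ := rescale_op_iso c_gt0 mu'E lam in b).
have fwd (t : B' -> R[i]) : states t /\ (forall lam (a : opAlg mu' lam), t (j' a) = s lam a) ->
    states (pull_state V t) /\
    (forall lam (a : opAlg mu lam), pull_state V t (j a) = pull_states c s a).
  move=> [ts tj]; split; first exact: pull_state_states.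
  by move=> lam a; rewrite /pull_state /= Vj tj.
have bwd (t : B -> R[i]) :
    states t /\ (forall lam (a : opAlg mu lam), t (j a) = pull_states c s a) ->
    states (pull_state (inverse V) t) /\
    (forall lam (a : opAlg mu' lam), pull_state (inverse V) t (j' a) = s lam a).
  move=> [ts tj]; split; first exact: (pull_state_states (star_isomorphism_inverse Vi) ts).
  move=> lam a; rewrite /pull_state /= -{1}(uK lam a) -Vj (inverseK Vb) tj.
  by rewrite /pull_states /pull_state /= uK.
have [[t tP]|nt] := pselect (exists t : B' -> R[i],
    states t /\ forall lam (a : opAlg mu' lam), t (j' a) = s lam a).
  have -> : limit_state j' s = t.
    apply: xget_unique => // t' [t's t'j]; case: tP => ts tj.
    exact: (limit_state_unique B'j' t's t'j ts tj).
  have [pts ptj] := fwd t tP.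
  rewrite (_ : limit_state j (pull_states c s) = pull_state V t)//.
  apply: xget_unique => // t' [t's t'j].
  exact: (limit_state_unique Bj t's t'j pts ptj).
(* Without an extending state on either side, both choices give the zero functional. *)
rewrite /limit_state xgetPN ?[X in _ = X _]xgetPN//.
  by move=> t tP; apply: nt; exists t.
by move=> t /bwd tP; apply: nt; exists (pull_state (inverse V) t).
Qed.

End LimitStates.

Theorem mainTheorem4 (R : realType) (p p' : nat) (dim_gt0 : (0 < p + p')%N)
    (M : manifold R (p + p'))
    (mu mu' : measure_field M)
    (mu_inv : invariant_field mu) (mu'_inv : invariant_field mu')
    (B B' : cstarType R)
    (j : forall lam : {fset M}, opAlg mu lam -> B)
    (j' : forall lam : {fset M}, opAlg mu' lam -> B')
    (B_lim : inductive_limit j) (B'_lim : inductive_limit j') :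
  exists2 c : R, 0 < c &
    let U (lam : {fset M}) : tensorL2 mu lam -> tensorL2 mu' lam :=
      fun psi => (Num.sqrt c ^- #|` lam|)%:C *: same_vector mu' psi in
    let u (lam : {fset M}) : opAlg mu lam -> opAlg mu' lam := conj_op (U lam) in
    let pull_states (s : forall lam : {fset M}, opAlg mu' lam -> R[i]) :
        forall lam : {fset M}, opAlg mu lam -> R[i] :=
      fun lam => pull_state (u lam) (s lam) in
    [/\ forall (x : M) (A : set (gammaB p p' (tangent x))), measurable A ->
          mu' x A = (c%:E * mu x A)%E,
        (forall lam : {fset M},
           hilbert_isomorphism (U lam) /\ star_isomorphism (u lam)) /\
        (forall lam lam' : {fset M}, (lam `<=` lam')%fset ->
           (forall a : opAlg mu' lam,
              op_iota lam' a = u lam' (op_iota lam' (inverse (u lam) a))) /\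
           (forall s : opAlg mu' lam' -> R[i], states s ->
              state_proj s = pull_state (inverse (u lam))
                               (state_proj (pull_state (u lam') s)
                                 : opAlg mu lam -> R[i])))
      & (forall (lam : {fset M}) (s : opAlg mu' lam -> R[i]),
           states s -> states (pull_state (u lam) s)) /\
        (exists V : B -> B',
          [/\ star_isomorphism V,
              forall (lam : {fset M}) (a : opAlg mu lam),
                V (j lam a) = j' lam (u lam a),
              set_bij (quantum_states mu') (quantum_states mu) pull_states
            & forall s, quantum_states mu' s -> forall a : B,
                limit_state j (pull_states s) a = limit_state j' s (V a)])].
Proof.
have [c c0 cE] := invariant_fields_proportional mu_inv mu'_inv.
exists c => //; move=> U u pull.
have [V [Vi Vj]] := limit_isomorphism c0 cE B_lim B'_lim.
split=> //; split.
- move=> lam; split; first exact: (rescale_hilbert_isomorphism c0 cE lam).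
  exact: (rescale_op_iso c0 cE lam).
- move=> lam lam' sub; split => [a|s _]; first exact: (op_iota_rescale c0 cE a sub).
  exact: (state_proj_rescale c0 cE s sub).
- by move=> lam s; exact: (states_rescale c0 cE).
- exists V; split => //; first exact: (quantum_states_rescale c0 cE).
  by move=> s _ b; exact: (limit_state_rescale c0 cE B_lim B'_lim Vi Vj).
Qed.
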